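(* Let $r_1,r_2>0$ and let $H$ be a harmonic function on $\mathbb{R}^2$. For $\epsilon>0$ let $B_j=B(\mathbf{c}_j,r_j)$, $j=1,2$, be two open disks with centers $\mathbf{c}_j$ and radii $r_j$ whose closures are disjoint and whose distance is $\epsilon$. Let $u$ be the solution to $$\Delta u=0 \text{ in } \mathbb{R}^2\setminus\overline{B_1\cup B_2},\qquad u|_{\partial B_j}=\lambda_j \ (\text{constant}),\ j=1,2,\qquad u(\mathbf{x})-H(\mathbf{x})=O(|\mathbf{x}|^{-1}) \text{ as } |\mathbf{x}|\to\infty,$$ where the constants $\lambda_j$ are determined by $\int_{\partial B_j}\frac{\partial u}{\partial\nu}\big|_+\,ds=0$, $j=1,2$. Let $\mathbf{p}_1,\mathbf{p}_2,h,\mathbf{n},\mathbf{p}$ be as in the context. Then $$u(\mathbf{x})=a\,h(\mathbf{x})+b(\mathbf{x}),\qquad a=\frac{4\pi r_1r_2}{r_1+r_2}\,(\mathbf{n}\cdot\nabla H)(\mathbf{p}),$$ and for any bounded set $\Omega$ containing $\overline{B_1}$ and $\overline{B_2}$ there is a constant $C$ independent of $\epsilon$ such that $$\|\nabla b\|_{L^\infty(\Omega\setminus(B_1\cup B_2))}\le C.$$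
   Context: $\nu$ denotes the outward unit normal of $\mathbb{R}^2\setminus\overline{B_1\cup B_2}$ (directed into $B_j$ on $\partial B_j$), and $|_+$ denotes the limit from outside the disks. For $j=1,2$, $R_j(\mathbf{x})=\frac{r_j^2(\mathbf{x}-\mathbf{c}_j)}{|\mathbf{x}-\mathbf{c}_j|^2}+\mathbf{c}_j$ is the reflection with respect to $\partial B_j$. $\mathbf{p}_1$ is the unique fixed point of $R_1R_2$ and $\mathbf{p}_2$ the unique fixed point of $R_2R_1$. Define $h(\mathbf{x})=\frac{1}{2\pi}\left(\log|\mathbf{x}-\mathbf{p}_1|-\log|\mathbf{x}-\mathbf{p}_2|\right)$. $\mathbf{n}$ is the unit vector in the direction of $\mathbf{p}_2-\mathbf{p}_1$, and $\mathbf{p}$ is the midpoint of the shortest line segment connecting $\partial B_1$ and $\partial B_2$. The constant $C$ may depend on $r_1,r_2,H,\Omega$ but not on $\epsilon$. *)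

(* Defs.v *)
From Stdlib Require Import Reals.
From Coquelicot Require Import Coquelicot.
Open Scope R_scope.

Definition pt := (R * R)%type.
Definition padd (p q : pt) : pt := (fst p + fst q, snd p + snd q).
Definition psub (p q : pt) : pt := (fst p - fst q, snd p - snd q).
Definition pscal (a : R) (p : pt) : pt := (a * fst p, a * snd p).
Definition pdot (p q : pt) : R := fst p * fst q + snd p * snd q.
Definition pnorm (p : pt) : R := sqrt (fst p ^ 2 + snd p ^ 2).
Definition pdist (p q : pt) : R := pnorm (psub p q).

Definition dx (f : pt -> R) (p : pt) : R := Derive (fun t => f (t, snd p)) (fst p).
Definition dy (f : pt -> R) (p : pt) : R := Derive (fun t => f (fst p, t)) (snd p).
Definition grad (f : pt -> R) (p : pt) : pt := (dx f p, dy f p).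

Definition C2_on (U : pt -> Prop) (f : pt -> R) : Prop :=
  forall p, U p ->
    ex_derive (fun t => f (t, snd p)) (fst p) /\
    ex_derive (fun t => f (fst p, t)) (snd p) /\
    ex_derive (fun t => dx f (t, snd p)) (fst p) /\
    ex_derive (fun t => dx f (fst p, t)) (snd p) /\
    ex_derive (fun t => dy f (t, snd p)) (fst p) /\
    ex_derive (fun t => dy f (fst p, t)) (snd p) /\
    continuous f p /\ continuous (dx f) p /\ continuous (dy f) p /\
    continuous (dx (dx f)) p /\ continuous (dy (dx f)) p /\
    continuous (dx (dy f)) p /\ continuous (dy (dy f)) p.

Definition harmonic_on (U : pt -> Prop) (f : pt -> R) : Prop :=
  C2_on U f /\ forall p, U p -> dx (dx f) p + dy (dy f) p = 0.

Definition reflect (c : pt) (r : R) (x : pt) : pt :=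
  padd (pscal (r ^ 2 / (pnorm (psub x c)) ^ 2) (psub x c)) c.

Definition ext2 (c1 : pt) (r1 : R) (c2 : pt) (r2 : R) (x : pt) : Prop :=
  r1 < pdist x c1 /\ r2 < pdist x c2.

Definition circ (c : pt) (r th : R) : pt := padd c (pscal r (cos th, sin th)).
Definition nu_in (th : R) : pt := (- cos th, - sin th).

(* int_{dB(c,r)} du/dnu|_+ ds = 0, with du/dnu|_+ the limit from the exterior
   E of grad u . nu, and ds = r dth. *)
Definition zero_flux (E : pt -> Prop) (c : pt) (r : R) (u : pt -> R) : Prop :=
  exists g : R -> R,
    (forall th, filterlim (fun x => pdot (grad u x) (nu_in th))
                  (within E (locally (circ c r th))) (locally (g th))) /\
    is_RInt (V := R_NormedModule) (fun th => g th * r) 0 (2 * PI) 0.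

Definition is_solution (c1 : pt) (r1 : R) (c2 : pt) (r2 : R) (H : pt -> R)
    (u : pt -> R) (lam1 lam2 : R) : Prop :=
  let E := ext2 c1 r1 c2 r2 in
  harmonic_on E u /\
  (forall y, pdist y c1 = r1 -> filterlim u (within E (locally y)) (locally lam1)) /\
  (forall y, pdist y c2 = r2 -> filterlim u (within E (locally y)) (locally lam2)) /\
  (exists M R0, 0 < R0 /\
     forall x, R0 <= pnorm x -> Rabs (u x - H x) <= M / pnorm x) /\
  zero_flux E c1 r1 u /\ zero_flux E c2 r2 u.

Definition hfun (p1 p2 : pt) (x : pt) : R :=
  (ln (pdist x p1) - ln (pdist x p2)) / (2 * PI).

Definition nvec (p1 p2 : pt) : pt := pscal (/ pdist p2 p1) (psub p2 p1).

(* Midpoint of the shortest segment joining dB(c1,r1) and dB(c2,r2)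
   (disjoint closures): that segment runs from c1 + r1 e to c2 - r2 e,
   e = (c2 - c1)/|c2 - c1|. *)
Definition midgap (c1 : pt) (r1 : R) (c2 : pt) (r2 : R) : pt :=
  let e := pscal (/ pdist c2 c1) (psub c2 c1) in
  pscal (1 / 2) (padd (padd c1 (pscal r1 e)) (psub c2 (pscal r2 e))).

Definition acoef (r1 r2 : R) (H : pt -> R) (c1 c2 p1 p2 : pt) : R :=
  4 * PI * r1 * r2 / (r1 + r2) * pdot (nvec p1 p2) (grad H (midgap c1 r1 c2 r2)).

(* Main.v *)
Require Import Defs.
From Stdlib Require Import Reals Lra Lia Psatz Classical ClassicalEpsilon List.
From Coquelicot Require Import Coquelicot.
Open Scope R_scope.

(** The function h takes constant values h1 and h2 on the two circles, so with
    alpha = (lam2 - lam1) / (h2 - h1) the harmonic function b0 = u - alpha h takes one and the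
    same value kappa on both of them. A function with equal boundary values has a bounded
    gradient, by the maximum principle alone: b0 - H decays at infinity, which bounds kappa and
    b0; comparison of b0 - kappa with multiples of ln (|x - c_j| / r_j) gives
    |b0 - kappa| <= C dist(x, B_j) for both j, and the interior gradient estimate on a ball
    of radius dist(x, B_1 u B_2) concludes.

    It remains to compare alpha with a. The method of images gives
    lam2 - lam1 = H(p2) - H(p1): the alternating sums of H over words in the reflections R1, R2
    have zero flux through the first circle and converge on the two circles to H(p1) and H(p2),
    up to a common constant, so that what is left of u is a multiple of h, and h has nonzero
    flux. With L = |p1 - p2| one then finds alpha - a = O(L), while grad h = O(1 / L). *)

(** * The Euclidean plane *)

(** The flux condition only concerns limits of [grad u] at the circles, and [u] is not known to be
    smooth up to them, so no divergence theorem is applied to [u]. Instead, an error of size delta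
    that vanishes on the first circle has normal derivative O(delta) there, by a logarithmic
    barrier; at fixed eps the constant may depend on eps, since delta tends to 0.

    Uniformity in eps is at stake for the function with equal boundary values. There the barrier
    lives in an annulus of fixed width, although the other disk cuts into it: the function vanishes
    on both circles, so the comparison survives.

    The asymptotics are carried out in L rather than eps. From h one gets alpha = 2 pi (H(p2) -
    H(p1)) / Lam, and p1, p2 being inverse points of each circle gives Lam = L (1 / (2 r1) + 1 / (2
    r2)) + O(L^2); this is the origin of 4 pi r1 r2 / (r1 + r2). The point p lies between p1 and p2,
    so evaluating the derivative of H there costs O(L). Finally |grad h| = L / (2 pi |x - p1| |x -
    p2|), and each p_j is at distance at least a multiple of L from the exterior. *)

Lemma pnorm_ge_0 p : 0 <= pnorm p.
Proof. apply sqrt_pos. Qed.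

Lemma pnorm_sqr p : pnorm p * pnorm p = fst p ^ 2 + snd p ^ 2.
Proof. unfold pnorm. apply sqrt_sqrt. nra. Qed.

Lemma pnorm_fst p : Rabs (fst p) <= pnorm p.
Proof.
  apply Rsqr_incr_0; auto using Rabs_pos, pnorm_ge_0.
  unfold Rsqr. rewrite pnorm_sqr, <- Rabs_mult, Rabs_pos_eq; nra.
Qed.

Lemma pnorm_snd p : Rabs (snd p) <= pnorm p.
Proof.
  apply Rsqr_incr_0; auto using Rabs_pos, pnorm_ge_0.
  unfold Rsqr. rewrite pnorm_sqr, <- Rabs_mult, Rabs_pos_eq; nra.
Qed.

Lemma pnorm_le_abs p : pnorm p <= Rabs (fst p) + Rabs (snd p).
Proof.
  pose proof (Rabs_pos (fst p)). pose proof (Rabs_pos (snd p)).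
  apply Rsqr_incr_0; auto using pnorm_ge_0; [|lra].
  unfold Rsqr. rewrite pnorm_sqr.
  assert (Rabs (fst p) * Rabs (fst p) = fst p ^ 2)
    by (rewrite <- Rabs_mult, Rabs_pos_eq; nra).
  assert (Rabs (snd p) * Rabs (snd p) = snd p ^ 2)
    by (rewrite <- Rabs_mult, Rabs_pos_eq; nra).
  nra.
Qed.

Lemma pnorm_eq_nonneg p c : 0 <= c -> fst p ^ 2 + snd p ^ 2 = c ^ 2 -> pnorm p = c.
Proof. intros Hc E. unfold pnorm. rewrite E. now apply sqrt_pow2. Qed.

Lemma pnorm_triangle p q : pnorm (padd p q) <= pnorm p + pnorm q.
Proof.
  pose proof (pnorm_ge_0 p). pose proof (pnorm_ge_0 q).
  apply Rsqr_incr_0; auto using pnorm_ge_0; [|lra].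
  unfold Rsqr. rewrite pnorm_sqr.
  pose proof (pnorm_sqr p). pose proof (pnorm_sqr q).
  destruct p as [a b], q as [c d]; simpl in *.
  set (m := pnorm (a, b)) in *. set (n := pnorm (c, d)) in *.
  assert (a * c + b * d <= m * n).
  { apply Rsqr_incr_0_var; [|nra]. unfold Rsqr.
    replace (m * n * (m * n)) with ((m * m) * (n * n)) by ring.
    rewrite H1, H2. assert (0 <= (a * d - b * c) ^ 2) by apply pow2_ge_0. nra. }
  nra.
Qed.

Lemma pdist_ge_0 p q : 0 <= pdist p q.
Proof. apply pnorm_ge_0. Qed.

Lemma pdist_sym p q : pdist p q = pdist q p.
Proof. unfold pdist, pnorm, psub; simpl; f_equal; ring. Qed.

Lemma pdist_triangle p q s : pdist p s <= pdist p q + pdist q s.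
Proof.
  unfold pdist. replace (psub p s) with (padd (psub p q) (psub q s)).
  - apply pnorm_triangle.
  - unfold psub, padd; simpl; f_equal; ring.
Qed.

Lemma pdist_sqr p q : pdist p q * pdist p q = (fst p - fst q) ^ 2 + (snd p - snd q) ^ 2.
Proof. unfold pdist. rewrite pnorm_sqr. reflexivity. Qed.

Lemma pdist_refl p : pdist p p = 0.
Proof. apply pnorm_eq_nonneg; [lra|]. simpl. ring. Qed.

Lemma pdist_eq_0 p q : pdist p q = 0 -> p = q.
Proof.
  intros E. pose proof (pdist_sqr p q) as S. rewrite E in S.
  destruct p as [a b], q as [c d]; simpl in *.
  destruct (Rplus_sqr_eq_0 (a - c) (b - d)) as [? ?]; [unfold Rsqr; lra|].
  f_equal; lra.
Qed.

Lemma pnorm_pscal k p : pnorm (pscal k p) = Rabs k * pnorm p.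
Proof.
  apply pnorm_eq_nonneg.
  - apply Rmult_le_pos; auto using Rabs_pos, pnorm_ge_0.
  - simpl fst; simpl snd. pose proof (pnorm_sqr p).
    assert (Rabs k * Rabs k = k * k) by (rewrite <- Rabs_mult, Rabs_pos_eq; nra).
    nra.
Qed.

Lemma pnorm_dist_0 p : pnorm p = pdist p (0, 0).
Proof. unfold pdist, pnorm, psub; simpl; f_equal; ring. Qed.

Lemma pnorm_le_dist p q : pnorm p <= pnorm q + pdist p q.
Proof. rewrite !pnorm_dist_0. pose proof (pdist_triangle p q (0,0)). lra. Qed.

(** Balls of the product structure on [R * R] are squares. Squares and Euclidean disks contain one
    another up to a factor, so every later neighbourhood can be taken to be a disk. *)
Lemma locally_pdist (p : pt) (P : pt -> Prop) :
  locally p P <-> exists d, 0 < d /\ forall q, pdist q p < d -> P q.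
Proof.
  split.
  - intros [d Hd]. exists d. split; [apply cond_pos|]. intros q Hq. apply Hd.
    split; change (Rabs (minus (fst q) (fst p)) < d) || change (Rabs (minus (snd q) (snd p)) < d);
    unfold minus, plus, opp; simpl.
    + pose proof (pnorm_fst (psub q p)). simpl in H. unfold pdist in Hq. unfold Rminus in *; lra.
    + pose proof (pnorm_snd (psub q p)). simpl in H. unfold pdist in Hq. unfold Rminus in *; lra.
  - intros [d [Hd H]]. assert (H2 : 0 < d / 2) by lra.
    exists (mkposreal _ H2). intros q [H3 H4]. apply H.
    change (Rabs (minus (fst q) (fst p)) < d / 2) in H3.
    change (Rabs (minus (snd q) (snd p)) < d / 2) in H4.
    unfold minus, plus, opp in H3, H4; simpl in H3, H4.
    pose proof (pnorm_le_abs (psub q p)). unfold pdist. simpl in H0. unfold Rminus in *. lra.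
Qed.

Definition popen (U : pt -> Prop) := forall p, U p -> locally p U.

Lemma popen_lt_dist c r : popen (fun x => r < pdist x c).
Proof.
  intros p Hp. apply locally_pdist. exists (pdist p c - r). split; [lra|].
  intros q Hq. pose proof (pdist_triangle p q c). rewrite (pdist_sym p q) in H. lra.
Qed.

Lemma popen_dist_lt c r : popen (fun x => pdist x c < r).
Proof.
  intros p Hp. apply locally_pdist. exists (r - pdist p c). split; [lra|].
  intros q Hq. pose proof (pdist_triangle q p c). lra.
Qed.

Lemma popen_and U V : popen U -> popen V -> popen (fun x => U x /\ V x).
Proof. intros HU HV p [Hu Hv]. apply filter_and; auto. Qed.

Lemma popen_True : popen (fun _ => True).
Proof. intros p _. apply filter_true. Qed.

Lemma popen_ext2 c1 r1 c2 r2 : popen (ext2 c1 r1 c2 r2).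
Proof. apply (popen_and (fun x => r1 < pdist x c1) (fun x => r2 < pdist x c2));
  apply popen_lt_dist. Qed.

(** * Differentials and harmonic functions *)

(** Total differentiability is stable under composition, which existence of both partial derivatives
    is not. It also pins down [dx] and [dy], which are total functions with a meaningless value
    where no derivative exists. *)
Definition hasgrad (F : pt -> R) (p : pt) (a b : R) : Prop :=
  differentiable_pt_lim (fun x y => F (x, y)) (fst p) (snd p) a b.

Lemma hasgrad_dx F p a b : hasgrad F p a b -> dx F p = a.
Proof. intros H. exact (proj1 (differentiable_pt_lim_unique _ _ _ _ _ H)). Qed.

Lemma hasgrad_dy F p a b : hasgrad F p a b -> dy F p = b.
Proof. intros H. exact (proj2 (differentiable_pt_lim_unique _ _ _ _ _ H)). Qed.

Lemma hasgrad_eq F p a b a' b' : hasgrad F p a b -> a = a' -> b = b' -> hasgrad F p a' b'.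
Proof. now intros H -> ->. Qed.

Lemma continuous_2d (F : pt -> R) (p : pt) :
  continuous F p <-> continuity_2d_pt (fun x y => F (x, y)) (fst p) (snd p).
Proof.
  rewrite continuity_2d_pt_filterlim. destruct p as [x y]; simpl. unfold continuous.
  split; intros H.
  - eapply filterlim_ext; [|exact H]. now intros [].
  - eapply filterlim_ext; [|exact H]. now intros [].
Qed.

Lemma hasgrad_continuous F p a b : hasgrad F p a b -> continuous F p.
Proof.
  intros H. apply continuous_2d. apply differentiable_continuity_pt.
  exists a, b. exact H.
Qed.

Lemma locally_2d_pt (P : pt -> Prop) p :
  locally p P -> locally_2d (fun x y => P (x, y)) (fst p) (snd p).
Proof.
  intros H. apply locally_2d_locally. destruct p as [x y].
  eapply filter_imp; [|exact H]. now intros [].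
Qed.

Lemma hasgrad_ext F G p a b : locally p (fun q => F q = G q) -> hasgrad F p a b -> hasgrad G p a b.
Proof.
  intros L H. apply differentiable_pt_lim_ext with (2 := H).
  now apply (locally_2d_pt (fun q => F q = G q)).
Qed.

Lemma hasgrad_comp (G F1 F2 : pt -> R) p a b a1 b1 a2 b2 :
  hasgrad G (F1 p, F2 p) a b -> hasgrad F1 p a1 b1 -> hasgrad F2 p a2 b2 ->
  hasgrad (fun q => G (F1 q, F2 q)) p (a * a1 + b * a2) (a * b1 + b * b2).
Proof.
  intros HG H1 H2. unfold hasgrad in *. destruct p as [x y]; simpl in *.
  apply (differentiable_pt_lim_comp (fun x y => G (x, y)) (fun x y => F1 (x, y))
           (fun x y => F2 (x, y))); assumption.
Qed.

Lemma is_derive_line (F : pt -> R) (k l : R -> R) t a b k' l' :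
  hasgrad F (k t, l t) a b -> is_derive k t k' -> is_derive l t l' ->
  is_derive (fun s => F (k s, l s)) t (a * k' + b * l').
Proof.
  intros H Hk Hl. apply is_derive_Reals.
  apply (derivable_pt_lim_comp_2d (fun x y => F (x, y))); auto; now apply is_derive_Reals.
Qed.

Lemma hasgrad_comp1 (f : R -> R) (F : pt -> R) p d a b :
  is_derive f (F p) d -> hasgrad F p a b -> hasgrad (fun q => f (F q)) p (d * a) (d * b).
Proof.
  intros Hf HF. eapply hasgrad_eq.
  - apply (hasgrad_comp (fun q => f (fst q)) F F p d 0 a b a b); auto.
    unfold hasgrad; simpl. apply differentiable_pt_lim_proj1_0. now apply is_derive_Reals.
  - ring.
  - ring.
Qed.

Lemma hasgrad_const c p : hasgrad (fun _ => c) p 0 0.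
Proof.
  intros eps. exists (mkposreal 1 Rlt_0_1). intros u v _ _.
  replace (c - c - _) with 0 by ring. rewrite Rabs_R0.
  apply Rmult_le_pos; [left; apply cond_pos|].
  eapply Rle_trans; [apply Rabs_pos | apply Rmax_l].
Qed.

Lemma hasgrad_fst p : hasgrad fst p 1 0.
Proof.
  intros eps. exists (mkposreal 1 Rlt_0_1). intros u v _ _. simpl.
  replace (u - fst p - _) with 0 by ring. rewrite Rabs_R0.
  apply Rmult_le_pos; [left; apply cond_pos|].
  eapply Rle_trans; [apply Rabs_pos | apply Rmax_l].
Qed.

Lemma hasgrad_snd p : hasgrad snd p 0 1.
Proof.
  intros eps. exists (mkposreal 1 Rlt_0_1). intros u v _ _. simpl.
  replace (v - snd p - _) with 0 by ring. rewrite Rabs_R0.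
  apply Rmult_le_pos; [left; apply cond_pos|].
  eapply Rle_trans; [apply Rabs_pos | apply Rmax_l].
Qed.

Lemma hasgrad_plus F G p a b c d :
  hasgrad F p a b -> hasgrad G p c d -> hasgrad (fun q => F q + G q) p (a + c) (b + d).
Proof.
  intros HF HG eps. assert (He : 0 < eps / 2) by (pose proof (cond_pos eps); lra).
  destruct (HF (mkposreal _ He)) as [d1 H1]. destruct (HG (mkposreal _ He)) as [d2 H2].
  exists (mkposreal _ (Rmin_stable_in_posreal d1 d2)). simpl. intros u v Hu Hv.
  assert (A1 := H1 u v (Rlt_le_trans _ _ _ Hu (Rmin_l _ _)) (Rlt_le_trans _ _ _ Hv (Rmin_l _ _))).
  assert (A2 := H2 u v (Rlt_le_trans _ _ _ Hu (Rmin_r _ _)) (Rlt_le_trans _ _ _ Hv (Rmin_r _ _))).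
  simpl in A1, A2. destruct p as [x y]; simpl in *.
  set (m := Rmax _ _) in *.
  match type of A1 with Rabs ?X <= _ => match type of A2 with Rabs ?Y <= _ =>
    match goal with |- Rabs ?Z <= _ => replace Z with (X + Y) by ring;
      pose proof (Rabs_triang X Y) end end end.
  lra.
Qed.

Lemma hasgrad_mult F G p a b c d :
  hasgrad F p a b -> hasgrad G p c d ->
  hasgrad (fun q => F q * G q) p (a * G p + F p * c) (b * G p + F p * d).
Proof.
  intros HF HG. eapply hasgrad_eq.
  - apply (hasgrad_comp (fun q => fst q * snd q) F G p (G p) (F p) a b c d); auto.
    intros eps. exists eps. simpl. intros u v Hu Hv.
    replace (u * v - F p * G p - _) with ((u - F p) * (v - G p)) by ring.
    rewrite Rabs_mult. apply Rmult_le_compat; auto using Rabs_pos; [lra|apply Rmax_r].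
  - ring.
  - ring.
Qed.

Lemma hasgrad_scal k F p a b : hasgrad F p a b -> hasgrad (fun q => k * F q) p (k * a) (k * b).
Proof.
  intros H. eapply hasgrad_eq.
  - apply (hasgrad_mult (fun _ => k) F p 0 0 a b); auto using hasgrad_const.
  - ring.
  - ring.
Qed.

Lemma hasgrad_opp F p a b : hasgrad F p a b -> hasgrad (fun q => - F q) p (- a) (- b).
Proof.
  intros H. apply hasgrad_ext with (fun q => -1 * F q).
  - apply filter_forall. intros; ring.
  - eapply hasgrad_eq; [apply hasgrad_scal, H|ring|ring].
Qed.

Lemma hasgrad_minus F G p a b c d :
  hasgrad F p a b -> hasgrad G p c d -> hasgrad (fun q => F q - G q) p (a - c) (b - d).
Proof. intros HF HG. apply hasgrad_plus; auto. now apply hasgrad_opp. Qed.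

(** The gradient is (P, Q) and the Hessian [[A, B], [B, -A]]: its shape encodes at once the symmetry
    of the mixed derivatives and the Laplace equation. With the derivatives as explicit witnesses,
    closure properties reduce to algebra. *)
Definition harm_at (F P Q A B : pt -> R) (p : pt) : Prop :=
  hasgrad F p (P p) (Q p) /\ hasgrad P p (A p) (B p) /\ hasgrad Q p (B p) (- A p) /\
  continuous A p /\ continuous B p.

Definition harm (U : pt -> Prop) (F : pt -> R) : Prop :=
  exists P Q A B, forall p, U p -> harm_at F P Q A B p.

Lemma harm_grad U F p : harm U F -> U p -> hasgrad F p (dx F p) (dy F p).
Proof.
  intros (P & Q & A & B & H) Hp. destruct (H p Hp) as (H1 & _).
  now rewrite (hasgrad_dx _ _ _ _ H1), (hasgrad_dy _ _ _ _ H1).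
Qed.

Lemma harm_continuous U F p : harm U F -> U p -> continuous F p.
Proof. intros H Hp. eapply hasgrad_continuous, harm_grad; eauto. Qed.

Lemma harm_sub (U V : pt -> Prop) F : (forall x, V x -> U x) -> harm U F -> harm V F.
Proof. intros S (P & Q & A & B & H). exists P, Q, A, B. auto. Qed.

Lemma continuous_Rplus (F G : pt -> R) p :
  continuous F p -> continuous G p -> continuous (fun q => F q + G q) p.
Proof. intros HF HG. exact (continuous_plus F G p HF HG). Qed.

Lemma continuous_Rmult (F G : pt -> R) p :
  continuous F p -> continuous G p -> continuous (fun q => F q * G q) p.
Proof. intros HF HG. exact (continuous_mult F G p HF HG). Qed.

Lemma continuous_Rminus (F G : pt -> R) p :
  continuous F p -> continuous G p -> continuous (fun q => F q - G q) p.
Proof. intros HF HG. exact (continuous_minus F G p HF HG). Qed.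

Lemma harm_const U c : harm U (fun _ => c).
Proof.
  exists (fun _ => 0), (fun _ => 0), (fun _ => 0), (fun _ => 0). intros p _.
  repeat split; try apply hasgrad_const; try apply continuous_const.
  rewrite Ropp_0; apply hasgrad_const.
Qed.

Lemma harm_plus U F G : harm U F -> harm U G -> harm U (fun q => F q + G q).
Proof.
  intros (P & Q & A & B & H) (P' & Q' & A' & B' & H').
  exists (fun q => P q + P' q), (fun q => Q q + Q' q), (fun q => A q + A' q), (fun q => B q + B' q).
  intros p Hp. destruct (H p Hp) as (h1 & h2 & h3 & h4 & h5).
  destruct (H' p Hp) as (k1 & k2 & k3 & k4 & k5).
  repeat split; try (apply hasgrad_plus; assumption); try (apply continuous_Rplus; assumption).
  eapply hasgrad_eq; [apply hasgrad_plus; eassumption|ring|ring].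
Qed.

Lemma harm_scal U k F : harm U F -> harm U (fun q => k * F q).
Proof.
  intros (P & Q & A & B & H).
  exists (fun q => k * P q), (fun q => k * Q q), (fun q => k * A q), (fun q => k * B q).
  intros p Hp. destruct (H p Hp) as (h1 & h2 & h3 & h4 & h5).
  repeat split; try (apply hasgrad_scal; assumption);
    try (apply continuous_Rmult; [apply continuous_const|assumption]).
  eapply hasgrad_eq; [apply hasgrad_scal; eassumption|ring|ring].
Qed.

Lemma hasgrad_ext_all F G p a b : (forall q, F q = G q) -> hasgrad F p a b -> hasgrad G p a b.
Proof. intros E. apply hasgrad_ext, filter_forall, E. Qed.

Lemma harm_ext U F G : (forall q, F q = G q) -> harm U F -> harm U G.
Proof.
  intros E (P & Q & A & B & H). exists P, Q, A, B. intros p Hp.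
  destruct (H p Hp) as (h1 & h2 & h3 & h4 & h5). repeat split; auto.
  now apply hasgrad_ext_all with F.
Qed.

Lemma harm_opp U F : harm U F -> harm U (fun q => - F q).
Proof. intros H. apply harm_ext with (fun q => -1 * F q); [intros; ring|]. now apply harm_scal. Qed.

Lemma harm_minus U F G : harm U F -> harm U G -> harm U (fun q => F q - G q).
Proof. intros HF HG. apply harm_plus; auto. now apply harm_opp. Qed.

Lemma C1_hasgrad (F : pt -> R) p :
  locally p (fun q => ex_derive (fun t => F (t, snd q)) (fst q)) ->
  ex_derive (fun t => F (fst p, t)) (snd p) ->
  continuous (dx F) p -> hasgrad F p (dx F p) (dy F p).
Proof.
  intros L1 L2 C. unfold hasgrad.
  apply filterdiff_differentiable_pt_lim.
  destruct p as [x y]; simpl in *.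
  assert (K := is_derive_filterdiff (fun x y => F (x, y)) x y
             (fun u v => dx F (u, v)) (dy F (x, y))).
  eapply filterdiff_ext_lin; [apply K|].
  - eapply filter_imp; [|exact L1]. intros [u v] Hu. simpl in *. unfold dx; simpl.
    now apply Derive_correct.
  - unfold dy; simpl. now apply Derive_correct.
  - eapply continuous_ext; [|exact C]. now intros [].
  - intros [u v]. simpl. unfold plus, scal; simpl. unfold mult; simpl. reflexivity.
Qed.

Lemma harmonic_on_harm U F : popen U -> harmonic_on U F -> harm U F.
Proof.
  intros HU [HC HL]. exists (dx F), (dy F), (dx (dx F)), (dy (dx F)). intros p Hp.
  assert (L := HU p Hp).
  destruct (HC p Hp) as (e1 & e2 & e3 & e4 & e5 & e6 & k0 & k1 & k2 & k3 & k4 & k5 & k6).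
  (* [harm_at] keeps a single mixed derivative, so the two in [C2_on] have to be identified. *)
  assert (S : dx (dy F) p = dy (dx F) p).
  { assert (K := Schwarz (fun x y => F (x, y)) (fst p) (snd p)).
    unfold dx, dy; simpl. apply K.
    - apply (locally_2d_pt (fun q =>
        ex_derive (fun z : R => F (z, snd q)) (fst q) /\
        ex_derive (fun z : R => F (fst q, z)) (snd q) /\
        ex_derive (fun z : R => Derive (fun t : R => F (z, t)) (snd q)) (fst q) /\
        ex_derive (fun z : R => Derive (fun t : R => F (t, z)) (fst q)) (snd q))).
      eapply filter_imp; [|exact L]. intros q Hq.
      destruct (HC q Hq) as (? & ? & ? & ? & ? & ? & _). repeat split; assumption.
    - apply continuous_2d in k5. exact k5.
    - apply continuous_2d in k4. exact k4. }
  repeat split; auto.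
  - apply C1_hasgrad; auto. eapply filter_imp; [|exact L]. intros q Hq. apply (HC q Hq).
  - apply C1_hasgrad; auto. eapply filter_imp; [|exact L]. intros q Hq. apply (HC q Hq).
  - rewrite <- S. replace (- dx (dx F) p) with (dy (dy F) p) by (specialize (HL p Hp); lra).
    apply C1_hasgrad; auto. eapply filter_imp; [|exact L]. intros q Hq. apply (HC q Hq).
Qed.

(** * Maximum principle *)

Definition insq (r : R) (p : pt) : Prop := - r <= fst p <= r /\ - r <= snd p <= r.

Lemma insq_pnorm r p : pnorm p <= r -> insq r p.
Proof.
  intros H. pose proof (pnorm_fst p). pose proof (pnorm_snd p).
  unfold insq. split; apply Rabs_le_between; lra.
Qed.

(** Upper semicontinuity is the right generality because the maximum principle applies this to a
    function cut off by 0, continuous only from above. If every point of the square were beaten by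
    some [q'], then [q'] would beat a whole neighbourhood; a finite subcover gives one [q'] beating
    all points, itself included. *)
Lemma usc_attains_max (F : pt -> R) (r : R) :
  0 <= r -> (forall p eta, 0 < eta -> locally p (fun q => F q < F p + eta)) ->
  exists p, insq r p /\ forall q, insq r q -> F q <= F p.
Proof.
  intros Hr usc. apply NNPP. intros Hno.
  assert (Hup : forall p, insq r p -> exists q, insq r q /\ F p < F q).
  { intros p Hp. apply NNPP. intros Hn. apply Hno. exists p. split; auto.
    intros q Hq. apply Rnot_lt_le. intros Hlt. apply Hn. now exists q. }
  assert (Hd : forall p : pt, exists d : posreal, insq r p -> exists q', insq r q' /\
     forall q, Rabs (fst q - fst p) < d -> Rabs (snd q - snd p) < d -> F q < F q').
  { intros p. destruct (classic (insq r p)) as [Hp|Hp].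
    - destruct (Hup p Hp) as [q' [Hq' Hlt]].
      assert (L := usc p (F q' - F p) ltac:(lra)).
      apply locally_pdist in L. destruct L as [d [Hd0 Hd]].
      assert (H2 : 0 < d / 2) by lra. exists (mkposreal _ H2). intros _. exists q'. split; auto.
      simpl. intros q H3 H4. replace (F q') with (F p + (F q' - F p)) by ring. apply Hd.
      unfold pdist. pose proof (pnorm_le_abs (psub q p)) as T. simpl in T. lra.
    - exists (mkposreal 1 Rlt_0_1). tauto. }
  set (delta := fun t : Compactness.Tn 2 R =>
    proj1_sig (constructive_indefinite_description _ (Hd (fst t, fst (snd t))))).
  apply (compactness_list 2 (- r, (- r, tt)) (r, (r, tt)) delta). intros [l Hl].
  assert (Hm : exists q', insq r q' /\ forall t, In t l ->
     insq r (fst t, fst (snd t)) -> forall q, Rabs (fst q - fst t) < delta t ->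
     Rabs (snd q - fst (snd t)) < delta t -> F q < F q').
  { clear Hl. induction l as [|t l IH].
    - exists (0, 0). split; [unfold insq; simpl; lra|]. intros t [].
    - destruct IH as [q1 [Hq1 IH]].
      destruct (classic (insq r (fst t, fst (snd t)))) as [Ht|Ht].
      + assert (K := proj2_sig (constructive_indefinite_description _ (Hd (fst t, fst (snd t)))) Ht).
        fold (delta t) in K. destruct K as [q2 [Hq2 K]]. simpl in K.
        destruct (Rle_dec (F q1) (F q2)) as [Hle|Hle].
        * exists q2. split; auto. intros t' [<-|Ht'] Hi q H1 H2.
          -- now apply K.
          -- apply Rlt_le_trans with (F q1); auto. now apply (IH t').
        * exists q1. split; auto. intros t' [<-|Ht'] Hi q H1 H2.
          -- apply Rlt_le_trans with (F q2); [now apply K|lra].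
          -- now apply (IH t').
      + exists q1. split; auto. intros t' [<-|Ht'] Hi q H1 H2; [tauto|]. now apply (IH t'). }
  destruct Hm as [q' [Hq' Hm]].
  destruct (Hl (fst q', (snd q', tt))) as [t (Ht & Hb & Hc)].
  { simpl. unfold insq in Hq'. tauto. }
  destruct t as [t1 [t2 []]]. simpl in Hb, Hc.
  assert (F q' < F q'); [|lra].
  apply (Hm (t1, (t2, tt))); auto; simpl; try tauto.
  unfold insq; simpl; tauto.
Qed.

Lemma continuous_near (F : pt -> R) p eta :
  continuous F p -> 0 < eta -> locally p (fun q => Rabs (F q - F p) < eta).
Proof.
  intros C He. apply (C (fun z => Rabs (z - F p) < eta)). now exists (mkposreal _ He).
Qed.

Lemma continuous_bounded (F : pt -> R) (r : R) :
  (forall p, continuous F p) -> exists M, 0 < M /\ forall q, pnorm q <= r -> Rabs (F q) <= M.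
Proof.
  intros C. destruct (Rle_dec 0 r) as [Hr|Hr].
  - destruct (usc_attains_max (fun p => Rabs (F p)) r Hr) as [p [_ Hp]].
    + intros p eta He. eapply filter_imp; [|apply (continuous_near F p eta (C p) He)].
      intros q Hq. simpl in Hq. pose proof (Rabs_triang_inv (F q) (F p)). lra.
    + exists (Rabs (F p) + 1). pose proof (Rabs_pos (F p)). split; [lra|].
      intros q Hq. assert (K := Hp q (insq_pnorm _ _ Hq)). simpl in K. lra.
  - exists 1. split; [lra|]. intros q Hq. pose proof (pnorm_ge_0 q). lra.
Qed.

(** If [s] were positive, [d] would exceed [d t0] just to the right of [t0] and stay below it just
    to the left. Moving right when [0 <= d t0], and left otherwise, then increases [f]. *)
Lemma second_derivative_at_max (f d : R -> R) (t0 s : R) :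
  locally t0 (fun t => is_derive f t (d t)) -> is_derive d t0 s ->
  locally t0 (fun t => f t <= f t0) -> s <= 0.
Proof.
  intros [d1 H1] H2 [d2 H3]. apply Rnot_lt_le. intros Hs.
  apply is_derive_Reals in H2.
  destruct (H2 (s / 2) ltac:(lra)) as [d3 H4].
  set (e := Rmin d1 (Rmin d2 d3) / 2).
  assert (He : 0 < e /\ e < d1 /\ e < d2 /\ e < d3).
  { unfold e. pose proof (cond_pos d1). pose proof (cond_pos d2). pose proof (cond_pos d3).
    pose proof (Rmin_l d1 (Rmin d2 d3)). pose proof (Rmin_r d1 (Rmin d2 d3)).
    pose proof (Rmin_l d2 d3). pose proof (Rmin_r d2 d3).
    assert (0 < Rmin d1 (Rmin d2 d3)) by (repeat apply Rmin_glb_lt; lra). lra. }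
  assert (Hder : forall t, Rabs (t - t0) <= e -> derivable_pt_lim f t (d t)).
  { intros t Ht. apply is_derive_Reals. apply H1.
    change (Rabs (minus t t0) < d1). unfold minus, plus, opp; simpl. unfold Rminus in Ht. lra. }
  assert (Hle : forall t, Rabs (t - t0) <= e -> f t <= f t0).
  { intros t Ht. apply H3. change (Rabs (minus t t0) < d2).
    unfold minus, plus, opp; simpl. unfold Rminus in Ht. lra. }
  assert (Hs2 : forall t, t <> t0 -> Rabs (t - t0) <= e -> (d t - d t0) / (t - t0) > s / 2).
  { intros t Hn Ht. assert (K := H4 (t - t0) ltac:(lra) ltac:(lra)).
    replace (t0 + (t - t0)) with t in K by ring. apply Rabs_lt_between in K. lra. }
  destruct (Rle_dec 0 (d t0)) as [Hd|Hd].
  - destruct (MVT_cor2 f d t0 (t0 + e)) as [c [E Hc]]; [lra| |].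
    { intros c Hc. apply Hder. rewrite Rabs_pos_eq; lra. }
    assert (K := Hs2 c ltac:(lra) ltac:(rewrite Rabs_pos_eq; lra)).
    assert (K2 := Hle (t0 + e) ltac:(rewrite Rabs_pos_eq; lra)).
    assert (d c - d t0 > 0).
    { replace (d c - d t0) with ((d c - d t0) / (c - t0) * (c - t0)) by (field; lra). nra. }
    nra.
  - destruct (MVT_cor2 f d (t0 - e) t0) as [c [E Hc]]; [lra| |].
    { intros c Hc. apply Hder. rewrite Rabs_left1; lra. }
    assert (K := Hs2 c ltac:(lra) ltac:(rewrite Rabs_left1; lra)).
    assert (K2 := Hle (t0 - e) ltac:(rewrite Rabs_left1; lra)).
    assert (d t0 - d c > 0).
    { replace (d t0 - d c) with ((d c - d t0) / (c - t0) * (t0 - c)) by (field; lra). nra. }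
    nra.
Qed.

Lemma locally_hline (P : pt -> Prop) (p : pt) :
  locally p P -> locally (fst p) (fun t => P (t, snd p)).
Proof.
  intros H. apply locally_pdist in H. destruct H as [d [Hd H]].
  exists (mkposreal _ Hd). intros t Ht. change (Rabs (minus t (fst p)) < d) in Ht.
  unfold minus, plus, opp in Ht; simpl in Ht. apply H. unfold pdist.
  pose proof (pnorm_le_abs (psub (t, snd p) p)) as K. revert K.
  generalize (pnorm (psub (t, snd p) p)). simpl. intros z K.
  rewrite Rminus_diag, Rabs_R0 in K. unfold Rminus in *. lra.
Qed.

Lemma locally_vline (P : pt -> Prop) (p : pt) :
  locally p P -> locally (snd p) (fun t => P (fst p, t)).
Proof.
  intros H. apply locally_pdist in H. destruct H as [d [Hd H]].
  exists (mkposreal _ Hd). intros t Ht. change (Rabs (minus t (snd p)) < d) in Ht.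
  unfold minus, plus, opp in Ht; simpl in Ht. apply H. unfold pdist.
  pose proof (pnorm_le_abs (psub (fst p, t) p)) as K. revert K.
  generalize (pnorm (psub (fst p, t) p)). simpl. intros z K.
  rewrite Rminus_diag, Rabs_R0 in K. unfold Rminus in *. lra.
Qed.

Lemma hasgrad_hline F p a b : hasgrad F p a b -> is_derive (fun t => F (t, snd p)) (fst p) a.
Proof.
  intros H. replace a with (a * 1 + b * 0) by ring.
  apply (is_derive_line F (fun t => t) (fun _ => snd p)).
  - now destruct p.
  - apply @is_derive_id.
  - apply @is_derive_const.
Qed.

Lemma hasgrad_vline F p a b : hasgrad F p a b -> is_derive (fun t => F (fst p, t)) (snd p) b.
Proof.
  intros H. replace b with (a * 0 + b * 1) by ring.
  apply (is_derive_line F (fun _ => fst p) (fun t => t)).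
  - now destruct p.
  - apply @is_derive_const.
  - apply @is_derive_id.
Qed.

(* A multiple of |x|^2 is added to make a strictly subharmonic function, which has no
   interior maximum. *)
Lemma maximum_principle (U : pt -> Prop) (w : pt -> R) (r : R) :
  popen U -> (forall x, U x -> pnorm x <= r) -> harm U w ->
  (forall p, ~ U p -> forall eta, 0 < eta -> locally p (fun q => U q -> w q <= eta)) ->
  forall x, U x -> w x <= 0.
Proof.
  intros HU Hr Hw Hb q0 Hq0. apply Rnot_lt_le. intros Hpos.
  assert (Hr0 : 0 <= r) by (pose proof (Hr q0 Hq0); pose proof (pnorm_ge_0 q0); lra).
  (* Small enough that [k * r^2 < w q0]: lowering [f] by up to [k * r^2] leaves it positive at
     [q0]. *)
  set (k := w q0 / (2 * (r * r + 1))).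
  assert (Hk : 0 < k) by (apply Rdiv_lt_0_compat; nra).
  set (f := fun p : pt => w p + k * (fst p * fst p + snd p * snd p - r * r)).
  assert (Hfw : forall p, U p -> f p <= w p).
  { intros p Hp. unfold f. pose proof (Hr p Hp) as K. pose proof (pnorm_ge_0 p).
    pose proof (pnorm_sqr p).
    assert (fst p * fst p + snd p * snd p - r * r <= 0) by nra. nra. }
  assert (Hf0 : 0 < f q0).
  { assert (k * (r * r) < w q0).
    { unfold k. apply Rmult_lt_reg_r with (2 * (r * r + 1)); [nra|]. field_simplify; nra. }
    unfold f. nra. }
  (* [U] is not closed and [w] is controlled at its boundary only in the limit. The positive part
     extended by 0 is upper semicontinuous on the whole square, and a positive maximum of it must
     lie in [U]. *)
  set (G := fun p => if excluded_middle_informative (U p) then Rmax 0 (f p) else 0).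
  assert (HGU : forall p, U p -> G p = Rmax 0 (f p)).
  { intros p Hp. unfold G. destruct excluded_middle_informative; tauto. }
  assert (HGN : forall p, ~ U p -> G p = 0).
  { intros p Hp. unfold G. destruct excluded_middle_informative; tauto. }
  destruct Hw as (P & Q & A & B & Hw).
  assert (Hg : forall p, U p -> hasgrad f p (P p + k * (2 * fst p)) (Q p + k * (2 * snd p))).
  { intros p Hp. destruct (Hw p Hp) as (h1 & _). unfold f. apply hasgrad_plus; auto.
    apply hasgrad_scal. eapply hasgrad_eq.
    - apply hasgrad_minus; [|apply hasgrad_const].
      apply hasgrad_plus; apply hasgrad_mult; apply hasgrad_fst || apply hasgrad_snd.
    - ring.
    - ring. }
  destruct (usc_attains_max G r Hr0) as [p [Hp Hmax]].
  { intros p eta He. destruct (classic (U p)) as [Hp|Hp].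
    - generalize (filter_and _ _ (HU p Hp)
        (continuous_near f p eta (hasgrad_continuous _ _ _ _ (Hg p Hp)) He)).
      apply filter_imp. intros q [Hq1 Hq2]. rewrite !HGU; auto.
      apply Rabs_lt_between in Hq2. unfold Rmax. repeat destruct Rle_dec; lra.
    - rewrite (HGN p Hp). generalize (Hb p Hp (eta / 2) ltac:(lra)).
      apply filter_imp. intros q Hq. destruct (classic (U q)) as [Hu|Hu].
      + rewrite HGU; auto. specialize (Hfw q Hu). specialize (Hq Hu).
        unfold Rmax; destruct Rle_dec; lra.
      + rewrite HGN; auto. lra. }
  assert (HpU : U p /\ 0 < f p).
  { assert (K := Hmax q0 (insq_pnorm _ _ (Hr q0 Hq0))). rewrite (HGU q0 Hq0) in K.
    pose proof (Rmax_r 0 (f q0)).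
    destruct (classic (U p)) as [Hu|Hu].
    - split; auto. rewrite HGU in K; auto. revert K; unfold Rmax; repeat destruct Rle_dec; lra.
    - rewrite HGN in K; auto. lra. }
  destruct HpU as [HpU Hfp].
  assert (Hloc : locally p (fun q => U q /\ f q <= f p)).
  { eapply filter_imp; [|exact (HU p HpU)]. intros q Hq. split; auto.
    assert (K := Hmax q (insq_pnorm _ _ (Hr q Hq))). rewrite !HGU in K; auto.
    revert K; unfold Rmax; repeat destruct Rle_dec; lra. }
  destruct (Hw p HpU) as (_ & h2 & h3 & _).
  (* The diagonal second derivatives of [f] are [A + 2 * k] and [- A + 2 * k]. Both are nonpositive
     at a maximum, yet their sum is [4 * k]. *)
  assert (A p + 2 * k <= 0).
  { apply (second_derivative_at_max (fun t => f (t, snd p))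
             (fun t => P (t, snd p) + k * (2 * t)) (fst p)).
    - generalize (locally_hline _ p Hloc). apply filter_imp. intros t [Ht _].
      exact (hasgrad_hline f (t, snd p) _ _ (Hg _ Ht)).
    - assert (K := hasgrad_hline P p _ _ h2).
      evar_last; [apply @is_derive_plus; [exact K|]|].
      + apply is_derive_scal, is_derive_scal, @is_derive_id.
      + unfold plus, one; simpl. ring.
    - generalize (locally_hline _ p Hloc). apply filter_imp. intros t [_ Ht].
      now destruct p. }
  assert (- A p + 2 * k <= 0).
  { apply (second_derivative_at_max (fun t => f (fst p, t))
             (fun t => Q (fst p, t) + k * (2 * t)) (snd p)).
    - generalize (locally_vline _ p Hloc). apply filter_imp. intros t [Ht _].
      exact (hasgrad_vline f (fst p, t) _ _ (Hg _ Ht)).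
    - assert (K := hasgrad_vline Q p _ _ h3).
      evar_last; [apply @is_derive_plus; [exact K|]|].
      + apply is_derive_scal, is_derive_scal, @is_derive_id.
      + unfold plus, one; simpl. ring.
    - generalize (locally_vline _ p Hloc). apply filter_imp. intros t [_ Ht].
      now destruct p. }
  lra.
Qed.

(** * Anticonformal substitutions and inversion *)

Lemma continuous_pair_comp (G X Y : pt -> R) p :
  continuous G (X p, Y p) -> continuous X p -> continuous Y p ->
  continuous (fun q => G (X q, Y q)) p.
Proof.
  intros HG HX HY.
  apply (continuous_comp_2 X Y (fun x y => G (x, y)) p); auto.
  eapply continuous_ext; [|exact HG]. now intros [].
Qed.

(* The map (X, Y) is the conjugate of a holomorphic one: its Jacobian matrix is
   [[m, n], [n, -m]], and m - i n is holomorphic with derivative mx - i my. *)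
Lemma harm_comp_anticonformal (U V : pt -> Prop) (F X Y m n mx my : pt -> R) :
  harm U F ->
  (forall p, V p -> U (X p, Y p) /\ hasgrad X p (m p) (n p) /\ hasgrad Y p (n p) (- m p) /\
     hasgrad m p (mx p) (my p) /\ hasgrad n p (my p) (- mx p) /\
     continuous mx p /\ continuous my p) ->
  harm V (fun p => F (X p, Y p)).
Proof.
  intros (P & Q & A & B & HF) HV.
  set (c := fun G : pt -> R => fun p => G (X p, Y p)).
  exists (fun p => c P p * m p + c Q p * n p), (fun p => c P p * n p - c Q p * m p),
    (fun p => c A p * (m p * m p - n p * n p) + 2 * (c B p * (m p * n p))
              + c P p * mx p + c Q p * my p),
    (fun p => 2 * (c A p * (m p * n p)) + c B p * (n p * n p - m p * m p)
              + c P p * my p - c Q p * mx p).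
  intros p Hp. destruct (HV p Hp) as (Hu & HX & HY & Hm & Hn & Cx & Cy).
  destruct (HF _ Hu) as (h1 & h2 & h3 & h4 & h5).
  assert (kF := hasgrad_comp F X Y p _ _ _ _ _ _ h1 HX HY).
  assert (kP := hasgrad_comp P X Y p _ _ _ _ _ _ h2 HX HY).
  assert (kQ := hasgrad_comp Q X Y p _ _ _ _ _ _ h3 HX HY).
  assert (CX := hasgrad_continuous _ _ _ _ HX). assert (CY := hasgrad_continuous _ _ _ _ HY).
  assert (Cm := hasgrad_continuous _ _ _ _ Hm). assert (Cn := hasgrad_continuous _ _ _ _ Hn).
  assert (CA := continuous_pair_comp A X Y p h4 CX CY).
  assert (CB := continuous_pair_comp B X Y p h5 CX CY).
  assert (CP := hasgrad_continuous _ _ _ _ kP). assert (CQ := hasgrad_continuous _ _ _ _ kQ).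
  unfold c. repeat split.
  - eapply hasgrad_eq; [exact kF|cbv beta; ring|cbv beta; ring].
  - eapply hasgrad_eq.
    + apply hasgrad_plus; apply hasgrad_mult; eassumption.
    + cbv beta; ring.
    + cbv beta; ring.
  - eapply hasgrad_eq.
    + apply hasgrad_minus; apply hasgrad_mult; eassumption.
    + cbv beta; ring.
    + cbv beta; ring.
  - repeat first [assumption | apply continuous_const | apply continuous_Rminus | apply continuous_Rplus
      | apply continuous_Rmult].
  - repeat first [assumption | apply continuous_const | apply continuous_Rminus | apply continuous_Rplus
      | apply continuous_Rmult].
Qed.

Definition sqd (c p : pt) : R := (fst p - fst c) * (fst p - fst c) + (snd p - snd c) * (snd p - snd c).
(** The pair ([invx], [invy]) is the inversion in the unit circle about [c], taken relative to [c],
    and also the gradient of ln |p - c|. The same derivative formulas thus serve reflections and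
    logarithms. *)
Definition invx (c p : pt) : R := (fst p - fst c) * / sqd c p.
Definition invy (c p : pt) : R := (snd p - snd c) * / sqd c p.

Lemma sqd_pdist c p : sqd c p = pdist p c * pdist p c.
Proof. rewrite pdist_sqr. unfold sqd. ring. Qed.

Lemma sqd_pos c p : 0 < pdist p c -> 0 < sqd c p.
Proof. rewrite sqd_pdist. nra. Qed.

Lemma hasgrad_sqd c p : hasgrad (sqd c) p (2 * (fst p - fst c)) (2 * (snd p - snd c)).
Proof.
  unfold sqd. eapply hasgrad_eq.
  - apply hasgrad_plus; apply hasgrad_mult; (apply hasgrad_minus; [|apply hasgrad_const]);
      apply hasgrad_fst || apply hasgrad_snd.
  - cbv beta; ring.
  - cbv beta; ring.
Qed.

Lemma hasgrad_inv_sqd c p : 0 < pdist p c ->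
  hasgrad (fun q => / sqd c q) p (- 2 * invx c p * / sqd c p) (- 2 * invy c p * / sqd c p).
Proof.
  intros Hp. pose proof (sqd_pos c p Hp). eapply hasgrad_eq.
  - apply (hasgrad_comp1 Rinv (sqd c) p (- / (sqd c p * sqd c p))); [|apply hasgrad_sqd].
    auto_derive; [lra|field; lra].
  - unfold invx. field. lra.
  - unfold invy. field. lra.
Qed.

Lemma hasgrad_invx c p : 0 < pdist p c ->
  hasgrad (invx c) p (invy c p * invy c p - invx c p * invx c p) (- 2 * invx c p * invy c p).
Proof.
  intros Hp. pose proof (sqd_pos c p Hp). unfold invx at 1. eapply hasgrad_eq.
  - apply hasgrad_mult; [|now apply hasgrad_inv_sqd].
    apply hasgrad_minus; [apply hasgrad_fst|apply hasgrad_const].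
  - unfold invx, invy. apply Rmult_eq_reg_r with (sqd c p * sqd c p); [|nra].
    field_simplify; [|lra|lra]. unfold sqd. ring.
  - unfold invx, invy. field. lra.
Qed.

Lemma hasgrad_invy c p : 0 < pdist p c ->
  hasgrad (invy c) p (- 2 * invx c p * invy c p) (invx c p * invx c p - invy c p * invy c p).
Proof.
  intros Hp. pose proof (sqd_pos c p Hp). unfold invy at 1. eapply hasgrad_eq.
  - apply hasgrad_mult; [|now apply hasgrad_inv_sqd].
    apply hasgrad_minus; [apply hasgrad_snd|apply hasgrad_const].
  - unfold invx, invy. field. lra.
  - unfold invx, invy. apply Rmult_eq_reg_r with (sqd c p * sqd c p); [|nra].
    field_simplify; [|lra|lra]. unfold sqd. ring.
Qed.

Ltac hasgrad_poly Hp :=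
  repeat first [apply hasgrad_const | apply (hasgrad_invx _ _ Hp) | apply (hasgrad_invy _ _ Hp)
    | apply hasgrad_minus | apply hasgrad_plus | apply hasgrad_mult].

Ltac continuous_poly Hp :=
  repeat first [apply continuous_const
    | exact (hasgrad_continuous _ _ _ _ (hasgrad_invx _ _ Hp))
    | exact (hasgrad_continuous _ _ _ _ (hasgrad_invy _ _ Hp))
    | apply continuous_Rminus | apply continuous_Rplus
      | apply continuous_Rmult].

Lemma hasgrad_ln_pdist c p : 0 < pdist p c ->
  hasgrad (fun q => ln (pdist q c)) p (invx c p) (invy c p).
Proof.
  intros Hp. pose proof (sqd_pos c p Hp).
  apply hasgrad_ext_all with (fun q => ln (sqrt (sqd c q))).
  - intros q. rewrite sqd_pdist, sqrt_square; auto using pdist_ge_0.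
  - assert (S : sqrt (sqd c p) * sqrt (sqd c p) = sqd c p) by (apply sqrt_sqrt; lra).
    assert (0 < sqrt (sqd c p)) by now apply sqrt_lt_R0.
    eapply hasgrad_eq.
    + apply (hasgrad_comp1 (fun z => ln (sqrt z)) (sqd c) p (/ (2 * sqd c p))); [|apply hasgrad_sqd].
      auto_derive; [auto|]. rewrite <- S at 3. field. lra.
    + unfold invx. field. lra.
    + unfold invy. field. lra.
Qed.

Lemma harm_ln_pdist (U : pt -> Prop) c :
  (forall p, U p -> 0 < pdist p c) -> harm U (fun q => ln (pdist q c)).
Proof.
  intros HU. exists (invx c), (invy c), (fun p => invy c p * invy c p - invx c p * invx c p),
    (fun p => - 2 * invx c p * invy c p).
  intros p Hp. specialize (HU p Hp). repeat split.
  - now apply hasgrad_ln_pdist.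
  - now apply hasgrad_invx.
  - eapply hasgrad_eq; [now apply hasgrad_invy|cbv beta; ring|cbv beta; ring].
  - continuous_poly HU.
  - continuous_poly HU.
Qed.

Lemma reflect_inv c r x :
  reflect c r x = (r ^ 2 * invx c x + fst c, r ^ 2 * invy c x + snd c).
Proof.
  assert (S : pnorm (psub x c) ^ 2 = sqd c x) by (rewrite sqd_pdist; unfold pdist; ring).
  unfold reflect. rewrite S. unfold padd, pscal, psub, invx, invy; simpl. f_equal; unfold Rdiv; ring.
Qed.

Lemma hasgrad_reflect F c r p a b : 0 < pdist p c -> hasgrad F (reflect c r p) a b ->
  hasgrad (fun q => F (reflect c r q)) p
    (r ^ 2 * (a * (invy c p * invy c p - invx c p * invx c p) - 2 * b * (invx c p * invy c p)))
    (r ^ 2 * (b * (invx c p * invx c p - invy c p * invy c p) - 2 * a * (invx c p * invy c p))).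
Proof.
  intros Hp H. apply hasgrad_ext_all
    with (fun q => F (r ^ 2 * invx c q + fst c, r ^ 2 * invy c q + snd c)).
  - intros q. now rewrite reflect_inv.
  - rewrite reflect_inv in H. eapply hasgrad_eq.
    + apply (hasgrad_comp F (fun q => r ^ 2 * invx c q + fst c)
               (fun q => r ^ 2 * invy c q + snd c)); [exact H| |]; hasgrad_poly Hp.
    + cbv beta; ring.
    + cbv beta; ring.
Qed.

Lemma harm_reflect (U V : pt -> Prop) F c r :
  harm U F -> (forall p, V p -> 0 < pdist p c /\ U (reflect c r p)) ->
  harm V (fun p => F (reflect c r p)).
Proof.
  intros HF HV.
  apply harm_ext with (fun q => F (r ^ 2 * invx c q + fst c, r ^ 2 * invy c q + snd c)).
  { intros q. now rewrite reflect_inv. }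
  apply (harm_comp_anticonformal U V F (fun q => r ^ 2 * invx c q + fst c)
    (fun q => r ^ 2 * invy c q + snd c)
    (fun q => r ^ 2 * (invy c q * invy c q - invx c q * invx c q))
    (fun q => r ^ 2 * (- 2 * invx c q * invy c q))
    (fun q => r ^ 2 * (2 * invx c q * invx c q * invx c q - 6 * invx c q * invy c q * invy c q))
    (fun q => r ^ 2 * (6 * invx c q * invx c q * invy c q - 2 * invy c q * invy c q * invy c q))); auto.
  intros p Hp. destruct (HV p Hp) as [Hc Hu]. rewrite reflect_inv in Hu. repeat split; auto.
  - eapply hasgrad_eq; [hasgrad_poly Hc|cbv beta; ring|cbv beta; ring].
  - eapply hasgrad_eq; [hasgrad_poly Hc|cbv beta; ring|cbv beta; ring].
  - eapply hasgrad_eq; [hasgrad_poly Hc|cbv beta; ring|cbv beta; ring].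
  - eapply hasgrad_eq; [hasgrad_poly Hc|cbv beta; ring|cbv beta; ring].
  - continuous_poly Hc.
  - continuous_poly Hc.
Qed.

(** * Interior gradient estimate *)

Lemma derive_le_of_le (k : R -> R) (l K rho : R) :
  0 < rho -> is_derive k 0 l -> k 0 = 0 -> (forall s, 0 < s < rho -> k s <= K * s) -> l <= K.
Proof.
  intros Hr D E H. apply Rnot_lt_le. intros Hlt. apply is_derive_Reals in D.
  destruct (D (l - K) ltac:(lra)) as [d Hd]. set (s := Rmin d rho / 2).
  assert (0 < s /\ s < d /\ s < rho).
  { unfold s. pose proof (cond_pos d). pose proof (Rmin_l d rho). pose proof (Rmin_r d rho).
    assert (0 < Rmin d rho) by (apply Rmin_glb_lt; lra). lra. }
  assert (K1 := Hd s ltac:(lra) ltac:(rewrite Rabs_pos_eq; lra)).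
  rewrite Rplus_0_l, E in K1. apply Rabs_lt_between in K1.
  assert (K2 := H s ltac:(lra)).
  assert (k s / s <= K).
  { apply Rmult_le_reg_r with s; [lra|]. replace (k s / s * s) with (k s) by (field; lra). lra. }
  unfold Rminus in K1. rewrite Ropp_0, Rplus_0_r in K1. lra.
Qed.

Lemma harm_mirror U V F x0 : harm U F -> (forall p, V p -> U (2 * x0 - fst p, snd p)) ->
  harm V (fun p => F (2 * x0 - fst p, snd p)).
Proof.
  intros HF HV. apply (harm_comp_anticonformal U V F (fun p => 2 * x0 - fst p) snd
    (fun _ => -1) (fun _ => 0) (fun _ => 0) (fun _ => 0)); auto.
  intros p Hp. repeat split; auto; try apply continuous_const.
  - eapply hasgrad_eq; [apply hasgrad_minus; [apply hasgrad_const|apply hasgrad_fst]|cbv beta; ring|cbv beta; ring].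
  - eapply hasgrad_eq; [apply hasgrad_snd|cbv beta; ring|cbv beta; ring].
  - apply hasgrad_const.
  - eapply hasgrad_eq; [apply hasgrad_const|cbv beta; ring|cbv beta; ring].
Qed.

Lemma harm_swap U F : harm U F -> harm (fun p => U (snd p, fst p)) (fun p => F (snd p, fst p)).
Proof.
  intros HF. apply (harm_comp_anticonformal U _ F snd fst
    (fun _ => 0) (fun _ => 1) (fun _ => 0) (fun _ => 0)); auto.
  intros p Hp. repeat split; auto; try apply continuous_const.
  - apply hasgrad_snd.
  - eapply hasgrad_eq; [apply hasgrad_fst|cbv beta; ring|cbv beta; ring].
  - apply hasgrad_const.
  - eapply hasgrad_eq; [apply hasgrad_const|cbv beta; ring|cbv beta; ring].
Qed.

Lemma popen_lt_continuous (F G : pt -> R) :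
  (forall p, continuous F p) -> (forall p, continuous G p) -> popen (fun p => F p < G p).
Proof.
  intros CF CG p Hp. set (e := (G p - F p) / 2). assert (0 < e) by (unfold e; lra).
  generalize (filter_and _ _ (continuous_near F p e (CF p) H) (continuous_near G p e (CG p) H)).
  apply filter_imp. intros q [H1 H2]. apply Rabs_lt_between in H1, H2. unfold e in *. lra.
Qed.

Lemma continuous_Rfst (p : pt) : continuous (fun q : pt => fst q) p.
Proof. exact (hasgrad_continuous _ _ _ _ (hasgrad_fst p)). Qed.

Lemma continuous_Rsnd (p : pt) : continuous (fun q : pt => snd q) p.
Proof. exact (hasgrad_continuous _ _ _ _ (hasgrad_snd p)). Qed.

(* Compare the part of F odd in x - x0 with the harmonic function
   M / rho^2 * (t^2 + s (2 rho - s)), s = x - x0, t = y - y0, on the half square. *)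
Lemma dx_le_of_bound (U : pt -> Prop) F p0 rho M :
  0 < rho -> 0 <= M -> harm U F ->
  (forall p, Rabs (fst p - fst p0) <= rho -> Rabs (snd p - snd p0) <= rho ->
     U p /\ Rabs (F p) <= M) ->
  dx F p0 <= 2 * M / rho.
Proof.
  intros Hr HM HF HS. destruct p0 as [x0 y0]; simpl in HS.
  set (ps := fun p : pt => M / rho ^ 2 *
     ((snd p - y0) * (snd p - y0) + (fst p - x0) * (2 * rho - (fst p - x0)))).
  set (w := fun p => / 2 * F p - / 2 * F (2 * x0 - fst p, snd p) - ps p).
  set (V := fun p : pt => (x0 < fst p /\ fst p < x0 + rho) /\ (y0 - rho < snd p /\ snd p < y0 + rho)).
  assert (Hsq : forall p : pt, x0 <= fst p <= x0 + rho -> y0 - rho <= snd p <= y0 + rho ->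
      (U p /\ Rabs (F p) <= M) /\ U (2 * x0 - fst p, snd p) /\ Rabs (F (2 * x0 - fst p, snd p)) <= M).
  { intros p H1 H2. split; apply HS; simpl; apply Rabs_le_between; lra. }
  assert (hps : harm V ps).
  { set (k := M / rho ^ 2).
    exists (fun p => k * (2 * rho - 2 * (fst p - x0))), (fun p => k * (2 * (snd p - y0))),
      (fun _ => - 2 * k), (fun _ => 0).
    assert (Hx : forall p : pt, hasgrad (fun q => fst q - x0) p 1 0).
    { intros p. eapply hasgrad_eq; [apply hasgrad_minus; [apply hasgrad_fst|apply hasgrad_const]|cbv beta; ring|cbv beta; ring]. }
    assert (Hy : forall p : pt, hasgrad (fun q => snd q - y0) p 0 1).
    { intros p. eapply hasgrad_eq; [apply hasgrad_minus; [apply hasgrad_snd|apply hasgrad_const]|cbv beta; ring|cbv beta; ring]. }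
    intros p Hp. repeat split; try apply continuous_const.
    - unfold ps. fold k. eapply hasgrad_eq.
      + apply hasgrad_scal, hasgrad_plus; [apply hasgrad_mult; apply Hy|].
        apply hasgrad_mult; [apply Hx|apply hasgrad_minus; [apply hasgrad_const|apply Hx]].
      + cbv beta; ring.
      + cbv beta; ring.
    - eapply hasgrad_eq.
      + apply hasgrad_scal, hasgrad_minus; [apply hasgrad_const|apply hasgrad_scal, Hx].
      + cbv beta; ring.
      + cbv beta; ring.
    - eapply hasgrad_eq; [apply hasgrad_scal, hasgrad_scal, Hy|cbv beta; ring|cbv beta; ring]. }
  assert (cps : forall p, continuous ps p).
  { intros p. unfold ps. repeat first [apply continuous_const | apply continuous_Rminus | apply continuous_Rplus
      | apply continuous_Rmult | apply continuous_Rfst | apply continuous_Rsnd]. }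
  assert (hw : harm V w).
  { unfold w. apply harm_minus; auto. apply harm_minus; apply harm_scal.
    - apply harm_sub with U; auto. intros p Hp. unfold V in Hp. apply Hsq; lra.
    - apply harm_mirror with U; auto. intros p Hp. unfold V in Hp. apply Hsq; lra. }
  assert (k2 : M / rho ^ 2 * rho ^ 2 = M) by (field; lra).
  assert (k1 : 0 <= M / rho ^ 2) by (apply Rdiv_le_0_compat; [lra|nra]).
  assert (HV : popen V).
  { unfold V. apply popen_and; apply popen_and; apply popen_lt_continuous; intros p;
      repeat first [apply continuous_const | apply continuous_Rfst | apply continuous_Rsnd]. }
  assert (Hle : forall p, V p -> w p <= 0).
  { apply maximum_principle with (r := Rabs x0 + Rabs y0 + 2 * rho); auto.
    - intros p Hp. unfold V in Hp. pose proof (pnorm_le_abs p).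
      pose proof (Rabs_triang x0 (fst p - x0)). pose proof (Rabs_triang y0 (snd p - y0)).
      replace (x0 + (fst p - x0)) with (fst p) in H0 by ring.
      replace (y0 + (snd p - y0)) with (snd p) in H1 by ring.
      assert (Rabs (fst p - x0) <= rho) by (apply Rabs_le_between; lra).
      assert (Rabs (snd p - y0) <= rho) by (apply Rabs_le_between; lra). lra.
    - intros p Hp eta He.
      destruct (classic (x0 <= fst p <= x0 + rho /\ y0 - rho <= snd p <= y0 + rho)) as [[H1 H2]|Hout].
      + destruct (Hsq p H1 H2) as [[Hu Hb] [Hu' Hb']].
        assert (w p <= 0).
        { apply Rabs_le_between in Hb, Hb'. unfold w, ps.
          set (k := M / rho ^ 2) in *.
          (* On the side s = 0 the odd part vanishes and the barrier is nonnegative. On the other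
             three sides t^2 + s (2 rho - s) is at least rho^2, so the barrier is at least [M]. *)
          assert (Hc : fst p = x0 \/ fst p = x0 + rho \/ snd p = y0 - rho \/ snd p = y0 + rho).
          { apply NNPP. intros Hc. apply Hp. unfold V. repeat split;
              apply Rnot_le_lt; intros ?; apply Hc; lra. }
          set (S := (snd p - y0) * (snd p - y0) + (fst p - x0) * (2 * rho - (fst p - x0))).
          assert (S0 : 0 <= (snd p - y0) * (snd p - y0)) by apply Rle_0_sqr.
          assert (S1 : 0 <= (fst p - x0) * (2 * rho - (fst p - x0))) by (apply Rmult_le_pos; lra).
          destruct Hc as [Hc|Hc].
          - replace (2 * x0 - fst p) with (fst p) by lra. rewrite <- surjective_pairing.
            assert (0 <= k * S) by (apply Rmult_le_pos; unfold S; lra). lra.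
          - assert (rho ^ 2 <= S).
            { unfold S. destruct Hc as [Hc|[Hc|Hc]]; rewrite Hc.
              - replace ((x0 + rho - x0) * (2 * rho - (x0 + rho - x0))) with (rho ^ 2) by ring. lra.
              - replace ((y0 - rho - y0) * (y0 - rho - y0)) with (rho ^ 2) by ring. lra.
              - replace ((y0 + rho - y0) * (y0 + rho - y0)) with (rho ^ 2) by ring. lra. }
            assert (k * rho ^ 2 <= k * S) by now apply Rmult_le_compat_l. lra. }
        assert (Cw : continuous w p).
        { unfold w. apply continuous_Rminus; [|apply cps]. apply continuous_Rminus;
            (apply continuous_Rmult; [apply continuous_const|]).
          - apply (harm_continuous U); auto.
          - apply (continuous_pair_comp F (fun p => 2 * x0 - fst p) snd).
            + apply (harm_continuous U); auto.
            + apply continuous_Rminus; [apply continuous_const|apply continuous_Rfst].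
            + apply continuous_Rsnd. }
        generalize (continuous_near w p eta Cw He). apply filter_imp. intros q Hq _.
        apply Rabs_lt_between in Hq. lra.
      + assert (Ho : locally p (fun q => ~ V q)).
        { apply not_and_or in Hout. destruct Hout as [Ho|Ho]; apply not_and_or in Ho;
            destruct Ho as [Ho|Ho]; apply Rnot_le_lt in Ho.
          - generalize (popen_lt_continuous (fun q => fst q) (fun _ => x0) continuous_Rfst
              (fun p => continuous_const x0 p) p Ho). apply filter_imp. unfold V. intros; lra.
          - generalize (popen_lt_continuous (fun _ => x0 + rho) (fun q => fst q)
              (fun p => continuous_const _ p) continuous_Rfst p Ho). apply filter_imp. unfold V. intros; lra.
          - generalize (popen_lt_continuous (fun q => snd q) (fun _ => y0 - rho) continuous_Rsnd
              (fun p => continuous_const _ p) p Ho). apply filter_imp. unfold V. intros; lra.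
          - generalize (popen_lt_continuous (fun _ => y0 + rho) (fun q => snd q)
              (fun p => continuous_const _ p) continuous_Rsnd p Ho). apply filter_imp. unfold V. intros; lra. }
        generalize Ho. apply filter_imp. tauto. }
  assert (D : hasgrad F (x0, y0) (dx F (x0, y0)) (dy F (x0, y0))).
  { apply (harm_grad U); auto. apply HS; simpl; rewrite Rminus_diag, Rabs_R0; lra. }
  (* On the axis t = 0 the comparison bounds F(x0 + s, y0) - F(x0 - s, y0) by 2 M s (2 rho - s) /
     rho^2, hence by 4 M s / rho; this difference has slope [2 * dx F] at s = 0. *)
  assert (2 * dx F (x0, y0) <= 4 * M / rho); [|lra].
  apply derive_le_of_le with (fun s => F (x0 + s, y0) - F (x0 - s, y0)) rho; auto.
  - evar_last; [apply @is_derive_minus|].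
    + apply (is_derive_line F (fun s => x0 + s) (fun _ => y0) 0 (dx F (x0, y0)) (dy F (x0, y0)) 1 0).
      * now rewrite Rplus_0_r.
      * auto_derive; auto; ring.
      * apply @is_derive_const.
    + apply (is_derive_line F (fun s => x0 - s) (fun _ => y0) 0 (dx F (x0, y0)) (dy F (x0, y0)) (-1) 0).
      * now rewrite Rminus_0_r.
      * auto_derive; auto; ring.
      * apply @is_derive_const.
    + unfold minus, plus, opp; simpl. ring.
  - rewrite Rplus_0_r, Rminus_0_r. ring.
  - intros s Hs. assert (K := Hle (x0 + s, y0)). unfold V, w, ps in K; simpl in K.
    replace (2 * x0 - (x0 + s)) with (x0 - s) in K by ring.
    replace (x0 + s - x0) with s in K by ring. rewrite Rminus_diag in K.
    assert (K' := K ltac:(lra)).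
    replace (4 * M / rho * s) with (2 * (M / rho ^ 2 * (s * (2 * rho)))) by (field; lra).
    change (rho * (rho * 1)) with (rho ^ 2) in K'. nra.
Qed.

(** The one-sided bound is applied to [F] and [- F], before and after exchanging the coordinates.
    The factor 2 in [2 * rho] makes the disk contain the square of half-side [rho]. *)
Lemma pnorm_grad_le_of_bound (U : pt -> Prop) F p0 rho M :
  0 < rho -> 0 <= M -> harm U F ->
  (forall p, pdist p p0 <= 2 * rho -> U p /\ Rabs (F p) <= M) ->
  pnorm (grad F p0) <= 4 * M / rho.
Proof.
  intros Hr HM HF HS.
  assert (HS' : forall p, Rabs (fst p - fst p0) <= rho -> Rabs (snd p - snd p0) <= rho ->
     U p /\ Rabs (F p) <= M).
  { intros p H1 H2. apply HS. unfold pdist. pose proof (pnorm_le_abs (psub p p0)) as K.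
    simpl in K. lra. }
  assert (Ho : harm U (fun p => - F p)) by now apply harm_opp.
  assert (HSo : forall p, Rabs (fst p - fst p0) <= rho -> Rabs (snd p - snd p0) <= rho ->
     U p /\ Rabs (- F p) <= M) by (intros; rewrite Rabs_Ropp; auto).
  assert (D : hasgrad F p0 (dx F p0) (dy F p0)).
  { apply (harm_grad U); auto. apply HS. rewrite pdist_refl. lra. }
  assert (e1 := dx_le_of_bound U F p0 rho M Hr HM HF HS').
  assert (e2 := dx_le_of_bound U _ p0 rho M Hr HM Ho HSo).
  rewrite (hasgrad_dx _ _ _ _ (hasgrad_opp _ _ _ _ D)) in e2.
  assert (Hs := harm_swap U F HF). assert (Hso := harm_opp _ _ Hs).
  assert (Ds : hasgrad (fun p => F (snd p, fst p)) (snd p0, fst p0) (dy F p0) (dx F p0)).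
  { eapply hasgrad_eq.
    - apply (hasgrad_comp F snd fst (snd p0, fst p0) (dx F p0) (dy F p0)).
      + simpl. now rewrite <- surjective_pairing.
      + apply hasgrad_snd.
      + apply hasgrad_fst.
    - cbv beta; ring.
    - cbv beta; ring. }
  assert (e3 := dx_le_of_bound _ _ (snd p0, fst p0) rho M Hr HM Hs
    ltac:(simpl; intros; apply HS'; simpl; auto)).
  rewrite (hasgrad_dx _ _ _ _ Ds) in e3.
  assert (e4 := dx_le_of_bound _ _ (snd p0, fst p0) rho M Hr HM Hso
    ltac:(simpl; intros; apply HSo; simpl; auto)).
  cbv beta in e4. rewrite (hasgrad_dx _ _ _ _ (hasgrad_opp _ _ _ _ Ds)) in e4.
  eapply Rle_trans; [apply pnorm_le_abs|]. simpl.
  assert (Rabs (dx F p0) <= 2 * M / rho) by (apply Rabs_le_between; lra).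
  assert (Rabs (dy F p0) <= 2 * M / rho) by (apply Rabs_le_between; lra). lra.
Qed.

(** * Logarithmic barriers *)

Lemma ln_pdist_ge_0 c r x : 0 < r -> r <= pdist x c -> 0 <= ln (pdist x c) - ln r.
Proof. intros H1 [H2|<-]; [|lra]. apply ln_increasing in H2; auto. lra. Qed.

(** The logarithmic term is nonnegative on [E], so subtracting it preserves the bound at the
    boundary; its purpose is to produce the bound far away, which is left as a hypothesis. *)
Lemma exterior_comparison (E : pt -> Prop) c r v m k M K :
  0 < r -> popen E -> (forall x, E x -> r < pdist x c) -> harm E v ->
  (forall p, ~ E p -> forall eta, 0 < eta -> locally p (fun q => E q -> v q <= m + eta)) ->
  0 <= k -> m <= M ->
  (forall x, E x -> K <= pnorm x -> v x - k * (ln (pdist x c) - ln r) <= M) ->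
  forall x, E x -> v x - k * (ln (pdist x c) - ln r) <= M.
Proof.
  intros Hr HE Hav Hv Hb Hk HM HK x Hx.
  destruct (Rle_dec K (pnorm x)) as [Hn|Hn]; [now apply HK|].
  assert (HL : forall q, E q -> 0 <= k * (ln (pdist q c) - ln r)).
  { intros q Hq. apply Rmult_le_pos; auto. apply ln_pdist_ge_0; auto. left; auto. }
  (* The truncation radius is [K + 1] rather than [K] so that the bound beyond [K] holds in a full
     neighbourhood of each outer boundary point. *)
  set (U := fun x => E x /\ pdist x (0, 0) < K + 1).
  assert (HU : popen U) by (apply popen_and; [auto|apply popen_dist_lt]).
  enough (v x - k * (ln (pdist x c) - ln r) - M <= 0) by lra.
  apply (maximum_principle U (fun x => v x - k * (ln (pdist x c) - ln r) - M) (K + 1)); auto.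
  - intros q [_ Hq]. rewrite pnorm_dist_0. lra.
  - apply harm_minus; [|apply harm_const]. apply harm_minus.
    + apply harm_sub with E; auto. now intros q [].
    + apply harm_scal, harm_minus; [|apply harm_const]. apply harm_ln_pdist.
      intros q [Hq _]. specialize (Hav q Hq). lra.
  - intros p Hp eta He. destruct (classic (E p)) as [Hep|Hep].
    + assert (Hf : K < pdist p (0, 0)).
      { apply Rnot_le_lt. intros Hle. apply Hp. split; auto. lra. }
      generalize (popen_lt_dist (0, 0) K p Hf). apply filter_imp. intros q Hq [Hq1 _].
      rewrite <- pnorm_dist_0 in Hq. specialize (HK q Hq1 ltac:(lra)). lra.
    + generalize (Hb p Hep eta He). apply filter_imp. intros q Hq [Hq1 _].
      specialize (Hq Hq1). specialize (HL q Hq1). lra.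
  - split; auto. rewrite <- pnorm_dist_0. lra.
Qed.

(* In the plane ln |x - c| dominates at infinity, so a harmonic function that tends to 0
   there cannot stay below a negative bound on the boundary. *)
Lemma exterior_maximum_principle (E : pt -> Prop) c r v m :
  0 < r -> popen E -> (forall x, E x -> r < pdist x c) ->
  (forall K, exists x, E x /\ K <= pnorm x) -> harm E v ->
  (forall p, ~ E p -> forall eta, 0 < eta -> locally p (fun q => E q -> v q <= m + eta)) ->
  (forall eta, 0 < eta -> exists K, forall x, E x -> K <= pnorm x -> Rabs (v x) <= eta) ->
  0 <= m /\ forall x, E x -> v x <= m.
Proof.
  intros Hr HE Hav Hfar Hv Hb Hinf.
  assert (Hm : 0 <= m).
  { apply Rnot_lt_le. intros Hm.
    assert (Hall : forall x, E x -> v x <= m).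
    { intros x Hx. apply le_epsilon. intros eps He.
      set (L := ln (pdist x c) - ln r).
      assert (HL : 0 <= L) by (apply ln_pdist_ge_0; auto; left; auto).
      set (k := eps / (L + 1)). assert (Hk : 0 < k) by (apply Rdiv_lt_0_compat; lra).
      destruct (Hinf 1 Rlt_0_1) as [K1 HK1].
      (* Beyond [K], [v] is at most 1 while [k * (ln (pdist q c) - ln r)] is at least [1 - m], which
         leaves at most [m]. The multiple [k] is so small that the logarithm costs at most [eps] at
         [x]. *)
      set (K := Rmax K1 (exp ((1 - m) / k + ln r) + pnorm c)).
      assert (K2 := exterior_comparison E c r v m k m K Hr HE Hav Hv Hb (Rlt_le _ _ Hk) (Rle_refl m)).
      assert (v x - k * L <= m).
      { apply K2; auto. intros q Hq Hqn.
        assert (Rabs (v q) <= 1) by (apply HK1; auto; eapply Rle_trans; [apply Rmax_l|exact Hqn]).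
        apply Rabs_le_between in H.
        assert (exp ((1 - m) / k + ln r) <= pdist q c).
        { assert (exp ((1 - m) / k + ln r) + pnorm c <= pnorm q)
            by (eapply Rle_trans; [apply Rmax_r|exact Hqn]).
          pose proof (pnorm_le_dist q c). lra. }
        assert ((1 - m) / k + ln r <= ln (pdist q c)).
        { rewrite <- (ln_exp ((1 - m) / k + ln r)). apply ln_le; auto. apply exp_pos. }
        assert ((1 - m) <= k * (ln (pdist q c) - ln r)).
        { replace (1 - m) with (k * ((1 - m) / k)) by (field; lra). apply Rmult_le_compat_l; lra. }
        lra. }
      assert (k * L <= eps); [|lra].
      unfold k. apply Rmult_le_reg_r with (L + 1); [lra|].
      replace (eps / (L + 1) * L * (L + 1)) with (eps * L) by (field; lra). nra. }
    destruct (Hinf (- m / 2) ltac:(lra)) as [K HK]. destruct (Hfar K) as [x [Hx Hxn]].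
    specialize (HK x Hx Hxn). specialize (Hall x Hx). apply Rabs_le_between in HK. lra. }
  split; auto. intros x Hx. apply le_epsilon. intros eps He.
  destruct (Hinf eps He) as [K HK].
  (* Once [0 <= m] is known, the decay of [v] alone yields [m + eps] far out, and no logarithm is
     subtracted. *)
  assert (K2 := exterior_comparison E c r v m 0 (m + eps) K Hr HE Hav Hv Hb (Rle_refl 0) ltac:(lra)).
  rewrite <- (Rminus_0_r (v x)). rewrite <- (Rmult_0_l (ln (pdist x c) - ln r)).
  apply K2; auto. intros q Hq Hqn. specialize (HK q Hq Hqn). apply Rabs_le_between in HK. lra.
Qed.

(** The barrier is harmonic, vanishes on the inner circle and equals [M] on the outer one, so it
    dominates [v] and [- v] on the boundary. The set [V] allows a second disk to cut into the
    annulus, as long as [v] tends to 0 at its boundary too. *)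
Lemma log_barrier (V : pt -> Prop) c r rho v M :
  let U := fun x => (r < pdist x c /\ pdist x c < rho) /\ V x in
  0 < r -> r < rho -> 0 <= M -> popen V -> harm U v -> (forall x, U x -> Rabs (v x) <= M) ->
  (forall p, ~ V p \/ pdist p c <= r -> forall eta, 0 < eta ->
     locally p (fun q => U q -> Rabs (v q) <= eta)) ->
  forall x, U x -> Rabs (v x) <= M / (ln rho - ln r) * (ln (pdist x c) - ln r).
Proof.
  intros U Hr Hrho HM HV.
  assert (Hln : 0 < ln rho - ln r) by (apply ln_increasing in Hrho; lra).
  set (k := M / (ln rho - ln r)).
  assert (Hk : 0 <= k) by (apply Rdiv_le_0_compat; lra).
  assert (HU : popen U).
  { apply popen_and; auto. apply popen_and; [apply popen_lt_dist|apply popen_dist_lt]. }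
  assert (Hone : forall w, harm U w -> (forall x, U x -> Rabs (w x) <= M) ->
    (forall p, ~ V p \/ pdist p c <= r -> forall eta, 0 < eta ->
     locally p (fun q => U q -> Rabs (w q) <= eta)) ->
    forall x, U x -> w x <= k * (ln (pdist x c) - ln r)).
  { intros w Hw Hwb Hb x Hx.
    enough (w x - k * (ln (pdist x c) - ln r) <= 0) by lra.
    apply (maximum_principle U (fun x => w x - k * (ln (pdist x c) - ln r)) (rho + pnorm c)); auto.
    - intros q [[_ Hq] _]. pose proof (pnorm_le_dist q c). lra.
    - apply harm_minus; auto. apply harm_scal, harm_minus; [|apply harm_const].
      apply harm_ln_pdist. intros q [[Hq _] _]. lra.
    - intros p Hp eta He. destruct (classic (~ V p \/ pdist p c <= r)) as [Hc|Hc].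
      + generalize (Hb p Hc eta He). apply filter_imp. intros q Hq HUq. specialize (Hq HUq).
        apply Rabs_le_between in Hq. destruct HUq as [[Hq1 _] _].
        assert (0 <= k * (ln (pdist q c) - ln r)); [|lra].
        apply Rmult_le_pos; auto. apply ln_pdist_ge_0; lra.
      + apply not_or_and in Hc. destruct Hc as [Hc1 Hc2]. apply NNPP in Hc1.
        apply Rnot_le_lt in Hc2.
        assert (Hc3 : rho <= pdist p c).
        { apply Rnot_lt_le. intros Hlt. apply Hp. repeat split; auto. }
        assert (Cl : continuous (fun q => k * (ln (pdist q c) - ln r)) p).
        { apply continuous_Rmult; [apply continuous_const|].
          apply continuous_Rminus; [|apply continuous_const].
          eapply hasgrad_continuous, hasgrad_ln_pdist. lra. }
        generalize (continuous_near _ p eta Cl He). apply filter_imp. intros q Hq HUq.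
        apply Rabs_lt_between in Hq. specialize (Hwb q HUq). apply Rabs_le_between in Hwb.
        assert (M <= k * (ln (pdist p c) - ln r)); [|lra].
        replace M with (k * (ln rho - ln r)) by (unfold k; field; lra).
        apply Rmult_le_compat_l; auto. apply Rplus_le_compat_r. apply ln_le; lra. }
  intros Hv Hvb Hb x Hx. apply Rabs_le_between. split.
  - enough (- v x <= k * (ln (pdist x c) - ln r)) by lra.
    apply (Hone (fun x => - v x)); auto.
    + now apply harm_opp.
    + intros. rewrite Rabs_Ropp. auto.
    + intros p Hp eta He. generalize (Hb p Hp eta He). apply filter_imp. intros q Hq Hu.
      rewrite Rabs_Ropp. auto.
  - now apply Hone.
Qed.

(** * Reflections in two disjoint circles *)

Lemma eq_of_sqr_eq x y : 0 <= x -> 0 <= y -> x * x = y * y -> x = y.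
Proof. intros Hx Hy E. apply Rsqr_inj; auto. Qed.

Lemma pdist_reflect c r x y : 0 < pdist x c -> 0 < pdist y c ->
  pdist (reflect c r x) (reflect c r y) = r ^ 2 * pdist x y / (pdist x c * pdist y c).
Proof.
  intros Hx Hy. apply eq_of_sqr_eq.
  - apply pdist_ge_0.
  - apply Rdiv_le_0_compat; [|nra]. apply Rmult_le_pos; [apply pow2_ge_0|apply pdist_ge_0].
  - replace (r ^ 2 * pdist x y / (pdist x c * pdist y c) * (r ^ 2 * pdist x y / (pdist x c * pdist y c)))
      with (r ^ 4 * (pdist x y * pdist x y) / ((pdist x c * pdist x c) * (pdist y c * pdist y c)))
      by (field; lra).
    rewrite (pdist_sqr (reflect c r x)). rewrite <- !sqd_pdist, !reflect_inv. simpl fst; simpl snd.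
    pose proof (sqd_pos c x Hx). pose proof (sqd_pos c y Hy).
    unfold invx, invy.
    assert (E : sqd y x = sqd c x + sqd c y
      - 2 * ((fst x - fst c) * (fst y - fst c) + (snd x - snd c) * (snd y - snd c)))
      by (unfold sqd; ring).
    rewrite E.
    assert (Ex : (snd x - snd c) ^ 2 = sqd c x - (fst x - fst c) ^ 2) by (unfold sqd; ring).
    assert (Ey : (snd y - snd c) ^ 2 = sqd c y - (fst y - fst c) ^ 2) by (unfold sqd; ring).
    set (a := fst x - fst c) in *. set (b := snd x - snd c) in *.
    set (a' := fst y - fst c) in *. set (b' := snd y - snd c) in *.
    replace (_ ^ 2 + _ ^ 2) with
      (r ^ 4 * ((a ^ 2 + b ^ 2) * / (sqd c x * sqd c x) + (a' ^ 2 + b' ^ 2) * / (sqd c y * sqd c y)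
        - 2 * (a * a' + b * b') * / (sqd c x * sqd c y))) by (field; lra).
    rewrite Ex, Ey. field. lra.
Qed.

Lemma pdist_reflect_center c r x : 0 < pdist x c -> pdist (reflect c r x) c = r ^ 2 / pdist x c.
Proof.
  intros Hx. apply eq_of_sqr_eq.
  - apply pdist_ge_0.
  - apply Rdiv_le_0_compat; [apply pow2_ge_0|auto].
  - replace (r ^ 2 / pdist x c * (r ^ 2 / pdist x c)) with (r ^ 4 / (pdist x c * pdist x c)) by (field; lra).
    rewrite (pdist_sqr (reflect c r x)), <- sqd_pdist, reflect_inv. simpl fst; simpl snd.
    pose proof (sqd_pos c x Hx). unfold invx, invy.
    assert (Ex : (snd x - snd c) ^ 2 = sqd c x - (fst x - fst c) ^ 2) by (unfold sqd; ring).
    replace (_ ^ 2 + _ ^ 2) with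
      (r ^ 4 * (((fst x - fst c) ^ 2 + (snd x - snd c) ^ 2) * / (sqd c x * sqd c x))) by (field; lra).
    rewrite Ex. field. lra.
Qed.

Lemma reflect_circle c r x : 0 < r -> pdist x c = r -> reflect c r x = x.
Proof.
  intros Hr E. rewrite reflect_inv. assert (S : sqd c x = r ^ 2) by (rewrite sqd_pdist, E; ring).
  unfold invx, invy. rewrite S. destruct x as [x y]; simpl. f_equal; field; lra.
Qed.

Definition gap (c1 : pt) (r1 : R) (c2 : pt) (r2 eps : R) : Prop :=
  0 < r1 /\ 0 < r2 /\ 0 < eps /\ pdist c1 c2 = r1 + r2 + eps.

Lemma gap_sym c1 r1 c2 r2 eps : gap c1 r1 c2 r2 eps -> gap c2 r2 c1 r1 eps.
Proof. intros (H1 & H2 & H3 & H4). rewrite pdist_sym in H4. repeat split; auto. lra. Qed.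

Lemma gap_dist c1 r1 c2 r2 eps x s :
  gap c1 r1 c2 r2 eps -> pdist x c1 <= r1 + s -> r2 + (eps - s) <= pdist x c2.
Proof.
  intros (H1 & H2 & H3 & H4) Hx. pose proof (pdist_triangle c1 x c2).
  rewrite (pdist_sym c1 x) in H. lra.
Qed.

Lemma gap_disk c1 r1 c2 r2 eps x :
  gap c1 r1 c2 r2 eps -> pdist x c1 <= r1 -> r2 + eps <= pdist x c2.
Proof. intros G Hx. pose proof (gap_dist _ _ _ _ _ x 0 G ltac:(lra)). lra. Qed.

Lemma reflect_into c r x : 0 < r -> r <= pdist x c -> pdist (reflect c r x) c <= r.
Proof.
  intros Hr Hx. rewrite pdist_reflect_center; [|lra].
  apply Rmult_le_reg_r with (pdist x c); [lra|]. unfold Rdiv. rewrite Rmult_assoc, Rinv_l; nra.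
Qed.

Lemma reflect_lipschitz c r eps x y : 0 < r -> 0 < eps -> r + eps <= pdist x c -> r + eps <= pdist y c ->
  pdist (reflect c r x) (reflect c r y) <= (r / (r + eps)) ^ 2 * pdist x y.
Proof.
  intros Hr He Hx Hy. rewrite pdist_reflect; [|lra|lra].
  replace (r ^ 2 * pdist x y / (pdist x c * pdist y c))
    with (r ^ 2 * pdist x y * / (pdist x c * pdist y c)) by reflexivity.
  replace ((r / (r + eps)) ^ 2 * pdist x y) with (r ^ 2 * pdist x y * / ((r + eps) * (r + eps)))
    by (field; lra).
  apply Rmult_le_compat_l.
  - apply Rmult_le_pos; [apply pow2_ge_0|apply pdist_ge_0].
  - apply Rinv_le_contravar; [nra|]. apply Rmult_le_compat; lra.
Qed.

Lemma ratio_sqr_lt_1 r eps : 0 < r -> 0 < eps -> 0 < (r / (r + eps)) ^ 2 < 1.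
Proof.
  intros Hr He. assert (0 < r / (r + eps)) by (apply Rdiv_lt_0_compat; lra).
  assert (r / (r + eps) < 1).
  { apply Rmult_lt_reg_r with (r + eps); [lra|]. unfold Rdiv. rewrite Rmult_assoc, Rinv_l; lra. }
  split; [apply pow_lt; auto|]. simpl. nra.
Qed.

Definition contr (r1 r2 eps : R) : R := (r1 / (r1 + eps)) ^ 2 * (r2 / (r2 + eps)) ^ 2.

Lemma contr_bounds r1 r2 eps : 0 < r1 -> 0 < r2 -> 0 < eps -> 0 < contr r1 r2 eps < 1.
Proof.
  intros H1 H2 He. unfold contr. pose proof (ratio_sqr_lt_1 r1 eps H1 He).
  pose proof (ratio_sqr_lt_1 r2 eps H2 He). nra.
Qed.

(** Each reflection acts on points of the other disk. These are at distance at least [eps] from its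
    own disk, where its Lipschitz constant is at most (r / (r + eps))^2. *)
Lemma reflect2_contraction c1 r1 c2 r2 eps x y : gap c1 r1 c2 r2 eps ->
  pdist x c1 <= r1 -> pdist y c1 <= r1 ->
  pdist (reflect c1 r1 (reflect c2 r2 x)) (reflect c1 r1 (reflect c2 r2 y))
    <= contr r1 r2 eps * pdist x y.
Proof.
  intros G Hx Hy. pose proof (gap_sym _ _ _ _ _ G) as G'. destruct G as (H1 & H2 & He & HD) eqn:EG.
  assert (Hx2 := gap_disk _ _ _ _ _ _ G Hx). assert (Hy2 := gap_disk _ _ _ _ _ _ G Hy).
  assert (Kx := reflect_into c2 r2 x H2 ltac:(lra)). assert (Ky := reflect_into c2 r2 y H2 ltac:(lra)).
  assert (Kx1 := gap_disk _ _ _ _ _ _ G' Kx). assert (Ky1 := gap_disk _ _ _ _ _ _ G' Ky).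
  eapply Rle_trans; [apply (reflect_lipschitz c1 r1 eps); auto|].
  unfold contr. rewrite Rmult_assoc. apply Rmult_le_compat_l; [apply pow2_ge_0|].
  now apply reflect_lipschitz.
Qed.

Lemma reflect2_fixed_unique c1 r1 c2 r2 eps x y : gap c1 r1 c2 r2 eps ->
  pdist x c1 <= r1 -> pdist y c1 <= r1 ->
  reflect c1 r1 (reflect c2 r2 x) = x -> reflect c1 r1 (reflect c2 r2 y) = y -> x = y.
Proof.
  intros G Hx Hy Ex Ey. pose proof (reflect2_contraction _ _ _ _ _ x y G Hx Hy) as K.
  rewrite Ex, Ey in K. destruct G as (H1 & H2 & He & _).
  pose proof (contr_bounds r1 r2 eps H1 H2 He). pose proof (pdist_ge_0 x y).
  apply pdist_eq_0. nra.
Qed.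

(** [reflect c2 r2 p1] is itself fixed by R2 R1 and lies in the second disk, so uniqueness
    identifies it with [p2]. *)
Lemma fixed_points_swapped c1 r1 c2 r2 eps p1 p2 : gap c1 r1 c2 r2 eps ->
  pdist p1 c1 < r1 -> reflect c1 r1 (reflect c2 r2 p1) = p1 ->
  pdist p2 c2 < r2 -> reflect c2 r2 (reflect c1 r1 p2) = p2 ->
  reflect c2 r2 p1 = p2 /\ reflect c1 r1 p2 = p1.
Proof.
  intros G H1 E1 H2 E2.
  assert (E : reflect c2 r2 p1 = p2).
  { apply (reflect2_fixed_unique c2 r2 c1 r1 eps); auto.
    - now apply gap_sym.
    - apply reflect_into; [apply G|]. pose proof (gap_disk _ _ _ _ _ p1 G ltac:(lra)).
      destruct G as (_ & _ & He & _). lra.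
    - lra.
    - now rewrite E1. }
  split; auto. now rewrite <- E.
Qed.

(** * Images of H *)

(** The recursion removes the letter that acts first, so that a longer word is the pullback of a
    shorter one under [f]. Both the harmonicity of words and the cancellations on the circle of [f]
    use this form. *)
Fixpoint word (H : pt -> R) (k : nat) (f g : pt -> pt) (x : pt) : R :=
  match k with
  | O => H x
  | S k => word H k g f (f x)
  end.

Lemma word_even H n f g x : word H (2 * n) f g x = H (Nat.iter n (fun y => g (f y)) x).
Proof.
  revert x. induction n as [|n IH]; intros x; [reflexivity|].
  replace (2 * S n)%nat with (S (S (2 * n))) by lia. simpl word. fold (2 * n)%nat.
  change (n + (n + 0))%nat with (2 * n)%nat. rewrite IH. f_equal.
  symmetry. exact (Nat.iter_succ_r n pt (fun y => g (f y)) x).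
Qed.

(** Reflection sends the outside of the shrunken first disk into the disk of radius [r1 + eps / 2],
    which stays outside the closed second disk and so in the domain of the remaining word. The
    domain is larger than the closed exterior, so values and gradients on the circle itself make
    sense. *)
Lemma harm_word H k : forall c1 r1 c2 r2 eps, gap c1 r1 c2 r2 eps -> harm (fun _ => True) H ->
  harm (fun x => r1 ^ 2 / (r1 + eps / 2) < pdist x c1) (word H k (reflect c1 r1) (reflect c2 r2)).
Proof.
  induction k as [|k IH]; intros c1 r1 c2 r2 eps G HH.
  - apply harm_sub with (fun _ => True); auto.
  - pose proof (gap_sym _ _ _ _ _ G) as G'.
    change (harm (fun x => r1 ^ 2 / (r1 + eps / 2) < pdist x c1)
      (fun x => word H k (reflect c2 r2) (reflect c1 r1) (reflect c1 r1 x))).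
    eapply harm_reflect; [apply (IH c2 r2 c1 r1 eps G' HH)|].
    intros p Hp. destruct G as (H1 & H2 & He & HD) eqn:EG.
    assert (0 < r1 ^ 2 / (r1 + eps / 2)) by (apply Rdiv_lt_0_compat; [apply pow_lt; auto|lra]).
    split; [lra|].
    assert (pdist (reflect c1 r1 p) c1 <= r1 + eps / 2).
    { rewrite pdist_reflect_center; [|lra]. left. apply Rmult_lt_reg_r with (pdist p c1); [lra|].
      replace (r1 ^ 2 / pdist p c1 * pdist p c1) with (r1 ^ 2) by (field; lra).
      apply Rmult_lt_compat_r with (r := r1 + eps / 2) in Hp; [|lra].
      replace (r1 ^ 2 / (r1 + eps / 2) * (r1 + eps / 2)) with (r1 ^ 2) in Hp by (field; lra). lra. }
    assert (K := gap_dist _ _ _ _ _ _ _ G H3).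
    assert (r2 ^ 2 / (r2 + eps / 2) < r2); [|lra].
    apply Rmult_lt_reg_r with (r2 + eps / 2); [lra|].
    replace (r2 ^ 2 / (r2 + eps / 2) * (r2 + eps / 2)) with (r2 ^ 2) by (field; lra). nra.
Qed.

Lemma word_limit H c1 r1 c2 r2 eps p1 delta : gap c1 r1 c2 r2 eps ->
  pdist p1 c1 < r1 -> reflect c1 r1 (reflect c2 r2 p1) = p1 -> continuous H p1 -> 0 < delta ->
  exists n0, forall n, (n0 <= n)%nat -> forall x, r2 <= pdist x c2 ->
    Rabs (word H (2 * n) (reflect c2 r2) (reflect c1 r1) x - H p1) <= delta.
Proof.
  intros G Hp E C Hd. destruct G as (H1 & H2 & He & HD) eqn:EG.
  pose proof (gap_sym _ _ _ _ _ G) as G'.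
  set (T := fun y => reflect c1 r1 (reflect c2 r2 y)).
  pose proof (contr_bounds r1 r2 eps H1 H2 He) as HK. set (K := contr r1 r2 eps) in *.
  assert (Hin : forall x, r2 <= pdist x c2 -> pdist (T x) c1 <= r1).
  { intros x Hx. apply reflect_into; auto.
    pose proof (gap_disk _ _ _ _ _ _ G' (reflect_into c2 r2 x H2 Hx)). lra. }
  assert (Hit : forall n x, pdist x c1 <= r1 ->
    pdist (Nat.iter n T x) c1 <= r1 /\ pdist (Nat.iter n T x) p1 <= K ^ n * pdist x p1).
  { induction n as [|n IH]; intros x Hx; simpl; [split; lra|].
    destruct (IH x Hx) as [I1 I2]. split.
    - apply Hin. pose proof (gap_disk _ _ _ _ _ _ G I1). lra.
    - rewrite <- E at 1. unfold T at 1.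
      eapply Rle_trans; [apply (reflect2_contraction _ _ _ _ eps); auto; lra|].
      fold K. rewrite Rmult_assoc. apply Rmult_le_compat_l; lra. }
  generalize (continuous_near H p1 delta C Hd). intros L. apply locally_pdist in L.
  destruct L as [d [Hd0 L]].
  destruct (pow_lt_1_zero K ltac:(rewrite Rabs_pos_eq; lra) (d / (2 * r1))
    ltac:(apply Rdiv_lt_0_compat; lra)) as [n1 Hn1].
  (* The first application of [T] only brings [x], which may be arbitrarily far away, into the first
     disk, within [2 * r1] of [p1]. The contraction counts from there on, uniformly in [x]. *)
  exists (S n1). intros n Hn x Hx. rewrite word_even.
  destruct n as [|n]; [lia|]. left. apply L.
  rewrite Nat.iter_succ_r.
  assert (HT := Hin x Hx).
  destruct (Hit n (T x) HT) as [_ I2]. unfold T in *. eapply Rle_lt_trans; [exact I2|].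
  assert (pdist (reflect c1 r1 (reflect c2 r2 x)) p1 <= 2 * r1).
  { eapply Rle_trans; [apply pdist_triangle with (q := c1)|]. rewrite (pdist_sym c1 p1). lra. }
  assert (Hn2 := Hn1 n ltac:(lia)). rewrite Rabs_pos_eq in Hn2; [|apply pow_le; lra].
  assert (0 < K ^ n) by (apply pow_lt; lra).
  apply Rle_lt_trans with (K ^ n * (2 * r1)); [apply Rmult_le_compat_l; lra|].
  apply Rmult_lt_compat_r with (r := 2 * r1) in Hn2; [|lra].
  replace (d / (2 * r1) * (2 * r1)) with d in Hn2 by (field; lra). lra.
Qed.

(** * Limits at infinity and the alternating sums of images *)

Definition tends_at_inf (v : pt -> R) (l : R) : Prop :=
  forall eta, 0 < eta -> exists K, forall x, K <= pnorm x -> Rabs (v x - l) <= eta.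

Lemma tends_plus v w l m : tends_at_inf v l -> tends_at_inf w m ->
  tends_at_inf (fun x => v x + w x) (l + m).
Proof.
  intros Hv Hw eta He. destruct (Hv (eta / 2) ltac:(lra)) as [K1 H1].
  destruct (Hw (eta / 2) ltac:(lra)) as [K2 H2]. exists (Rmax K1 K2). intros x Hx.
  assert (A1 := H1 x (Rle_trans _ _ _ (Rmax_l _ _) Hx)).
  assert (A2 := H2 x (Rle_trans _ _ _ (Rmax_r _ _) Hx)).
  replace (v x + w x - (l + m)) with ((v x - l) + (w x - m)) by ring.
  pose proof (Rabs_triang (v x - l) (w x - m)). lra.
Qed.

Lemma tends_scal k v l : tends_at_inf v l -> tends_at_inf (fun x => k * v x) (k * l).
Proof.
  intros Hv eta He. pose proof (Rabs_pos k).
  destruct (Hv (eta / (Rabs k + 1)) ltac:(apply Rdiv_lt_0_compat; lra)) as [K HK].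
  exists K. intros x Hx. specialize (HK x Hx).
  replace (k * v x - k * l) with (k * (v x - l)) by ring. rewrite Rabs_mult.
  apply Rle_trans with (Rabs k * (eta / (Rabs k + 1))); [apply Rmult_le_compat_l; auto|].
  apply Rmult_le_reg_r with (Rabs k + 1); [lra|].
  replace (Rabs k * (eta / (Rabs k + 1)) * (Rabs k + 1)) with (Rabs k * eta) by (field; lra). nra.
Qed.

Lemma tends_ext v w l : (forall x, v x = w x) -> tends_at_inf v l -> tends_at_inf w l.
Proof. intros E H eta He. destruct (H eta He) as [K HK]. exists K. intros. rewrite <- E. auto. Qed.

Lemma tends_const c : tends_at_inf (fun _ => c) c.
Proof. intros eta He. exists 0. intros. rewrite Rminus_diag, Rabs_R0. lra. Qed.

Lemma tends_reflect v c r : continuous v c -> tends_at_inf (fun x => v (reflect c r x)) (v c).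
Proof.
  intros C eta He. generalize (continuous_near v c eta C He). intros L. apply locally_pdist in L.
  destruct L as [d [Hd L]]. exists (pnorm c + (r ^ 2 + 1) / d). intros x Hx. left. apply L.
  assert (0 < (r ^ 2 + 1) / d) by (apply Rdiv_lt_0_compat; nra).
  assert ((r ^ 2 + 1) / d <= pdist x c) by (pose proof (pnorm_le_dist x c); lra).
  rewrite pdist_reflect_center; [|lra].
  apply Rmult_lt_reg_r with (pdist x c); [lra|].
  replace (r ^ 2 / pdist x c * pdist x c) with (r ^ 2) by (field; lra).
  apply Rmult_le_compat_l with (r := d) in H0; [|lra].
  replace (d * ((r ^ 2 + 1) / d)) with (r ^ 2 + 1) in H0 by (field; lra). lra.
Qed.

(* On the circle fixed by f the terms cancel. By [image_sum_swap] adding the last word makes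
   the sum symmetric in f and g, so that the same function is nearly constant on both circles. *)
Fixpoint image_sum (H : pt -> R) (k : nat) (f g : pt -> pt) (x : pt) : R :=
  match k with
  | O => 0
  | S k => image_sum H k f g x + (-1) ^ k * (word H k g f x - word H k g f (f x))
  end.

Lemma image_sum_zero H k f g x : f x = x -> image_sum H k f g x = 0.
Proof. intros E. induction k as [|k IH]; simpl; [auto|]. rewrite IH, E. ring. Qed.

(** Both sides equal [H x] plus the sum over 1 <= j <= k of (-1)^j times the two words of length j.
    The empty word is common to both alternations and is counted once. *)
Lemma image_sum_swap H k f g x :
  image_sum H k f g x + (-1) ^ k * word H k g f x = image_sum H k g f x + (-1) ^ k * word H k f g x.
Proof. induction k as [|k IH]; simpl; [ring|]. lra. Qed.

(* r^2 / (r + eps/2) is the radius of the reflected circle of radius r + eps/2; all images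
   of H are harmonic outside the two disks of these radii. *)
Definition offcenter (c1 : pt) (r1 : R) (c2 : pt) (r2 eps : R) (x : pt) : Prop :=
  r1 ^ 2 / (r1 + eps / 2) < pdist x c1 /\ r2 ^ 2 / (r2 + eps / 2) < pdist x c2.

Lemma popen_offcenter c1 r1 c2 r2 eps : popen (offcenter c1 r1 c2 r2 eps).
Proof.
  exact (popen_and _ _ (popen_lt_dist c1 (r1 ^ 2 / (r1 + eps / 2)))
    (popen_lt_dist c2 (r2 ^ 2 / (r2 + eps / 2)))).
Qed.

Lemma offcenter_radius r eps : 0 < r -> 0 < eps -> 0 < r ^ 2 / (r + eps / 2) < r.
Proof.
  intros Hr He. split; [apply Rdiv_lt_0_compat; [apply pow_lt; auto|lra]|].
  apply Rmult_lt_reg_r with (r + eps / 2); [lra|].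
  replace (r ^ 2 / (r + eps / 2) * (r + eps / 2)) with (r ^ 2) by (field; lra). nra.
Qed.

Lemma harm_image_sum H k c1 r1 c2 r2 eps : gap c1 r1 c2 r2 eps -> harm (fun _ => True) H ->
  harm (offcenter c1 r1 c2 r2 eps) (image_sum H k (reflect c1 r1) (reflect c2 r2)).
Proof.
  intros G HH. pose proof (gap_sym _ _ _ _ _ G) as G'. induction k as [|k IH]; simpl.
  - apply harm_const.
  - apply harm_plus; auto. apply harm_scal, harm_minus.
    + apply harm_sub with (2 := harm_word H k _ _ _ _ _ G' HH). now intros x [].
    + apply harm_sub with (2 := harm_word H (S k) _ _ _ _ _ G HH). now intros x [].
Qed.

Lemma continuous_word_center H k c1 r1 c2 r2 eps : gap c1 r1 c2 r2 eps -> harm (fun _ => True) H ->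
  continuous (word H k (reflect c2 r2) (reflect c1 r1)) c1.
Proof.
  intros G HH. pose proof (gap_sym _ _ _ _ _ G) as G'.
  eapply harm_continuous; [apply (harm_word H k _ _ _ _ _ G' HH)|].
  destruct G as (H1 & H2 & He & HD). simpl. pose proof (offcenter_radius r2 eps H2 He). lra.
Qed.

(** Apart from [H] itself, every term starts with a reflection, which takes infinity to a centre.
    Lengthening the sum therefore adds to the limit the values of words at [c1] and [c2]. *)
Lemma image_sum_tends H k c1 r1 c2 r2 eps : gap c1 r1 c2 r2 eps -> harm (fun _ => True) H ->
  exists l, tends_at_inf (fun x => image_sum H k (reflect c1 r1) (reflect c2 r2) x
    + (-1) ^ k * word H k (reflect c2 r2) (reflect c1 r1) x - H x) l.
Proof.
  intros G HH. pose proof (gap_sym _ _ _ _ _ G) as G'. induction k as [|k [l IH]].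
  - exists 0. apply tends_ext with (fun _ => 0); [intros; simpl; ring|apply tends_const].
  - set (s := (-1) ^ k) in *.
    exists (l + - s * (word H k (reflect c2 r2) (reflect c1 r1) c1
                    + word H k (reflect c1 r1) (reflect c2 r2) c2)).
    eapply tends_ext; [|apply tends_plus; [exact IH|]; apply tends_scal, tends_plus;
      [apply tends_reflect with (r := r1)|apply tends_reflect with (r := r2)]].
    + intros x. simpl. fold s. ring.
    + now apply continuous_word_center with eps.
    + now apply continuous_word_center with eps.
Qed.

(** * Fluxes through circles *)

Definition radial (F : pt -> R) (th : R) (p : pt) : R := dx F p * cos th + dy F p * sin th.

Lemma circ_eq c r th : circ c r th = (fst c + r * cos th, snd c + r * sin th).
Proof. reflexivity. Qed.

Lemma pdist_circ c r th s : 0 <= s -> pdist (circ c (r + s) th) (circ c r th) = s.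
Proof.
  intros Hs. unfold pdist. apply pnorm_eq_nonneg; auto. simpl.
  pose proof (sin2_cos2 th). unfold Rsqr in H.
  replace (_ + _) with (s * s * (sin th * sin th + cos th * cos th)) by ring. rewrite H. ring.
Qed.

Lemma pdist_circ_center c r th : 0 <= r -> pdist (circ c r th) c = r.
Proof.
  intros Hr. unfold pdist. apply pnorm_eq_nonneg; auto. simpl.
  pose proof (sin2_cos2 th). unfold Rsqr in H.
  replace (_ + _) with (r * r * (sin th * sin th + cos th * cos th)) by ring. rewrite H. ring.
Qed.

Lemma harm_grad_continuous U F p : popen U -> harm U F -> U p ->
  continuous (dx F) p /\ continuous (dy F) p.
Proof.
  intros HU (P & Q & A & B & H) Hp. destruct (H p Hp) as (_ & h2 & h3 & _).
  split.
  - apply continuous_ext_loc with P; [|exact (hasgrad_continuous _ _ _ _ h2)].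
    eapply filter_imp; [|exact (HU p Hp)]. intros q Hq. symmetry.
    destruct (H q Hq) as (k & _). exact (hasgrad_dx _ _ _ _ k).
  - apply continuous_ext_loc with Q; [|exact (hasgrad_continuous _ _ _ _ h3)].
    eapply filter_imp; [|exact (HU p Hp)]. intros q Hq. symmetry.
    destruct (H q Hq) as (k & _). exact (hasgrad_dy _ _ _ _ k).
Qed.

Lemma continuous_polar (G : pt -> R) (c q : pt) :
  continuous G (circ c (fst q) (snd q)) -> continuous (fun z : pt => G (circ c (fst z) (snd z))) q.
Proof.
  intros HG.
  apply (continuous_pair_comp G (fun z => fst c + fst z * cos (snd z))
    (fun z => snd c + fst z * sin (snd z))).
  - exact HG.
  - apply continuous_Rplus; [apply continuous_const|]. apply continuous_Rmult; [apply continuous_Rfst|].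
    apply (continuous_comp snd cos); [apply continuous_Rsnd|apply continuous_cos].
  - apply continuous_Rplus; [apply continuous_const|]. apply continuous_Rmult; [apply continuous_Rfst|].
    apply (continuous_comp snd sin); [apply continuous_Rsnd|apply continuous_sin].
Qed.

Lemma continuous_on_circle (G : pt -> R) c r th :
  continuous G (circ c r th) -> continuous (fun t => G (circ c r t)) th.
Proof.
  intros HG. apply (continuous_comp (fun t => circ c r t) G); auto.
  apply (continuous_comp_2 (fun t => fst c + r * cos t) (fun t => snd c + r * sin t)
     (fun x y => (x, y) : pt)).
  - apply (continuous_plus (fun _ => fst c) (fun t => r * cos t)); [apply continuous_const|].
    apply (continuous_mult (fun _ => r) cos); [apply continuous_const|apply continuous_cos].
  - apply (continuous_plus (fun _ => snd c) (fun t => r * sin t)); [apply continuous_const|].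
    apply (continuous_mult (fun _ => r) sin); [apply continuous_const|apply continuous_sin].
  - apply continuous_ext with (fun z => z); [now intros []|apply continuous_id].
Qed.

Lemma continuous_radial U F c r th : popen U -> harm U F -> U (circ c r th) ->
  continuous (fun t => radial F t (circ c r t)) th.
Proof.
  intros HU HF Hp. destruct (harm_grad_continuous U F _ HU HF Hp) as [Cx Cy].
  unfold radial.
  apply (continuous_plus (fun t => dx F (circ c r t) * cos t) (fun t => dy F (circ c r t) * sin t)).
  - apply (continuous_mult (fun t => dx F (circ c r t)) cos); [|apply continuous_cos].
    now apply continuous_on_circle.
  - apply (continuous_mult (fun t => dy F (circ c r t)) sin); [|apply continuous_sin].
    now apply continuous_on_circle.
Qed.

(* d/ds (s F_r) = - d/dth ((1/s) F_th) in polar coordinates, so s times the flux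
   density has an integral independent of the radius s, which vanishes at s = 0. *)
Lemma flux_zero U F c r rho : 0 < r -> r < rho -> popen U -> harm U F ->
  (forall x, pdist x c < rho -> U x) ->
  is_RInt (fun t => radial F t (circ c r t)) 0 (2 * PI) 0.
Proof.
  intros Hr Hrho HU HF HS. pose proof PI_RGT_0 as HPI.
  assert (HFc := HF). destruct HF as (P & Q & A & B & H).
  assert (Hin : forall s th, Rabs s < rho -> U (circ c s th)).
  { intros s th Hs. apply HS. unfold pdist. replace (psub (circ c s th) c) with (pscal s (cos th, sin th)).
    - rewrite pnorm_pscal. replace (pnorm (cos th, sin th)) with 1; [lra|].
      symmetry. apply pnorm_eq_nonneg; [lra|]. simpl. pose proof (sin2_cos2 th). unfold Rsqr in H0. lra.
    - unfold psub, circ, padd, pscal; simpl; f_equal; ring. }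
  (* [f] is s F_r, and [g] is (1/s) F_th with the factor s cancelled, hence regular at the centre.
     Since [k] is the s-derivative of [f] and minus the th-derivative of the periodic [g], its
     integral over a period vanishes. *)
  set (f := fun s th => s * (P (circ c s th) * cos th + Q (circ c s th) * sin th)).
  set (k := fun s th => P (circ c s th) * cos th + Q (circ c s th) * sin th
     + s * (A (circ c s th) * (cos th * cos th - sin th * sin th)
            + 2 * (B (circ c s th) * (cos th * sin th)))).
  set (g := fun s th => - (P (circ c s th) * sin th) + Q (circ c s th) * cos th).
  assert (Df : forall s th, Rabs s < rho -> is_derive (fun z => f z th) s (k s th)).
  { intros s th Hs. destruct (H _ (Hin s th Hs)) as (_ & h2 & h3 & _).
    assert (dP : is_derive (fun z => P (circ c z th)) s (A (circ c s th) * cos th + B (circ c s th) * sin th)).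
    { apply (is_derive_line P (fun z => fst c + z * cos th) (fun z => snd c + z * sin th)); auto;
        auto_derive; auto; ring. }
    assert (dQ : is_derive (fun z => Q (circ c z th)) s (B (circ c s th) * cos th + - A (circ c s th) * sin th)).
    { apply (is_derive_line Q (fun z => fst c + z * cos th) (fun z => snd c + z * sin th)); auto;
        auto_derive; auto; ring. }
    unfold f. evar_last.
    - apply (is_derive_mult (fun z => z) (fun z => P (circ c z th) * cos th + Q (circ c z th) * sin th)).
      + apply @is_derive_id.
      + apply @is_derive_plus; apply @is_derive_scal_l; eassumption.
      + intros; apply Rmult_comm.
    - unfold plus, mult, one, scal; simpl. unfold mult; simpl. unfold k. ring. }
  assert (Dg : forall s th, Rabs s < rho -> is_derive (fun t => g s t) th (- k s th)).
  { intros s th Hs. destruct (H _ (Hin s th Hs)) as (_ & h2 & h3 & _).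
    assert (dP : is_derive (fun t => P (circ c s t)) th
       (A (circ c s th) * (s * - sin th) + B (circ c s th) * (s * cos th))).
    { apply (is_derive_line P (fun t => fst c + s * cos t) (fun t => snd c + s * sin t)); auto;
        auto_derive; auto; ring. }
    assert (dQ : is_derive (fun t => Q (circ c s t)) th
       (B (circ c s th) * (s * - sin th) + - A (circ c s th) * (s * cos th))).
    { apply (is_derive_line Q (fun t => fst c + s * cos t) (fun t => snd c + s * sin t)); auto;
        auto_derive; auto; ring. }
    unfold g. evar_last.
    - apply @is_derive_plus.
      + apply @is_derive_opp. apply (is_derive_mult (fun t => P (circ c s t)) sin); [exact dP| |].
        * apply is_derive_Reals, derivable_pt_lim_sin.
        * intros; apply Rmult_comm.
      + apply (is_derive_mult (fun t => Q (circ c s t)) cos); [exact dQ| |].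
        * apply is_derive_Reals, derivable_pt_lim_cos.
        * intros; apply Rmult_comm.
    - unfold plus, mult, opp; simpl. unfold k. ring. }
  assert (Ck : forall s th, Rabs s < rho -> continuity_2d_pt k s th).
  { intros s th Hs. destruct (H _ (Hin s th Hs)) as (h1 & h2 & h3 & h4 & h5).
    assert (cP := continuous_polar P c (s, th) (hasgrad_continuous _ _ _ _ h2)).
    assert (cQ := continuous_polar Q c (s, th) (hasgrad_continuous _ _ _ _ h3)).
    assert (cA := continuous_polar A c (s, th) h4). assert (cB := continuous_polar B c (s, th) h5).
    assert (cc : continuous (fun z : pt => cos (snd z)) (s, th))
      by (apply (continuous_comp snd cos); [apply continuous_Rsnd|apply continuous_cos]).
    assert (cs : continuous (fun z : pt => sin (snd z)) (s, th))
      by (apply (continuous_comp snd sin); [apply continuous_Rsnd|apply continuous_sin]).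
    apply (continuous_2d (fun z => k (fst z) (snd z)) (s, th)). unfold k.
    repeat first [assumption | apply continuous_const | apply continuous_Rfst
      | apply continuous_Rminus | apply continuous_Rplus | apply continuous_Rmult]. }
  assert (Ck1 : forall s th, Rabs s < rho -> continuous (k s) th).
  { intros s th Hs. assert (K := Ck s th Hs). apply (continuous_2d (fun z => k (fst z) (snd z)) (s, th)) in K.
    apply (continuous_comp_2 (fun _ => s) (fun t => t) k th); [apply continuous_const|apply continuous_id|exact K]. }
  assert (Ik : forall s, Rabs s < rho -> RInt (k s) 0 (2 * PI) = 0).
  { intros s Hs. assert (K : is_RInt (fun t => - k s t) 0 (2 * PI) (minus (g s (2 * PI)) (g s 0))).
    { apply (is_RInt_derive (g s)).
      - intros t _. now apply Dg.
      - intros t _. apply (continuous_opp (k s)). now apply Ck1. }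
    apply is_RInt_opp in K.
    apply is_RInt_unique. eapply is_RInt_ext; [|evar_last; [exact K|]].
    - intros t _. unfold opp; simpl. ring.
    - unfold minus, plus, opp, g; simpl. rewrite !circ_eq, cos_2PI, sin_2PI, cos_0, sin_0. ring. }
  set (J := fun s => RInt (f s) 0 (2 * PI)).
  assert (Cf : forall s t, Rabs s < rho -> continuous (f s) t).
  { intros s t Hs. destruct (H _ (Hin s t Hs)) as (h1 & h2 & h3 & h4 & h5).
    unfold f. apply (continuous_mult (fun _ => s)
      (fun t => P (circ c s t) * cos t + Q (circ c s t) * sin t)); [apply continuous_const|].
    apply (continuous_plus (fun t => P (circ c s t) * cos t) (fun t => Q (circ c s t) * sin t)).
    - apply (continuous_mult (fun t => P (circ c s t)) cos); [|apply continuous_cos].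
      apply continuous_on_circle. exact (hasgrad_continuous _ _ _ _ h2).
    - apply (continuous_mult (fun t => Q (circ c s t)) sin); [|apply continuous_sin].
      apply continuous_on_circle. exact (hasgrad_continuous _ _ _ _ h3). }
  assert (Hloc : forall s, Rabs s < rho -> locally s (fun z => Rabs z < rho)).
  { intros s Hs. exists (mkposreal (rho - Rabs s) ltac:(lra)). intros z. change R in (type of z). intros Hz.
    change (Rabs (minus z s) < rho - Rabs s) in Hz. unfold minus, plus, opp in Hz; simpl in Hz.
    pose proof (Rabs_triang (z + - s) s). replace (z + - s + s) with z in H0 by ring. lra. }
  assert (DJ : forall s, Rabs s < rho -> is_derive J s 0).
  { intros s Hs. unfold J. evar_last.
    - apply (is_derive_RInt_param f 0 (2 * PI) s).
      + generalize (Hloc s Hs). apply filter_imp. intros z Hz t _. exists (k z t). now apply Df.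
      + intros t _. apply continuity_2d_pt_ext_loc with k; [|now apply Ck].
        exists (mkposreal (rho - Rabs s) ltac:(lra)). simpl. intros u v Hu _.
        symmetry. apply is_derive_unique, Df.
        pose proof (Rabs_triang (u - s) s). replace (u - s + s) with u in H0 by ring. lra.
      + generalize (Hloc s Hs). apply filter_imp. intros z Hz.
        apply (ex_RInt_continuous (V := R_CompleteNormedModule)). intros t _. now apply Cf.
    - transitivity (RInt (k s) 0 (2 * PI)); [|now apply Ik]. apply RInt_ext. intros t _. now apply is_derive_unique, Df. }
  assert (EJ : J r = 0).
  { assert (E0 : J 0 = 0).
    { unfold J. transitivity (RInt (fun _ => 0) 0 (2 * PI)).
      - apply RInt_ext. intros t _. unfold f. apply Rmult_0_l.
      - rewrite RInt_const. apply Rmult_0_r. }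
    destruct (MVT_gen J 0 r (fun _ => 0)) as [z [_ Hz]].
    - intros x Hx. rewrite Rmin_left, Rmax_right in Hx by lra. apply DJ. rewrite Rabs_pos_eq; lra.
    - intros x Hx. rewrite Rmin_left, Rmax_right in Hx by lra.
      apply continuity_pt_filterlim. apply (@ex_derive_continuous _ R_NormedModule). exists 0. apply DJ. rewrite Rabs_pos_eq; lra.
    - lra. }
  assert (Hc : forall t, continuous (fun t => radial F t (circ c r t)) t).
  { intros t. apply (continuous_radial U); auto. apply Hin. rewrite Rabs_pos_eq; lra. }
  assert (X : ex_RInt (fun t => radial F t (circ c r t)) 0 (2 * PI)).
  { apply (ex_RInt_continuous (V := R_CompleteNormedModule)). intros t _. apply Hc. }
  assert (E : r * RInt (fun t => radial F t (circ c r t)) 0 (2 * PI) = 0).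
  { transitivity (J r); [|exact EJ]. unfold J. symmetry.
    assert (K := RInt_correct (V := R_CompleteNormedModule) _ _ _ X).
    apply (is_RInt_scal _ _ _ r) in K. apply is_RInt_unique.
    eapply is_RInt_ext; [|exact K]. intros t _.
    destruct (H (circ c r t)) as (h1 & _); [apply Hin; rewrite Rabs_pos_eq; lra|].
    unfold scal; simpl. unfold mult; simpl. unfold f, radial.
    now rewrite (hasgrad_dx _ _ _ _ h1), (hasgrad_dy _ _ _ _ h1). }
  evar_last; [apply (RInt_correct (V := R_CompleteNormedModule)), X|]. nra.
Qed.

(** * The singular function h *)

Lemma ln_le_sub_1 x : 0 < x -> ln x <= x - 1.
Proof.
  intros Hx. rewrite <- (ln_exp (x - 1)). apply ln_le; auto.
  pose proof (exp_ineq1_le (x - 1)). lra.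
Qed.

Lemma ln_diff_le a b : 0 < a -> 0 < b -> ln a - ln b <= (a - b) / b.
Proof.
  intros Ha Hb. rewrite <- ln_div; auto. replace ((a - b) / b) with (a / b - 1) by (field; lra).
  apply ln_le_sub_1. now apply Rdiv_lt_0_compat.
Qed.

Lemma hasgrad_hfun p1 p2 x : 0 < pdist x p1 -> 0 < pdist x p2 ->
  hasgrad (hfun p1 p2) x (/ (2 * PI) * (invx p1 x - invx p2 x)) (/ (2 * PI) * (invy p1 x - invy p2 x)).
Proof.
  intros H1 H2. apply hasgrad_ext_all with
    (fun q => / (2 * PI) * (ln (pdist q p1) - ln (pdist q p2))).
  - intros q. unfold hfun, Rdiv. ring.
  - apply hasgrad_scal, hasgrad_minus; now apply hasgrad_ln_pdist.
Qed.

Lemma harm_hfun (U : pt -> Prop) p1 p2 :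
  (forall x, U x -> 0 < pdist x p1 /\ 0 < pdist x p2) -> harm U (hfun p1 p2).
Proof.
  intros HU. apply harm_ext with (fun q => / (2 * PI) * (ln (pdist q p1) - ln (pdist q p2))).
  - intros q. unfold hfun, Rdiv. ring.
  - apply harm_scal, harm_minus; apply harm_ln_pdist; intros; now apply HU.
Qed.

Lemma hfun_opp p1 p2 x : hfun p1 p2 x = - hfun p2 p1 x.
Proof. unfold hfun, Rdiv. ring. Qed.

Lemma tends_hfun p1 p2 : tends_at_inf (hfun p1 p2) 0.
Proof.
  intros eta He. set (L := pdist p1 p2). pose proof (pdist_ge_0 p1 p2) as HL. fold L in HL.
  pose proof PI_RGT_0.
  exists (pnorm p1 + pnorm p2 + (L + 1) / eta). intros x Hx.
  assert (0 < (L + 1) / eta) by (apply Rdiv_lt_0_compat; lra).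
  pose proof (pnorm_ge_0 p1). pose proof (pnorm_ge_0 p2).
  pose proof (pnorm_le_dist x p1). pose proof (pnorm_le_dist x p2).
  pose proof (pdist_triangle x p1 p2) as T1. pose proof (pdist_triangle x p2 p1) as T2.
  rewrite (pdist_sym p2 p1) in T2. fold L in T1, T2.
  set (a := pdist x p1) in *. set (b := pdist x p2) in *.
  assert (K : forall z y, (L + 1) / eta <= z -> y <= L -> y / z <= eta).
  { intros z y Hz Hy. apply Rmult_le_reg_r with z; [lra|].
    replace (y / z * z) with y by (field; lra).
    apply Rmult_le_compat_l with (r := eta) in Hz; [|lra].
    replace (eta * ((L + 1) / eta)) with (L + 1) in Hz by (field; lra). lra. }
  assert (A1 : ln a - ln b <= eta).
  { eapply Rle_trans; [apply ln_diff_le; lra|]. apply K; lra. }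
  assert (A2 : ln b - ln a <= eta).
  { eapply Rle_trans; [apply ln_diff_le; lra|]. apply K; lra. }
  assert (A3 : Rabs (ln a - ln b) <= eta) by (apply Rabs_le_between; lra).
  rewrite Rminus_0_r. unfold hfun, Rdiv. fold a b. rewrite Rabs_mult.
  rewrite (Rabs_pos_eq (/ (2 * PI))) by (left; apply Rinv_0_lt_compat; lra).
  assert (/ (2 * PI) <= 1).
  { rewrite <- Rinv_1. apply Rinv_le_contravar; [lra|]. pose proof PI2_1. lra. }
  assert (0 < / (2 * PI)) by (apply Rinv_0_lt_compat; lra).
  pose proof (Rabs_pos (ln a - ln b)). nra.
Qed.

(** The first circle is a circle of Apollonius for [p1] and [p2]: [x] is its own reflection and [p1]
    is that of [p2], so the distance formula for reflections gives a constant ratio. *)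
Lemma circle_ratio c1 r1 c2 r2 eps p1 p2 x : gap c1 r1 c2 r2 eps -> pdist p2 c2 < r2 ->
  reflect c1 r1 p2 = p1 -> pdist x c1 = r1 ->
  0 < pdist x p2 /\ r1 + eps <= pdist p2 c1 /\ pdist x p1 = r1 / pdist p2 c1 * pdist x p2.
Proof.
  intros G H2 E Hx. pose proof (gap_disk _ _ _ _ _ p2 (gap_sym _ _ _ _ _ G) ltac:(lra)).
  destruct G as (h1 & h2 & he & hD).
  pose proof (pdist_triangle p2 x c1). rewrite (pdist_sym p2 x) in H0.
  split; [lra|]. split; [lra|].
  rewrite <- E. rewrite <- (reflect_circle c1 r1 x) at 1 by auto.
  rewrite pdist_reflect by lra. rewrite Hx. field. lra.
Qed.

Lemma hfun_circle c1 r1 c2 r2 eps p1 p2 x : gap c1 r1 c2 r2 eps -> pdist p2 c2 < r2 ->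
  reflect c1 r1 p2 = p1 -> pdist x c1 = r1 ->
  hfun p1 p2 x = (ln r1 - ln (pdist p2 c1)) / (2 * PI).
Proof.
  intros G H2 E Hx. destruct (circle_ratio _ _ _ _ _ _ _ _ G H2 E Hx) as (K1 & K2 & K3).
  destruct G as (h1 & h2 & he & hD). unfold hfun. rewrite K3.
  rewrite ln_mult; [|apply Rdiv_lt_0_compat; lra|lra]. rewrite ln_div by lra. f_equal. ring.
Qed.

(** On the circle this derivative is the Poisson kernel (l^2 - r1^2) / (2 pi r1 |x - p2|^2) of the
    exterior point [p2], where l = |p2 - c1|. *)
Lemma radial_hfun_pos c1 r1 c2 r2 eps p1 p2 th : gap c1 r1 c2 r2 eps -> pdist p2 c2 < r2 ->
  reflect c1 r1 p2 = p1 -> 0 < radial (hfun p1 p2) th (circ c1 r1 th).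
Proof.
  intros G H2 E. pose proof PI_RGT_0. set (x := circ c1 r1 th).
  assert (Hx : pdist x c1 = r1) by (apply pdist_circ_center; destruct G; lra).
  destruct (circle_ratio _ _ _ _ _ _ _ _ G H2 E Hx) as (K1 & K2 & K3).
  destruct G as (h1 & h2 & he & hD).
  assert (K4 : 0 < r1 / pdist p2 c1) by (apply Rdiv_lt_0_compat; lra).
  assert (K5 : 0 < pdist x p1) by (rewrite K3; apply Rmult_lt_0_compat; lra).
  assert (D := hasgrad_hfun p1 p2 x K5 K1).
  unfold radial. rewrite (hasgrad_dx _ _ _ _ D), (hasgrad_dy _ _ _ _ D).
  set (l := pdist p2 c1) in *.
  assert (S1 : sqd p1 x = (r1 / l) ^ 2 * sqd p2 x) by (rewrite !sqd_pdist, K3; ring).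
  assert (S2 : 0 < sqd p2 x) by now apply sqd_pos.
  assert (SL : sqd c1 p2 = l ^ 2) by (rewrite sqd_pdist; unfold l; ring).
  unfold invx, invy. rewrite S1. set (q := sqd p2 x) in *.
  assert (E1 : fst p1 = fst c1 + (r1 / l) ^ 2 * (fst p2 - fst c1)).
  { rewrite <- E, reflect_inv. simpl fst. unfold invx. rewrite SL. field. lra. }
  assert (E2 : snd p1 = snd c1 + (r1 / l) ^ 2 * (snd p2 - snd c1)).
  { rewrite <- E, reflect_inv. simpl snd. unfold invy. rewrite SL. field. lra. }
  rewrite E1, E2. unfold x. rewrite circ_eq. simpl fst; simpl snd.
  pose proof (sin2_cos2 th) as SC. unfold Rsqr in SC.
  set (cs := cos th) in *. set (sn := sin th) in *.
  replace (_ + _) with (/ (2 * PI) * / q * (r1 * (l ^ 2 / r1 ^ 2 - 1)) * (sn * sn + cs * cs)).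
  - rewrite SC. apply Rmult_lt_0_compat; [|lra].
    apply Rmult_lt_0_compat; [apply Rmult_lt_0_compat; apply Rinv_0_lt_compat; lra|].
    apply Rmult_lt_0_compat; [lra|].
    replace (l ^ 2 / r1 ^ 2 - 1) with ((l ^ 2 - r1 ^ 2) / r1 ^ 2) by (field; lra).
    apply Rdiv_lt_0_compat; [nra|apply pow_lt; lra].
  - field. repeat split; lra.
Qed.

(** * The jump of the boundary potentials *)

(** Near the circle the slopes of [e] along the ray are close to [gam]. If [gam] exceeded [K], the
    mean value theorem between two radii would force more growth than the bounds on [e] at these
    radii allow. *)
Lemma boundary_slope_le c r ep e K gam th : 0 < r -> 0 < ep -> 0 <= K ->
  harm (fun x => r < pdist x c /\ pdist x c < r + ep) e ->
  (forall x, r < pdist x c < r + ep -> Rabs (e x) <= K * (pdist x c - r)) ->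
  (forall eta, 0 < eta -> exists tau, 0 < tau /\ forall t, 0 < t < tau ->
     Rabs (radial e th (circ c (r + t) th) - gam) <= eta) ->
  gam <= K.
Proof.
  intros Hr Hep HK He Hb Hl. apply Rnot_lt_le. intros Hlt.
  destruct (Hl ((gam - K) / 2) ltac:(lra)) as [tau [Htau Hl1]].
  set (K' := (gam + K) / 2).
  set (t := Rmin tau ep / 2).
  assert (Ht : 0 < t /\ t < tau /\ t < ep).
  { unfold t. pose proof (Rmin_l tau ep). pose proof (Rmin_r tau ep).
    assert (0 < Rmin tau ep) by (apply Rmin_glb_lt; lra). lra. }
  (* So small compared with [t] that [K * (t + s) < K' * (t - s)], with [K'] halfway between [K] and
     [gam]. *)
  set (s := t * ((K' - K) / (2 * (K + K')))).
  assert (Hq : 0 < (K' - K) / (2 * (K + K')) < 1).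
  { unfold K'. split; [apply Rdiv_lt_0_compat; lra|].
    apply Rmult_lt_reg_r with (2 * (K + (gam + K) / 2)); [lra|].
    unfold Rdiv at 1. rewrite Rmult_assoc, Rinv_l; lra. }
  assert (Hs : 0 < s < t) by (unfold s; nra).
  assert (Hd : forall z, 0 < z < r + ep -> pdist (circ c z th) c = z)
    by (intros; apply pdist_circ_center; lra).
  destruct (MVT_cor2 (fun z => e (circ c (r + z) th)) (fun z => radial e th (circ c (r + z) th)) s t)
    as [z [E Hz]]; [lra| |].
  { intros z Hz. apply is_derive_Reals.
    apply (is_derive_line e (fun z => fst c + (r + z) * cos th) (fun z => snd c + (r + z) * sin th)).
    - apply (harm_grad _ e _ He). change (r < pdist (circ c (r + z) th) c /\ pdist (circ c (r + z) th) c < r + ep).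
      rewrite Hd; lra.
    - auto_derive; auto; ring.
    - auto_derive; auto; ring. }
  assert (A1 := Hb (circ c (r + t) th)). rewrite Hd in A1 by lra. specialize (A1 ltac:(lra)).
  assert (A2 := Hb (circ c (r + s) th)). rewrite Hd in A2 by lra. specialize (A2 ltac:(lra)).
  apply Rabs_le_between in A1, A2.
  assert (A3 := Hl1 z ltac:(lra)). apply Rabs_le_between in A3.
  assert (K' <= radial e th (circ c (r + z) th)) by (unfold K'; lra).
  assert (K' * (t - s) <= K * t + K * s) by nra.
  assert (s * (2 * (K + K')) = t * (K' - K)) by (unfold s; field; unfold K'; lra).
  assert (0 < t * (K' - K)) by (apply Rmult_lt_0_compat; unfold K'; lra).
  nra.
Qed.

Lemma radial_opp U F th p : harm U F -> U p -> radial (fun q => - F q) th p = - radial F th p.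
Proof.
  intros HF Hp. assert (D := hasgrad_opp _ _ _ _ (harm_grad _ _ _ HF Hp)).
  unfold radial. rewrite (hasgrad_dx _ _ _ _ D), (hasgrad_dy _ _ _ _ D). ring.
Qed.

Lemma boundary_slope_abs_le c r ep e K gam th : 0 < r -> 0 < ep -> 0 <= K ->
  harm (fun x => r < pdist x c /\ pdist x c < r + ep) e ->
  (forall x, r < pdist x c < r + ep -> Rabs (e x) <= K * (pdist x c - r)) ->
  (forall eta, 0 < eta -> exists tau, 0 < tau /\ forall t, 0 < t < tau ->
     Rabs (radial e th (circ c (r + t) th) - gam) <= eta) ->
  Rabs gam <= K.
Proof.
  intros Hr Hep HK He Hb Hl. apply Rabs_le_between. split.
  - enough (- gam <= K) by lra.
    apply (boundary_slope_le c r ep (fun q => - e q) K (- gam) th); auto.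
    + now apply harm_opp.
    + intros. rewrite Rabs_Ropp. auto.
    + intros eta Heta. destruct (Hl eta Heta) as [tau [Ht H]]. exists (Rmin tau ep).
      split; [apply Rmin_glb_lt; auto|]. intros t Htt.
      pose proof (Rmin_l tau ep). pose proof (Rmin_r tau ep).
      rewrite (radial_opp _ e _ _ He).
      * replace (- radial e th (circ c (r + t) th) - - gam)
          with (- (radial e th (circ c (r + t) th) - gam)) by ring.
        rewrite Rabs_Ropp. apply H. lra.
      * rewrite pdist_circ_center; lra.
  - now apply (boundary_slope_le c r ep e K gam th).
Qed.

Lemma ext2_boundary c1 r1 c2 r2 (P : pt -> Prop) :
  (forall y, pdist y c1 = r1 -> locally y (fun q => ext2 c1 r1 c2 r2 q -> P q)) ->
  (forall y, pdist y c2 = r2 -> locally y (fun q => ext2 c1 r1 c2 r2 q -> P q)) ->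
  forall p, ~ ext2 c1 r1 c2 r2 p -> locally p (fun q => ext2 c1 r1 c2 r2 q -> P q).
Proof.
  intros H1 H2 p Hp.
  destruct (Rtotal_order (pdist p c1) r1) as [L|[L|L]]; [|now apply H1|].
  { generalize (popen_dist_lt c1 r1 p L). apply filter_imp. intros q Hq [Hq1 _]. lra. }
  destruct (Rtotal_order (pdist p c2) r2) as [L2|[L2|L2]]; [|now apply H2|].
  { generalize (popen_dist_lt c2 r2 p L2). apply filter_imp. intros q Hq [_ Hq1]. lra. }
  exfalso. apply Hp. split; auto.
Qed.

Lemma ext2_far c1 r1 c2 r2 K : exists x, ext2 c1 r1 c2 r2 x /\ K <= pnorm x.
Proof.
  set (m := Rabs r1 + Rabs r2 + pnorm c1 + pnorm c2 + Rabs K + 1).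
  pose proof (Rabs_pos r1). pose proof (Rabs_pos r2). pose proof (Rabs_pos K).
  pose proof (Rle_abs r1). pose proof (Rle_abs r2). pose proof (Rle_abs K).
  pose proof (pnorm_ge_0 c1). pose proof (pnorm_ge_0 c2).
  assert (E : pnorm (m, 0) = m) by (apply pnorm_eq_nonneg; [unfold m; lra|simpl; ring]).
  pose proof (pnorm_le_dist (m, 0) c1). pose proof (pnorm_le_dist (m, 0) c2).
  exists (m, 0). unfold ext2. unfold m in *. repeat split; lra.
Qed.

Lemma filterlim_within_near (E : pt -> Prop) (v : pt -> R) y l :
  filterlim v (within E (locally y)) (locally l) -> forall eta, 0 < eta ->
  locally y (fun q => E q -> Rabs (v q - l) < eta).
Proof.
  intros H eta He. apply (H (fun z => Rabs (z - l) < eta)). now exists (mkposreal _ He).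
Qed.

Lemma radial_minus U F G th p : harm U F -> harm U G -> U p ->
  radial (fun q => F q - G q) th p = radial F th p - radial G th p.
Proof.
  intros HF HG Hp. assert (D := hasgrad_minus _ _ _ _ _ _ _ (harm_grad _ _ _ HF Hp) (harm_grad _ _ _ HG Hp)).
  unfold radial. rewrite (hasgrad_dx _ _ _ _ D), (hasgrad_dy _ _ _ _ D). ring.
Qed.

Lemma radial_scal U F k th p : harm U F -> U p -> radial (fun q => k * F q) th p = k * radial F th p.
Proof.
  intros HF Hp. assert (D := hasgrad_scal k _ _ _ _ (harm_grad _ _ _ HF Hp)).
  unfold radial. rewrite (hasgrad_dx _ _ _ _ D), (hasgrad_dy _ _ _ _ D). ring.
Qed.

(** At a point of its own circle the differential of the reflection is the mirror in the tangent
    line, which reverses the normal. *)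
Lemma radial_reflect_circle U F c r th : 0 < r -> harm U F -> U (circ c r th) ->
  radial (fun q => F (reflect c r q)) th (circ c r th) = - radial F th (circ c r th).
Proof.
  intros Hr HF Hp. set (x := circ c r th) in *.
  assert (Hx : pdist x c = r) by (apply pdist_circ_center; lra).
  assert (D := harm_grad _ _ _ HF Hp). rewrite <- (reflect_circle c r x Hr Hx) in D at 1.
  assert (D2 := hasgrad_reflect F c r x _ _ ltac:(lra) D).
  unfold radial. rewrite (hasgrad_dx _ _ _ _ D2), (hasgrad_dy _ _ _ _ D2).
  assert (S : sqd c x = r ^ 2) by (rewrite sqd_pdist, Hx; ring).
  assert (I1 : invx c x = cos th / r).
  { unfold invx. rewrite S. unfold x. rewrite circ_eq. simpl fst. field. lra. }
  assert (I2 : invy c x = sin th / r).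
  { unfold invy. rewrite S. unfold x. rewrite circ_eq. simpl snd. field. lra. }
  rewrite I1, I2. pose proof (sin2_cos2 th) as SC. unfold Rsqr in SC.
  set (a := dx F x). set (b := dy F x).
  replace (- (a * cos th + b * sin th))
    with (- (a * cos th + b * sin th) * (sin th * sin th + cos th * cos th)) by (rewrite SC; ring).
  field. lra.
Qed.

Lemma circle_offcenter c1 r1 c2 r2 eps x : gap c1 r1 c2 r2 eps -> r1 <= pdist x c1 -> r2 <= pdist x c2 ->
  offcenter c1 r1 c2 r2 eps x.
Proof.
  intros (h1 & h2 & he & hD) H1 H2. pose proof (offcenter_radius r1 eps h1 he).
  pose proof (offcenter_radius r2 eps h2 he). split; lra.
Qed.

(** Each new pair is [W] minus its reflection, whose normal derivative on the circle is twice that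
    of [W]. The word [W] starts with the other reflection, or is [H], so it is harmonic in a disk
    about [c1] larger than the first one and has no flux. *)
Lemma image_sum_flux H k c1 r1 c2 r2 eps : gap c1 r1 c2 r2 eps -> harm (fun _ => True) H ->
  is_RInt (fun t => radial (image_sum H k (reflect c1 r1) (reflect c2 r2)) t (circ c1 r1 t)) 0 (2 * PI) 0.
Proof.
  intros G HH. pose proof (gap_sym _ _ _ _ _ G) as G'.
  assert (Hoff : forall t, offcenter c1 r1 c2 r2 eps (circ c1 r1 t)).
  { intros t. assert (E : pdist (circ c1 r1 t) c1 = r1) by (apply pdist_circ_center; destruct G; lra).
    apply circle_offcenter; [auto|lra|].
    pose proof (gap_disk _ _ _ _ _ (circ c1 r1 t) G ltac:(lra)). destruct G as (_ & _ & he & _). lra. }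
  induction k as [|k IH].
  - eapply is_RInt_ext; [|evar_last; [apply (is_RInt_const 0 (2 * PI) 0)|]].
    + intros t _. simpl. unfold radial.
      rewrite (hasgrad_dx _ _ _ _ (hasgrad_const 0 (circ c1 r1 t))), (hasgrad_dy _ _ _ _ (hasgrad_const 0 (circ c1 r1 t))).
      ring.
    + apply Rmult_0_r.
  - set (W := word H k (reflect c2 r2) (reflect c1 r1)).
    assert (hW : harm (fun x => r2 ^ 2 / (r2 + eps / 2) < pdist x c2) W) by now apply harm_word.
    assert (FW : is_RInt (fun t => radial W t (circ c1 r1 t)) 0 (2 * PI) 0).
    { apply flux_zero with (2 := ltac:(destruct G as (_ & _ & he & _); lra) : r1 < r1 + eps) (4 := hW).
      - apply G.
      - apply popen_lt_dist.
      - intros x Hx. pose proof (gap_dist _ _ _ _ _ x eps G ltac:(lra)).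
        destruct G as (h1 & h2 & he & _). pose proof (offcenter_radius r2 eps h2 he). lra. }
    apply (is_RInt_scal _ _ _ ((-1) ^ k * 2)) in FW.
    assert (FS := is_RInt_plus _ _ _ _ _ _ IH FW).
    eapply is_RInt_ext; [|evar_last; [exact FS|]].
    + intros t _. set (x := circ c1 r1 t).
      assert (hS := harm_image_sum H k _ _ _ _ _ G HH).
      assert (D0 := harm_grad _ _ _ hS (Hoff t)).
      assert (hW1 : harm (offcenter c1 r1 c2 r2 eps) W) by (apply harm_sub with (2 := hW); now intros y []).
      assert (hW2 : harm (offcenter c1 r1 c2 r2 eps) (fun y => W (reflect c1 r1 y))).
      { apply harm_sub with (2 := harm_word H (S k) _ _ _ _ _ G HH). now intros y []. }
      assert (D1 := harm_grad _ _ _ hW1 (Hoff t)). assert (D2 := harm_grad _ _ _ hW2 (Hoff t)).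
      assert (D := hasgrad_plus _ _ _ _ _ _ _ D0 (hasgrad_scal ((-1) ^ k) _ _ _ _ (hasgrad_minus _ _ _ _ _ _ _ D1 D2))).
      assert (R2 := radial_reflect_circle _ W c1 r1 t ltac:(apply G) hW1 (Hoff t)).
      change (image_sum H (S k) (reflect c1 r1) (reflect c2 r2)) with
        (fun y => image_sum H k (reflect c1 r1) (reflect c2 r2) y + (-1) ^ k * (W y - W (reflect c1 r1 y))).
      unfold radial in *. cbv beta in D. unfold x.
      rewrite (hasgrad_dx _ _ _ _ D), (hasgrad_dy _ _ _ _ D).
      unfold plus, scal; simpl. unfold mult; simpl.
      set (d1 := dx (fun q => W (reflect c1 r1 q)) (circ c1 r1 t)) in *.
      set (d2 := dy (fun q => W (reflect c1 r1 q)) (circ c1 r1 t)) in *.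
      set (s := (-1) ^ k) in *.
      replace ((dx (image_sum H k (reflect c1 r1) (reflect c2 r2)) (circ c1 r1 t) + s * (dx W (circ c1 r1 t) - d1)) * cos t +
         (dy (image_sum H k (reflect c1 r1) (reflect c2 r2)) (circ c1 r1 t) + s * (dy W (circ c1 r1 t) - d2)) * sin t)
       with (dx (image_sum H k (reflect c1 r1) (reflect c2 r2)) (circ c1 r1 t) * cos t
          + dy (image_sum H k (reflect c1 r1) (reflect c2 r2)) (circ c1 r1 t) * sin t
          + s * (dx W (circ c1 r1 t) * cos t + dy W (circ c1 r1 t) * sin t) - s * (d1 * cos t + d2 * sin t)) by ring.
      rewrite R2. ring.
    + unfold plus, scal; simpl. unfold mult; simpl. ring.
Qed.

(** * Boundary values of h and the comparison of u with the image sums *)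

Definition fixed_pair (c1 : pt) (r1 : R) (c2 : pt) (r2 : R) (p1 p2 : pt) : Prop :=
  pdist p1 c1 < r1 /\ pdist p2 c2 < r2 /\ reflect c2 r2 p1 = p2 /\ reflect c1 r1 p2 = p1.

Definition hval1 (c1 : pt) (r1 : R) (p2 : pt) : R := (ln r1 - ln (pdist p2 c1)) / (2 * PI).
Definition hval2 (c2 : pt) (r2 : R) (p1 : pt) : R := (ln (pdist p1 c2) - ln r2) / (2 * PI).

Lemma hval_lt c1 r1 c2 r2 eps p1 p2 : gap c1 r1 c2 r2 eps -> fixed_pair c1 r1 c2 r2 p1 p2 ->
  hval1 c1 r1 p2 < hval2 c2 r2 p1.
Proof.
  intros G (H1 & H2 & _). pose proof (gap_disk _ _ _ _ _ p1 G ltac:(lra)).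
  pose proof (gap_disk _ _ _ _ _ p2 (gap_sym _ _ _ _ _ G) ltac:(lra)).
  destruct G as (h1 & h2 & he & _). unfold hval1, hval2.
  apply Rmult_lt_compat_r; [apply Rinv_0_lt_compat; pose proof PI_RGT_0; lra|].
  pose proof (ln_increasing r1 (pdist p2 c1) h1 ltac:(lra)).
  pose proof (ln_increasing r2 (pdist p1 c2) h2 ltac:(lra)). lra.
Qed.

Lemma hfun_circle1 c1 r1 c2 r2 eps p1 p2 x : gap c1 r1 c2 r2 eps -> fixed_pair c1 r1 c2 r2 p1 p2 ->
  pdist x c1 = r1 -> hfun p1 p2 x = hval1 c1 r1 p2.
Proof. intros G (H1 & H2 & E2 & E1) Hx. now apply (hfun_circle c1 r1 c2 r2 eps). Qed.

Lemma hfun_circle2 c1 r1 c2 r2 eps p1 p2 x : gap c1 r1 c2 r2 eps -> fixed_pair c1 r1 c2 r2 p1 p2 ->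
  pdist x c2 = r2 -> hfun p1 p2 x = hval2 c2 r2 p1.
Proof.
  intros G (H1 & H2 & E2 & E1) Hx. rewrite hfun_opp.
  rewrite (hfun_circle c2 r2 c1 r1 eps p2 p1 x (gap_sym _ _ _ _ _ G) H1 E2 Hx).
  unfold hval2, Rdiv. ring.
Qed.

Lemma fixed_pair_apart c1 r1 c2 r2 p1 p2 x : fixed_pair c1 r1 c2 r2 p1 p2 ->
  r1 <= pdist x c1 -> r2 <= pdist x c2 -> 0 < pdist x p1 /\ 0 < pdist x p2.
Proof.
  intros (H1 & H2 & _) Hx1 Hx2. pose proof (pdist_triangle x p1 c1). pose proof (pdist_triangle x p2 c2).
  lra.
Qed.

Lemma harm_hfun_ext2 c1 r1 c2 r2 p1 p2 : fixed_pair c1 r1 c2 r2 p1 p2 ->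
  harm (ext2 c1 r1 c2 r2) (hfun p1 p2).
Proof.
  intros Hf. apply harm_hfun. intros x [Hx1 Hx2].
  apply (fixed_pair_apart c1 r1 c2 r2); auto; lra.
Qed.

Lemma continuous_hfun c1 r1 c2 r2 p1 p2 x : fixed_pair c1 r1 c2 r2 p1 p2 ->
  r1 <= pdist x c1 -> r2 <= pdist x c2 -> continuous (hfun p1 p2) x.
Proof.
  intros Hf H1 H2. destruct (fixed_pair_apart _ _ _ _ _ _ _ Hf H1 H2).
  eapply hasgrad_continuous, hasgrad_hfun; auto.
Qed.

Lemma solution_tends u H : (exists M R0, 0 < R0 /\
     forall x, R0 <= pnorm x -> Rabs (u x - H x) <= M / pnorm x) ->
  tends_at_inf (fun x => u x - H x) 0.
Proof.
  intros (M & R0 & HR & HM) eta He. pose proof (Rabs_pos M).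
  assert (0 < (Rabs M + 1) / eta) by (apply Rdiv_lt_0_compat; lra).
  exists (R0 + (Rabs M + 1) / eta). intros x Hx. rewrite Rminus_0_r.
  eapply Rle_trans; [apply HM; lra|].
  apply Rmult_le_reg_r with (pnorm x); [lra|].
  replace (M / pnorm x * pnorm x) with M by (field; lra).
  assert (eta * ((Rabs M + 1) / eta) <= eta * pnorm x) by (apply Rmult_le_compat_l; lra).
  replace (eta * ((Rabs M + 1) / eta)) with (Rabs M + 1) in H2 by (field; lra).
  pose proof (Rle_abs M). lra.
Qed.

(** A common form for all boundary comparisons below: [Z] is an image sum, which vanishes at [y],
    and [W] a word that is nearly constant. Taking one or both to be 0 gives the simpler cases. *)
Lemma near_ext2_circle (E : pt -> Prop) (u Z W h : pt -> R) lam w0 h0 al delta y eta :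
  filterlim u (within E (locally y)) (locally lam) ->
  continuous Z y -> Z y = 0 -> (forall q, E q -> Rabs (W q - w0) <= delta) ->
  continuous h y -> h y = h0 -> 0 < eta ->
  locally y (fun q => E q ->
    Rabs ((u q - lam) - Z q - (W q - w0) - al * (h q - h0)) <= delta + eta).
Proof.
  intros Hu CZ Z0 HW Ch h00 He. assert (He3 : 0 < eta / 3) by lra.
  assert (Cah : continuous (fun q => al * h q) y)
    by (apply continuous_Rmult; [apply continuous_const|auto]).
  generalize (filter_and _ _ (filterlim_within_near E u y lam Hu (eta / 3) He3)
    (filter_and _ _ (continuous_near Z y (eta / 3) CZ He3)
       (continuous_near _ y (eta / 3) Cah He3))).
  apply filter_imp. intros q [A1 [A2 A3]] Hq. specialize (A1 Hq). specialize (HW q Hq).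
  rewrite Z0 in A2. cbv beta in A3. rewrite h00 in A3.
  apply Rabs_lt_between in A1, A2, A3. apply Rabs_le_between in HW. apply Rabs_le_between. lra.
Qed.

(** The image sum completed by its last word is within delta of a constant on either circle. The
    quotient [al] adjusts the multiple of h so that [v] has nearly the same boundary value [kap] on
    both, and the exterior maximum principle extends |v - kap| <= delta to the whole exterior. *)
Lemma image_comparison H c1 r1 c2 r2 eps p1 p2 u lam1 lam2 delta :
  gap c1 r1 c2 r2 eps -> harm (fun _ => True) H -> fixed_pair c1 r1 c2 r2 p1 p2 ->
  is_solution c1 r1 c2 r2 H u lam1 lam2 -> 0 < delta ->
  let al := ((lam2 - H p2) - (lam1 - H p1)) / (hval2 c2 r2 p1 - hval1 c1 r1 p2) in
  exists n, forall x, ext2 c1 r1 c2 r2 x ->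
    Rabs ((u x - lam1) - image_sum H (2 * n) (reflect c1 r1) (reflect c2 r2) x
      - al * (hfun p1 p2 x - hval1 c1 r1 p2)) <= 4 * delta.
Proof.
  intros G HH Hf (Hu & Hb1 & Hb2 & Hinf & _) Hd al.
  pose proof (gap_sym _ _ _ _ _ G) as G'. pose proof (hval_lt _ _ _ _ _ _ _ G Hf) as Hlt.
  set (E := ext2 c1 r1 c2 r2) in *. pose proof (popen_ext2 c1 r1 c2 r2) as HE. fold E in HE.
  apply harmonic_on_harm in Hu; auto.
  set (h := hfun p1 p2). set (h1 := hval1 c1 r1 p2) in *. set (h2 := hval2 c2 r2 p1) in *.
  assert (CH : forall p, continuous H p) by (intros p; now apply (harm_continuous _ _ p HH)).
  destruct Hf as (P1 & P2 & E2 & E1) eqn:EF.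
  destruct (word_limit H c1 r1 c2 r2 eps p1 delta G P1 ltac:(now rewrite E2) (CH p1) Hd) as [n1 Hn1].
  destruct (word_limit H c2 r2 c1 r1 eps p2 delta G' P2 ltac:(now rewrite E1) (CH p2) Hd) as [n2 Hn2].
  set (n := Nat.max n1 n2). exists n.
  specialize (Hn1 n ltac:(lia)). specialize (Hn2 n ltac:(lia)).
  set (R1 := reflect c1 r1) in *. set (R2 := reflect c2 r2) in *.
  destruct (image_sum_tends H (2 * n) c1 r1 c2 r2 eps G HH) as [l Hl].
  (* With even length the sign is 1, and the last words are [H] composed with iterates of R1 R2 or
     R2 R1, which tend to [H p1] and [H p2]. *)
  assert (Sg : (-1) ^ (2 * n) = 1) by apply pow_1_even.
  rewrite Sg in Hl. fold R1 R2 in Hl.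
  assert (Sw := fun x => image_sum_swap H (2 * n) R1 R2 x). rewrite Sg in Sw.
  assert (hZ := harm_image_sum H (2 * n) c1 r1 c2 r2 eps G HH). fold R1 R2 in hZ.
  assert (hZ' := harm_image_sum H (2 * n) c2 r2 c1 r1 eps G' HH). fold R1 R2 in hZ'.
  assert (hW := harm_word H (2 * n) c2 r2 c1 r1 eps G' HH). fold R1 R2 in hW.
  set (Z := image_sum H (2 * n) R1 R2) in *. set (Z' := image_sum H (2 * n) R2 R1) in *.
  set (W1 := word H (2 * n) R2 R1) in *. set (W2 := word H (2 * n) R1 R2) in *.
  (* The constant [l] is the limit of Z + W1 - H at infinity, so that [v] tends to 0 there. On the
     second circle Z + W1 is rewritten as Z' + W2, where Z' vanishes. *)
  set (v := fun x => u x - (Z x + W1 x) + l - al * h x).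
  set (kap := lam1 - H p1 + l - al * h1).
  assert (Hal : al * (h2 - h1) = (lam2 - H p2) - (lam1 - H p1)) by (unfold al; field; lra).
  assert (Hoff : forall x, E x -> offcenter c1 r1 c2 r2 eps x).
  { intros x [X1 X2]. apply circle_offcenter; auto; lra. }
  assert (hv : harm E v).
  { unfold v. apply harm_minus; [|apply harm_scal; now apply harm_hfun_ext2].
    apply harm_plus; [|apply harm_const]. apply harm_minus; auto. apply harm_plus.
    - now apply harm_sub with (2 := hZ).
    - apply harm_sub with (2 := hW). intros x Hx. apply (Hoff x Hx). }
  assert (tv : tends_at_inf v 0).
  { replace 0 with (0 + (-1 * l + (l + - al * 0))) by ring.
    eapply tends_ext; [|apply tends_plus; [exact (solution_tends u H Hinf)|
      apply tends_plus; [apply tends_scal; exact Hl|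
      apply tends_plus; [apply tends_const|apply tends_scal; exact (tends_hfun p1 p2)]]]].
    intros x. unfold v. fold h. ring. }
  assert (Hbd : forall eta, 0 < eta -> forall p, ~ E p ->
     locally p (fun q => E q -> Rabs (v q - kap) <= delta + eta)).
  { intros eta He. apply ext2_boundary; intros y Hy.
    - assert (Y2 : r2 <= pdist y c2).
      { pose proof (gap_disk _ _ _ _ _ y G ltac:(lra)). destruct G as (_ & _ & he & _). lra. }
      generalize (near_ext2_circle E u Z W1 h lam1 (H p1) h1 al delta y eta (Hb1 y Hy)
        (harm_continuous _ _ _ hZ (circle_offcenter _ _ _ _ _ y G ltac:(lra) Y2))
        (image_sum_zero H (2 * n) R1 R2 y (reflect_circle c1 r1 y ltac:(apply G) Hy))
        ltac:(intros q [_ Q2]; apply Hn1; lra)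
        (continuous_hfun _ _ _ _ _ _ y Hf ltac:(lra) Y2)
        (hfun_circle1 _ _ _ _ _ _ _ y G Hf Hy) He).
      apply filter_imp. intros q Hq HEq. specialize (Hq HEq). unfold v, kap.
      match goal with |- Rabs ?X <= _ => match type of Hq with Rabs ?Y <= _ => replace X with Y by ring end end.
      exact Hq.
    - assert (Y1 : r1 <= pdist y c1).
      { pose proof (gap_disk _ _ _ _ _ y G' ltac:(lra)). destruct G as (_ & _ & he & _). lra. }
      generalize (near_ext2_circle E u Z' W2 h lam2 (H p2) h2 al delta y eta (Hb2 y Hy)
        (harm_continuous _ _ _ hZ' (circle_offcenter _ _ _ _ _ y G' ltac:(lra) Y1))
        (image_sum_zero H (2 * n) R2 R1 y (reflect_circle c2 r2 y ltac:(apply G) Hy))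
        ltac:(intros q [Q1 _]; apply Hn2; lra)
        (continuous_hfun _ _ _ _ _ _ y Hf Y1 ltac:(lra))
        (hfun_circle2 _ _ _ _ _ _ _ y G Hf Hy) He).
      apply filter_imp. intros q Hq HEq. specialize (Hq HEq). unfold v, kap.
      match goal with |- Rabs ?X <= _ => match type of Hq with Rabs ?Y <= _ => replace X with Y end end.
      + exact Hq.
      + specialize (Sw q). lra. }
  assert (X1 := exterior_maximum_principle E c1 r1 v (kap + delta) ltac:(apply G) HE
    ltac:(intros x [X _]; exact X) (ext2_far c1 r1 c2 r2) hv).
  destruct X1 as [X1 X2].
  { intros p Hp eta He. generalize (Hbd eta He p Hp). apply filter_imp. intros q Hq HEq.
    specialize (Hq HEq). apply Rabs_le_between in Hq. lra. }
  { intros eta He. destruct (tv eta He) as [K HK]. exists K. intros x _ Hx.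
    specialize (HK x Hx). now rewrite Rminus_0_r in HK. }
  assert (X3 := exterior_maximum_principle E c1 r1 (fun x => - v x) (delta - kap) ltac:(apply G) HE
    ltac:(intros x [X _]; exact X) (ext2_far c1 r1 c2 r2) (harm_opp _ _ hv)).
  destruct X3 as [X3 X4].
  { intros p Hp eta He. generalize (Hbd eta He p Hp). apply filter_imp. intros q Hq HEq.
    specialize (Hq HEq). apply Rabs_le_between in Hq. lra. }
  { intros eta He. destruct (tv eta He) as [K HK]. exists K. intros x _ Hx.
    specialize (HK x Hx). rewrite Rminus_0_r in HK. now rewrite Rabs_Ropp. }
  intros x Hx. specialize (X2 x Hx). specialize (X4 x Hx). cbv beta in X4.
  assert (HW := Hn1 x ltac:(destruct Hx; lra)). apply Rabs_le_between in HW.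
  (* The last word is removed again, at the price of another delta: what remains is small and tends
     to exactly 0 at the first circle. *)
  replace (u x - lam1 - Z x - al * (h x - h1)) with (v x + (W1 x - H p1) - kap)
    by (unfold v, kap; ring).
  apply Rabs_le_between. lra.
Qed.

Lemma continuous_radial_fixed U F th p : popen U -> harm U F -> U p ->
  continuous (fun q => radial F th q) p.
Proof.
  intros HU HF Hp. destruct (harm_grad_continuous U F p HU HF Hp) as [Cx Cy].
  unfold radial. apply continuous_Rplus; (apply continuous_Rmult; [assumption|apply continuous_const]).
Qed.

(** The error [e] is at most [4 * delta] and vanishes on the first circle, so its normal derivative
    and its flux are O(delta). The fluxes of [u] and of the image sum are zero, hence [al] times the
    positive flux of h is O(delta) for every delta. *)
Lemma potential_jump H c1 r1 c2 r2 eps p1 p2 u lam1 lam2 :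
  gap c1 r1 c2 r2 eps -> harm (fun _ => True) H -> fixed_pair c1 r1 c2 r2 p1 p2 ->
  is_solution c1 r1 c2 r2 H u lam1 lam2 -> lam2 - lam1 = H p2 - H p1.
Proof.
  intros G HH Hf Hsol. pose proof PI_RGT_0 as HPI.
  pose proof (hval_lt _ _ _ _ _ _ _ G Hf) as Hlt.
  set (al := ((lam2 - H p2) - (lam1 - H p1)) / (hval2 c2 r2 p1 - hval1 c1 r1 p2)).
  set (h1 := hval1 c1 r1 p2) in *. set (h2 := hval2 c2 r2 p1) in *.
  enough (Hal : al = 0).
  { assert (al * (h2 - h1) = (lam2 - H p2) - (lam1 - H p1)) by (unfold al; field; lra).
    rewrite Hal in H0. lra. }
  assert (Hcmp := fun delta => image_comparison H c1 r1 c2 r2 eps p1 p2 u lam1 lam2 delta G HH Hf Hsol).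
  cbv zeta in Hcmp. fold h1 h2 al in Hcmp.
  destruct Hsol as (Hu & Hb1 & _ & _ & (g & Hg & Ig) & _).
  set (E := ext2 c1 r1 c2 r2) in *. pose proof (popen_ext2 c1 r1 c2 r2) as HE. fold E in HE.
  apply harmonic_on_harm in Hu; auto.
  set (h := hfun p1 p2) in *.
  destruct G as (g1 & g2 & he & gD) eqn:EG.
  (* The first bound is |p1 - c1|: h is harmonic outside the smaller disk through [p1], and this
     open set contains the whole first circle. *)
  set (O := fun x => (r1 - (r1 - pdist p1 c1) < pdist x c1) /\ r2 < pdist x c2).
  assert (HO : popen O) by (apply popen_and; apply popen_lt_dist).
  assert (hh : harm O h).
  { apply harm_hfun. intros x [X1 X2]. destruct Hf as (P1 & P2 & _).
    pose proof (pdist_triangle x p1 c1). pose proof (pdist_triangle x p2 c2). lra. }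
  assert (Ocirc : forall th, O (circ c1 r1 th)).
  { intros th. assert (X : pdist (circ c1 r1 th) c1 = r1) by (apply pdist_circ_center; lra).
    destruct Hf as (P1 & _). pose proof (gap_disk _ _ _ _ _ (circ c1 r1 th) G ltac:(lra)).
    split; lra. }
  set (I := RInt (fun t => radial h t (circ c1 r1 t)) 0 (2 * PI)).
  assert (Ch : forall t, continuous (fun t => radial h t (circ c1 r1 t)) t)
    by (intros t; now apply (continuous_radial O)).
  assert (XI : is_RInt (fun t => radial h t (circ c1 r1 t)) 0 (2 * PI) I).
  { apply (RInt_correct (V := R_CompleteNormedModule)).
    apply (ex_RInt_continuous (V := R_CompleteNormedModule)). intros t _. apply Ch. }
  assert (HI : 0 < I).
  { apply RInt_gt_0; [lra| |intros; apply Ch]. intros t _. destruct Hf as (P1 & P2 & E2 & E1).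
    now apply (radial_hfun_pos c1 r1 c2 r2 eps). }
  assert (Hln : 0 < ln (r1 + eps) - ln r1) by (pose proof (ln_increasing r1 (r1 + eps)); lra).
  (* The slope, per unit of delta, of the barrier of height [4 * delta] in an annulus of width
     [eps], which stays clear of the second disk; ln (|x - c1| / r1) is at most (|x - c1| - r1) /
     r1. *)
  set (K := 4 / (ln (r1 + eps) - ln r1) / r1).
  assert (HK : 0 < K) by (unfold K; apply Rdiv_lt_0_compat; [apply Rdiv_lt_0_compat; lra|lra]).
  assert (Hmain : forall delta, 0 < delta -> Rabs al * I <= 2 * PI * K * delta).
  { intros delta Hd. destruct (Hcmp delta Hd) as [n Hn].
    set (Z := image_sum H (2 * n) (reflect c1 r1) (reflect c2 r2)) in *.
    assert (hZ := harm_image_sum H (2 * n) c1 r1 c2 r2 eps G HH). fold Z in hZ.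
    assert (FZ := image_sum_flux H (2 * n) c1 r1 c2 r2 eps G HH). fold Z in FZ.
    set (e := fun x => (u x - Z x) - al * h x + (al * h1 - lam1)).
    set (An := fun x => r1 < pdist x c1 /\ pdist x c1 < r1 + eps).
    assert (AnE : forall x, An x -> E x).
    { intros x [X1 X2]. split; auto. pose proof (gap_dist _ _ _ _ _ x (pdist x c1 - r1) G ltac:(lra)). lra. }
    assert (Eoff : forall x, E x -> offcenter c1 r1 c2 r2 eps x).
    { intros x [X1 X2]. apply circle_offcenter; auto; lra. }
    assert (EO : forall x, E x -> O x).
    { intros x [X1 X2]. destruct Hf as (P1 & _). split; lra. }
    assert (hZE : harm E Z) by now apply harm_sub with (2 := hZ).
    assert (hhE : harm E h) by now apply harm_sub with (2 := hh).
    assert (huZ : harm E (fun x => u x - Z x)) by now apply harm_minus.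
    assert (hah : harm E (fun x => al * h x)) by now apply harm_scal.
    assert (he1 : harm E (fun x => u x - Z x - al * h x)) by now apply harm_minus.
    assert (heE : harm E e) by (unfold e; apply harm_plus; [auto|apply harm_const]).
    assert (heb : forall x, E x -> Rabs (e x) <= 4 * delta).
    { intros x Hx. replace (e x) with ((u x - lam1) - Z x - al * (h x - h1)) by (unfold e; ring).
      now apply Hn. }
    assert (Hslope : forall x, r1 < pdist x c1 < r1 + eps -> Rabs (e x) <= K * delta * (pdist x c1 - r1)).
    { intros x Hx.
      assert (X := log_barrier (fun _ => True) c1 r1 (r1 + eps) e (4 * delta) g1 ltac:(lra) ltac:(lra)
        popen_True). cbv zeta in X.
      specialize (X ltac:(apply harm_sub with (2 := heE); intros y [Y _]; now apply AnE)
        ltac:(intros y [Y _]; apply heb; now apply AnE)).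
      eapply Rle_trans; [apply X|].
      - intros p [Hp|Hp] eta Heta; [tauto|].
        destruct Hp as [Hp|Hp].
        + generalize (popen_dist_lt c1 r1 p Hp). apply filter_imp. intros q Hq [[Q _] _]. lra.
        + assert (P2 : r2 <= pdist p c2).
          { pose proof (gap_disk _ _ _ _ _ p G ltac:(lra)). lra. }
          generalize (near_ext2_circle E u Z (fun _ => 0) h lam1 0 h1 al 0 p eta (Hb1 p Hp)
            (harm_continuous _ _ _ hZ (circle_offcenter _ _ _ _ _ p G ltac:(lra) P2))
            (image_sum_zero H (2 * n) _ _ p (reflect_circle c1 r1 p g1 Hp))
            ltac:(intros; rewrite Rminus_diag, Rabs_R0; lra)
            (continuous_hfun _ _ _ _ _ _ p Hf ltac:(lra) P2)
            (hfun_circle1 _ _ _ _ _ _ _ p G Hf Hp) Heta).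
          apply filter_imp. intros q Hq [Q _]. specialize (Hq (AnE q Q)).
          replace (e q) with (u q - lam1 - Z q - (0 - 0) - al * (h q - h1)) by (unfold e; ring). lra.
      - intuition lra.
      - replace (K * delta * (pdist x c1 - r1))
          with (4 * delta / (ln (r1 + eps) - ln r1) * ((pdist x c1 - r1) / r1)) by (unfold K; field; lra).
        apply Rmult_le_compat_l; [apply Rdiv_le_0_compat; lra|]. apply ln_diff_le; lra. }
    (* The limit of the outward radial derivative of [e]. The sign of [g t] is reversed because
       [nu_in] points into the disk. *)
    set (gam := fun t => - g t - radial Z t (circ c1 r1 t) - al * radial h t (circ c1 r1 t)).
    assert (Hgam : forall t, Rabs (gam t) <= K * delta).
    { intros t. apply (boundary_slope_abs_le c1 r1 eps e (K * delta) (gam t) t); auto.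
      - apply Rmult_le_pos; lra.
      - apply harm_sub with (2 := heE). exact AnE.
      - intros eta Heta. set (y := circ c1 r1 t).
        assert (Y : pdist y c1 = r1) by (apply pdist_circ_center; lra).
        assert (Y2 : r2 <= pdist y c2).
        { pose proof (gap_disk _ _ _ _ _ y G ltac:(lra)). lra. }
        assert (L1 := filterlim_within_near E _ y (g t) (Hg t) (eta / 3) ltac:(lra)).
        assert (L2 := continuous_near _ y (eta / 3) (continuous_radial_fixed _ Z t y
          (popen_offcenter _ _ _ _ _) hZ (circle_offcenter _ _ _ _ _ y G ltac:(lra) Y2)) ltac:(lra)).
        assert (L3 := continuous_near (fun q => al * radial h t q) y (eta / 3)
          (continuous_Rmult _ _ _ (continuous_const _ _) (continuous_radial_fixed O h t y HO hh (Ocirc t))) ltac:(lra)).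
        generalize (filter_and _ _ L1 (filter_and _ _ L2 L3)). intros L. apply locally_pdist in L.
        destruct L as [d [Hd0 L]]. exists (Rmin d eps). split; [apply Rmin_glb_lt; lra|].
        intros s Hs. pose proof (Rmin_l d eps). pose proof (Rmin_r d eps).
        assert (As : An (circ c1 (r1 + s) t)).
        { unfold An. rewrite pdist_circ_center; lra. }
        assert (Es := AnE _ As).
        destruct (L (circ c1 (r1 + s) t)) as [A1 [A2 A3]].
        { unfold y. rewrite pdist_circ; lra. }
        specialize (A1 Es). cbv beta in A1, A2, A3.
        assert (Re : radial e t (circ c1 (r1 + s) t)
          = radial u t (circ c1 (r1 + s) t) - radial Z t (circ c1 (r1 + s) t)
            - al * radial h t (circ c1 (r1 + s) t)).
        { unfold e.
          assert (D := hasgrad_plus _ _ _ _ _ _ _ (harm_grad _ _ _ he1 Es) (hasgrad_const (al * h1 - lam1) _)).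
          unfold radial at 1. rewrite (hasgrad_dx _ _ _ _ D), (hasgrad_dy _ _ _ _ D).
          rewrite !Rplus_0_r. fold (radial (fun x => u x - Z x - al * h x) t (circ c1 (r1 + s) t)).
          rewrite (radial_minus E _ _ _ _ huZ hah Es), (radial_minus E _ _ _ _ Hu hZE Es),
            (radial_scal E _ _ _ _ hhE Es). reflexivity. }
        rewrite Re. unfold gam. fold y.
        assert (Rn : pdot (grad u (circ c1 (r1 + s) t)) (nu_in t) = - radial u t (circ c1 (r1 + s) t)).
        { unfold pdot, grad, nu_in, radial; simpl. ring. }
        rewrite Rn in A1. apply Rabs_lt_between in A1, A2, A3. apply Rabs_le_between. lra. }
    assert (IG : is_RInt (fun t => gam t * r1) 0 (2 * PI) (- (al * I * r1))).
    { assert (J1 := is_RInt_opp _ _ _ _ Ig).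
      assert (J2 := is_RInt_scal _ _ _ (- r1) _ FZ).
      assert (J3 := is_RInt_scal _ _ _ (- (al * r1)) _ XI).
      assert (J := is_RInt_plus _ _ _ _ _ _ J1 (is_RInt_plus _ _ _ _ _ _ J2 J3)).
      eapply is_RInt_ext; [|evar_last; [exact J|]].
      - intros t _. unfold plus, opp, scal, gam; simpl. unfold mult; simpl. ring.
      - unfold plus, opp, scal; simpl. unfold mult; simpl. ring. }
    assert (N := norm_RInt_le_const (V := R_NormedModule) (fun t => gam t * r1) 0 (2 * PI) _ (K * delta * r1)
      ltac:(lra) ltac:(intros t _; change (Rabs (gam t * r1) <= K * delta * r1);
        rewrite Rabs_mult, (Rabs_pos_eq r1) by lra; apply Rmult_le_compat_r; [lra|apply Hgam]) IG).
    change (Rabs (- (al * I * r1)) <= (2 * PI - 0) * (K * delta * r1)) in N.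
    rewrite Rabs_Ropp, !Rabs_mult, (Rabs_pos_eq I), (Rabs_pos_eq r1) in N by lra.
    apply Rmult_le_reg_r with r1; [lra|]. lra. }
  destruct (Req_dec al 0) as [Z|NZ]; auto. exfalso.
  assert (0 < Rabs al * I) by (apply Rmult_lt_0_compat; [now apply Rabs_pos_lt|auto]).
  assert (0 < 2 * PI * K) by (apply Rmult_lt_0_compat; lra).
  assert (X := Hmain (Rabs al * I / (2 * (2 * PI * K)))
    ltac:(apply Rdiv_lt_0_compat; lra)).
  replace (2 * PI * K * (Rabs al * I / (2 * (2 * PI * K)))) with (Rabs al * I / 2) in X.
  - lra.
  - field. split; lra.
Qed.

(** * The part with equal boundary potentials *)

(** The width 3 is independent of the gap, and so is the resulting slope. The other disk may enter
    the annulus, but [b] tends to 0 at its circle as well. A width above 3/2 leaves room for the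
    interior estimate made at distance at most 1 from the disk. *)
Lemma near_disk_bound c1 r1 c2 r2 b M : 0 < r1 -> 0 <= M ->
  harm (ext2 c1 r1 c2 r2) b ->
  (forall x, ext2 c1 r1 c2 r2 x -> pdist x c1 < r1 + 3 -> Rabs (b x) <= M) ->
  (forall eta, 0 < eta -> forall p, ~ ext2 c1 r1 c2 r2 p ->
     locally p (fun q => ext2 c1 r1 c2 r2 q -> Rabs (b q) <= eta)) ->
  forall x, ext2 c1 r1 c2 r2 x -> pdist x c1 < r1 + 3 ->
    Rabs (b x) <= M / (ln (r1 + 3) - ln r1) / r1 * (pdist x c1 - r1).
Proof.
  intros Hr HM Hb Hbd Hz x Hx Hx3.
  assert (Hln : 0 < ln (r1 + 3) - ln r1) by (pose proof (ln_increasing r1 (r1 + 3)); lra).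
  assert (X := log_barrier (fun x => r2 < pdist x c2) c1 r1 (r1 + 3) b M Hr ltac:(lra) HM
    (popen_lt_dist c2 r2)). cbv zeta in X.
  eapply Rle_trans; [apply X|].
  - apply harm_sub with (2 := Hb). intros y [[Y1 _] Y2]. now split.
  - intros y [[Y1 Y3] Y2]. apply Hbd; auto. now split.
  - intros p Hp eta He.
    assert (Np : ~ ext2 c1 r1 c2 r2 p) by (intros [N1 N2]; destruct Hp; lra).
    generalize (Hz eta He p Np). apply filter_imp. intros q Hq [[Q1 _] Q2]. apply Hq. now split.
  - destruct Hx. auto.
  - replace (M / (ln (r1 + 3) - ln r1) / r1 * (pdist x c1 - r1))
      with (M / (ln (r1 + 3) - ln r1) * ((pdist x c1 - r1) / r1)) by (field; lra).
    apply Rmult_le_compat_l; [apply Rdiv_le_0_compat; lra|].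
    destruct Hx. apply ln_diff_le; lra.
Qed.

Definition near_const (M r : R) : R := M / (ln (r + 3) - ln r) / r.

Lemma near_const_ge_0 M r : 0 < r -> 0 <= M -> 0 <= near_const M r.
Proof.
  intros Hr HM. pose proof (ln_increasing r (r + 3) Hr ltac:(lra)). unfold near_const.
  apply Rdiv_le_0_compat; auto. apply Rdiv_le_0_compat; lra.
Qed.

(* At distance d from the disks the function is O(d), so the interior estimate at scale d
   bounds its gradient. *)
Lemma grad_bound_of_zero_boundary c1 r1 c2 r2 b M x : 0 < r1 -> 0 < r2 -> 0 <= M ->
  harm (ext2 c1 r1 c2 r2) b ->
  (forall y, ext2 c1 r1 c2 r2 y ->
     pdist y c1 < r1 + 3 \/ pdist y c2 < r2 + 3 \/ pdist y x <= 1 -> Rabs (b y) <= M) ->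
  (forall eta, 0 < eta -> forall p, ~ ext2 c1 r1 c2 r2 p ->
     locally p (fun q => ext2 c1 r1 c2 r2 q -> Rabs (b q) <= eta)) ->
  ext2 c1 r1 c2 r2 x ->
  pnorm (grad b x) <= 16 * (M + 2 * near_const M r1 + 2 * near_const M r2).
Proof.
  intros Hr1 Hr2 HM Hb Hbd Hz Hx.
  assert (N1 := near_disk_bound c1 r1 c2 r2 b M Hr1 HM Hb ltac:(intros; apply Hbd; auto) Hz).
  assert (Sw : forall y, ext2 c2 r2 c1 r1 y <-> ext2 c1 r1 c2 r2 y) by (unfold ext2; tauto).
  assert (N2 := near_disk_bound c2 r2 c1 r1 b M Hr2 HM
    ltac:(apply harm_sub with (2 := Hb); intros; now apply Sw)
    ltac:(intros; apply Hbd; auto; now apply Sw)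
    ltac:(intros eta He p Hp; generalize (Hz eta He p ltac:(now rewrite <- Sw));
          apply filter_imp; intros q Hq HE; apply Hq; now apply Sw)).
  fold (near_const M r1) in N1. fold (near_const M r2) in N2.
  pose proof (near_const_ge_0 M r1 Hr1 HM) as K1. pose proof (near_const_ge_0 M r2 Hr2 HM) as K2.
  set (k1 := near_const M r1) in *. set (k2 := near_const M r2) in *.
  set (d1 := pdist x c1 - r1). set (d2 := pdist x c2 - r2).
  assert (D1 : 0 < d1) by (unfold d1; destruct Hx; lra).
  assert (D2 : 0 < d2) by (unfold d2; destruct Hx; lra).
  set (d := Rmin 1 (Rmin d1 d2)).
  assert (Hd : 0 < d /\ d <= 1 /\ d <= d1 /\ d <= d2).
  { unfold d. pose proof (Rmin_l 1 (Rmin d1 d2)). pose proof (Rmin_r 1 (Rmin d1 d2)).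
    pose proof (Rmin_l d1 d2). pose proof (Rmin_r d1 d2).
    assert (0 < Rmin 1 (Rmin d1 d2)) by (repeat apply Rmin_glb_lt; lra). lra. }
  assert (Hc : d = 1 \/ d = d1 \/ d = d2).
  { unfold d, Rmin. repeat destruct Rle_dec; auto. }
  set (N := M + 2 * k1 + 2 * k2).
  (* With rho = d / 4 the estimate uses the disk of radius [d / 2] about [x]. Its points are in the
     exterior, and within [2 * d] of the nearest disk unless d = 1; this is why |b| <= N d there,
     [M] covering the case d = 1. *)
  replace (16 * N) with (4 * (N * d) / (d / 4)) by (field; lra).
  apply (pnorm_grad_le_of_bound (ext2 c1 r1 c2 r2)); auto.
  - lra.
  - apply Rmult_le_pos; unfold N; lra.
  - intros p Hp. pose proof (pdist_triangle x p c1) as T1. pose proof (pdist_triangle x p c2) as T2.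
    pose proof (pdist_triangle p x c1) as T3. pose proof (pdist_triangle p x c2) as T4.
    rewrite (pdist_sym x p) in T1, T2.
    assert (Ep : ext2 c1 r1 c2 r2 p) by (unfold d1, d2 in *; split; lra).
    split; auto. destruct Hc as [Hc|[Hc|Hc]].
    + eapply Rle_trans; [apply Hbd; auto; right; right; lra|]. rewrite Hc. unfold N. lra.
    + eapply Rle_trans; [apply N1; auto; unfold d1 in *; lra|].
      apply Rle_trans with (k1 * (2 * d)); [apply Rmult_le_compat_l; unfold d1 in *; lra|].
      unfold N. nra.
    + eapply Rle_trans; [apply N2; [now apply Sw|unfold d2 in *; lra]|].
      apply Rle_trans with (k2 * (2 * d)); [apply Rmult_le_compat_l; unfold d2 in *; lra|].
      unfold N. nra.
Qed.

Lemma regular_part_bound H M0 rho0 c1 r1 c2 r2 eps p1 p2 u lam1 lam2 x :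
  gap c1 r1 c2 r2 eps -> harm (fun _ => True) H -> fixed_pair c1 r1 c2 r2 p1 p2 ->
  is_solution c1 r1 c2 r2 H u lam1 lam2 -> 0 <= M0 ->
  (forall q, pnorm q <= rho0 -> Rabs (H q) <= M0) ->
  pnorm c1 + r1 + 3 <= rho0 -> pnorm c2 + r2 + 3 <= rho0 -> pnorm x + 1 <= rho0 ->
  ext2 c1 r1 c2 r2 x ->
  let al := (lam2 - lam1) / (hval2 c2 r2 p1 - hval1 c1 r1 p2) in
  pnorm (grad (fun q => u q - al * hfun p1 p2 q) x)
    <= 16 * (2 * M0 + 2 * near_const (2 * M0) r1 + 2 * near_const (2 * M0) r2).
Proof.
  intros G HH Hf (Hu & Hb1 & Hb2 & Hinf & _) HM HB B1 B2 Bx Hx al.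
  pose proof (gap_sym _ _ _ _ _ G) as G'. pose proof (hval_lt _ _ _ _ _ _ _ G Hf) as Hlt.
  set (E := ext2 c1 r1 c2 r2) in *. pose proof (popen_ext2 c1 r1 c2 r2) as HE. fold E in HE.
  apply harmonic_on_harm in Hu; auto.
  set (h := hfun p1 p2) in *. set (h1 := hval1 c1 r1 p2) in *. set (h2 := hval2 c2 r2 p1) in *.
  assert (Hal : al * (h2 - h1) = lam2 - lam1) by (unfold al; field; lra).
  set (kap := lam1 - al * h1).
  assert (hh : harm E h) by now apply harm_hfun_ext2.
  set (b := fun q => u q - al * h q - kap).
  assert (hb : harm E b).
  { unfold b. apply harm_minus; [|apply harm_const]. apply harm_minus; auto. now apply harm_scal. }
  assert (Hz : forall eta, 0 < eta -> forall p, ~ E p -> locally p (fun q => E q -> Rabs (b q) <= eta)).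
  { intros eta He. apply ext2_boundary; intros y Hy.
    - assert (Y2 : r2 <= pdist y c2).
      { pose proof (gap_disk _ _ _ _ _ y G ltac:(lra)). destruct G as (_ & _ & he & _). lra. }
      generalize (near_ext2_circle E u (fun _ => 0) (fun _ => 0) h lam1 0 h1 al 0 y eta (Hb1 y Hy)
        (continuous_const _ _) eq_refl ltac:(intros; rewrite Rminus_diag, Rabs_R0; lra)
        (continuous_hfun _ _ _ _ _ _ y Hf ltac:(lra) Y2)
        (hfun_circle1 _ _ _ _ _ _ _ y G Hf Hy) He).
      apply filter_imp. intros q Hq HEq. specialize (Hq HEq).
      replace (b q) with (u q - lam1 - 0 - (0 - 0) - al * (h q - h1)) by (unfold b, kap; ring). lra.
    - assert (Y1 : r1 <= pdist y c1).
      { pose proof (gap_disk _ _ _ _ _ y G' ltac:(lra)). destruct G as (_ & _ & he & _). lra. }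
      generalize (near_ext2_circle E u (fun _ => 0) (fun _ => 0) h lam2 0 h2 al 0 y eta (Hb2 y Hy)
        (continuous_const _ _) eq_refl ltac:(intros; rewrite Rminus_diag, Rabs_R0; lra)
        (continuous_hfun _ _ _ _ _ _ y Hf Y1 ltac:(lra))
        (hfun_circle2 _ _ _ _ _ _ _ y G Hf Hy) He).
      apply filter_imp. intros q Hq HEq. specialize (Hq HEq).
      replace (b q) with (u q - lam2 - 0 - (0 - 0) - al * (h q - h2)) by (unfold b, kap; lra). lra. }
  (* [v] tends to 0 at infinity and its boundary values are those of kap - H. The maximum principle
     gives |v - kap| <= M0, and b = v - kap + H is bounded by [2 * M0] wherever |H| <= M0. *)
  set (v := fun q => b q + kap - H q).
  assert (hv : harm E v).
  { unfold v. apply harm_minus; [apply harm_plus; [auto|apply harm_const]|].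
    now apply harm_sub with (2 := HH). }
  assert (tv : tends_at_inf v 0).
  { replace 0 with (0 + - al * 0) by ring.
    eapply tends_ext; [|apply tends_plus; [exact (solution_tends u H Hinf)|
      apply tends_scal; exact (tends_hfun p1 p2)]].
    intros q. unfold v, b. fold h. ring. }
  assert (Hbd : forall eta, 0 < eta -> forall p, ~ E p ->
     locally p (fun q => E q -> Rabs (v q - kap) <= M0 + eta)).
  { intros eta He p Hp. assert (Lp : pdist p (0, 0) < rho0).
    { rewrite <- pnorm_dist_0. unfold E, ext2 in Hp. apply not_and_or in Hp.
      destruct Hp as [Hp|Hp]; apply Rnot_lt_le in Hp.
      - pose proof (pnorm_le_dist p c1). lra.
      - pose proof (pnorm_le_dist p c2). lra. }
    generalize (filter_and _ _ (Hz eta He p Hp) (popen_dist_lt (0, 0) rho0 p Lp)).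
    apply filter_imp. intros q [Hq Nq] HEq. specialize (Hq HEq).
    rewrite <- pnorm_dist_0 in Nq. assert (HHq := HB q ltac:(lra)).
    apply Rabs_le_between in Hq, HHq. apply Rabs_le_between. unfold v. lra. }
  destruct (exterior_maximum_principle E c1 r1 v (kap + M0) ltac:(apply G) HE
    ltac:(intros y [Y _]; exact Y) (ext2_far c1 r1 c2 r2) hv) as [X1 X2].
  { intros p Hp eta He. generalize (Hbd eta He p Hp). apply filter_imp. intros q Hq HEq.
    specialize (Hq HEq). apply Rabs_le_between in Hq. lra. }
  { intros eta He. destruct (tv eta He) as [K HK]. exists K. intros y _ Hy.
    specialize (HK y Hy). now rewrite Rminus_0_r in HK. }
  destruct (exterior_maximum_principle E c1 r1 (fun q => - v q) (M0 - kap) ltac:(apply G) HE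
    ltac:(intros y [Y _]; exact Y) (ext2_far c1 r1 c2 r2) (harm_opp _ _ hv)) as [X3 X4].
  { intros p Hp eta He. generalize (Hbd eta He p Hp). apply filter_imp. intros q Hq HEq.
    specialize (Hq HEq). apply Rabs_le_between in Hq. lra. }
  { intros eta He. destruct (tv eta He) as [K HK]. exists K. intros y _ Hy.
    specialize (HK y Hy). rewrite Rminus_0_r in HK. now rewrite Rabs_Ropp. }
  assert (Hgb : grad b x = grad (fun q => u q - al * h q) x).
  { assert (D := harm_grad E (fun q => u q - al * h q) x
      ltac:(apply harm_minus; auto; now apply harm_scal) Hx).
    assert (D' := hasgrad_minus _ _ _ _ _ _ _ D (hasgrad_const kap x)).
    unfold grad. cbv beta in D'. fold b in D'.
    rewrite (hasgrad_dx _ _ _ _ D'), (hasgrad_dy _ _ _ _ D'). f_equal; ring. }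
  rewrite <- Hgb. apply grad_bound_of_zero_boundary with c1 c2; auto; try apply G; [lra|].
  intros y Hy Hc. assert (Ny : pnorm y <= rho0).
  { destruct Hc as [Hc|[Hc|Hc]].
    - pose proof (pnorm_le_dist y c1). lra.
    - pose proof (pnorm_le_dist y c2). lra.
    - pose proof (pnorm_le_dist y x). lra. }
  specialize (X2 y Hy). specialize (X4 y Hy). cbv beta in X4. assert (HHy := HB y Ny).
  apply Rabs_le_between in HHy. apply Rabs_le_between. unfold v in *. lra.
Qed.

(** * Asymptotics of the coefficient *)

(* S1 and S2 are the distances from the centre of a circle of radius r to a pair of
   mutually inverse points. *)
Lemma inverse_pair_estimates S1 S2 r D0 : 0 < S1 -> S1 < r -> S1 * S2 = r ^ 2 -> S2 <= D0 ->
  (S2 - S1) * (r / (2 * D0)) <= r - S1 /\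
  (S2 - S1) / (2 * D0) <= ln S2 - ln r /\
  Rabs (ln S2 - ln r - (S2 - S1) / (2 * r)) <= (S2 - S1) ^ 2 * (D0 / r ^ 3).
Proof.
  intros H1 H2 E HD. set (L := S2 - S1).
  assert (HS : r < S2) by nra. assert (HL : 0 < L) by (unfold L; lra).
  assert (HS1 : r ^ 2 / D0 <= S1).
  { apply Rmult_le_reg_r with D0; [lra|]. replace (r ^ 2 / D0 * D0) with (r ^ 2) by (field; lra). nra. }
  assert (HinvS1 : / S1 <= D0 / r ^ 2).
  { replace (D0 / r ^ 2) with (/ (r ^ 2 / D0)) by (field; lra). apply Rinv_le_contravar; auto.
    apply Rdiv_lt_0_compat; nra. }
  assert (E2 : S2 = r ^ 2 / S1) by (rewrite <- E; field; lra).
  assert (A1 : r - S1 = L * (S1 / (S1 + r))) by (unfold L; rewrite E2; field; lra).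
  assert (A2 : L * (r / (2 * D0)) <= r - S1).
  { rewrite A1. apply Rmult_le_compat_l; [lra|].
    apply Rle_trans with (S1 / (2 * r)).
    - replace (r / (2 * D0)) with ((r ^ 2 / D0) * / (2 * r)) by (field; lra).
      apply Rmult_le_compat_r; [left; apply Rinv_0_lt_compat; lra|auto].
    - apply Rmult_le_compat_l; [lra|]. apply Rinv_le_contravar; lra. }
  assert (lo : (r - S1) / r <= ln S2 - ln r).
  { pose proof (ln_diff_le r S2 ltac:(lra) ltac:(lra)).
    replace ((r - S1) / r) with (- ((r - S2) / S2)); [lra|]. rewrite E2. field. lra. }
  assert (hi : ln S2 - ln r <= (S2 - r) / r) by (apply ln_diff_le; lra).
  split; auto. split.
  - eapply Rle_trans; [|exact lo]. apply Rmult_le_reg_r with r; [lra|].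
    replace ((r - S1) / r * r) with (r - S1) by (field; lra).
    replace (L / (2 * D0) * r) with (L * (r / (2 * D0))) by (field; lra). auto.
  (* S2 - r and r - S1 add up to S2 - S1 and differ by (r - S1)^2 / S1, a second-order quantity.
     Both are therefore (S2 - S1) / 2 up to second order, and ln (S2 / r) lies between them after
     division by r. *)
  - assert (B1 : (S2 - r) - (r - S1) = (r - S1) ^ 2 * / S1) by (rewrite E2; field; lra).
    assert (B0 : 0 <= (r - S1) ^ 2 * / S1).
    { apply Rmult_le_pos; [apply pow2_ge_0|left; now apply Rinv_0_lt_compat]. }
    assert (B2 : (r - S1) ^ 2 * / S1 <= L ^ 2 * (D0 / r ^ 2)).
    { apply Rmult_le_compat; auto; [apply pow2_ge_0|left; now apply Rinv_0_lt_compat|].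
      apply pow_incr. unfold L. lra. }
    assert (E3 : L ^ 2 * (D0 / r ^ 3) = L ^ 2 * (D0 / r ^ 2) / r) by (field; lra).
    assert (ir : 0 < / r) by (apply Rinv_0_lt_compat; lra).
    rewrite E3. apply Rabs_le_between. unfold L in *.
    assert (Hr : (S2 - S1) / (2 * r) = ((S2 - r) + (r - S1)) / 2 * / r) by (field; lra).
    rewrite Hr. unfold Rdiv in lo, hi |- *. split; nra.
Qed.

(** A reflection moves a point along its ray from the centre. With the distances frozen into the
    factors [t] and [t'], the fixed-point equations become a linear system, the same in each
    coordinate; this puts [p1] and [p2] on the line of centres without solving a quadratic
    equation. *)
Lemma gap_axis c1 r1 c2 r2 eps p1 p2 : gap c1 r1 c2 r2 eps -> fixed_pair c1 r1 c2 r2 p1 p2 ->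
  exists (e : pt) (S1 S2 : R), fst e ^ 2 + snd e ^ 2 = 1 /\
    p1 = padd c1 (pscal S1 e) /\ p2 = padd c1 (pscal S2 e) /\
    0 < S1 < r1 /\ r1 + eps < S2 < r1 + r2 + eps /\ S1 * S2 = r1 ^ 2 /\
    (r1 + r2 + eps - S2) * (r1 + r2 + eps - S1) = r2 ^ 2 /\
    nvec p1 p2 = e /\ midgap c1 r1 c2 r2 = padd c1 (pscal (r1 + eps / 2) e) /\
    pdist p1 c1 = S1 /\ pdist p2 c2 = r1 + r2 + eps - S2 /\
    pdist p2 c1 = S2 /\ pdist p1 c2 = r1 + r2 + eps - S1.
Proof.
  intros G (P1 & P2 & E2 & E1).
  pose proof (gap_disk _ _ _ _ _ p1 G ltac:(lra)) as Q1.
  pose proof (gap_disk _ _ _ _ _ p2 (gap_sym _ _ _ _ _ G) ltac:(lra)) as Q2.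
  destruct G as (g1 & g2 & he & gD). set (D := r1 + r2 + eps) in *.
  assert (HD : 0 < D) by (unfold D; lra).
  set (l1 := pdist p2 c1) in *. set (l2 := pdist p1 c2) in *.
  set (t := r1 ^ 2 / l1 ^ 2). set (t' := r2 ^ 2 / l2 ^ 2).
  assert (Ht : 0 < t < 1).
  { unfold t. split; [apply Rdiv_lt_0_compat; apply pow_lt; lra|].
    apply Rmult_lt_reg_r with (l1 ^ 2); [apply pow_lt; lra|].
    replace (r1 ^ 2 / l1 ^ 2 * l1 ^ 2) with (r1 ^ 2) by (field; lra). nra. }
  assert (Ht' : 0 < t' < 1).
  { unfold t'. split; [apply Rdiv_lt_0_compat; apply pow_lt; lra|].
    apply Rmult_lt_reg_r with (l2 ^ 2); [apply pow_lt; lra|].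
    replace (r2 ^ 2 / l2 ^ 2 * l2 ^ 2) with (r2 ^ 2) by (field; lra). nra. }
  assert (Htt : 0 < t * t' < 1) by nra.
  assert (F1 : fst p1 = fst c1 + t * (fst p2 - fst c1) /\ snd p1 = snd c1 + t * (snd p2 - snd c1)).
  { rewrite <- E1. unfold reflect. fold (pdist p2 c1). fold l1. fold t. simpl. split; ring. }
  assert (F2 : fst p2 = fst c2 + t' * (fst p1 - fst c2) /\ snd p2 = snd c2 + t' * (snd p1 - snd c2)).
  { rewrite <- E2. unfold reflect. fold (pdist p1 c2). fold l2. fold t'. simpl. split; ring. }
  set (s2 := (1 - t') / (1 - t * t')). set (s1 := t * s2).
  assert (Hs2 : 0 < s2 < 1).
  { unfold s2. split; [apply Rdiv_lt_0_compat; lra|].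
    apply Rmult_lt_reg_r with (1 - t * t'); [lra|].
    replace ((1 - t') / (1 - t * t') * (1 - t * t')) with (1 - t') by (field; lra). nra. }
  assert (Hs1 : 0 < s1 < s2) by (unfold s1; nra).
  assert (G2 : forall a2 b1 b2 a1, a1 = b1 + t * (a2 - b1) -> a2 = b2 + t' * (a1 - b2) ->
     a2 = b1 + s2 * (b2 - b1) /\ a1 = b1 + s1 * (b2 - b1)).
  { intros a2 b1 b2 a1 e1 e2.
    assert (X : (a2 - b1) * (1 - t * t') = (1 - t') * (b2 - b1)) by (rewrite e1 in e2; lra).
    assert (Y : a2 - b1 = s2 * (b2 - b1)).
    { unfold s2. apply Rmult_eq_reg_r with (1 - t * t'); [|lra]. rewrite X. field. lra. }
    split; [lra|]. rewrite e1, Y. unfold s1. ring. }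
  destruct (G2 _ _ _ _ (proj1 F1) (proj1 F2)) as [X2 X1].
  destruct (G2 _ _ _ _ (proj2 F1) (proj2 F2)) as [Y2 Y1].
  set (e := pscal (/ D) (psub c2 c1)).
  assert (SD : (fst c2 - fst c1) ^ 2 + (snd c2 - snd c1) ^ 2 = D ^ 2).
  { pose proof (pdist_sqr c2 c1) as S. rewrite (pdist_sym c2 c1), gD in S. lra. }
  assert (Ee : fst e ^ 2 + snd e ^ 2 = 1).
  { unfold e; simpl fst; simpl snd.
    replace ((/ D * (fst c2 - fst c1)) ^ 2 + (/ D * (snd c2 - snd c1)) ^ 2)
      with (((fst c2 - fst c1) ^ 2 + (snd c2 - snd c1) ^ 2) * / (D ^ 2)) by (field; lra).
    rewrite SD. field. lra. }
  assert (Ep1 : p1 = padd c1 (pscal (s1 * D) e)).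
  { rewrite (surjective_pairing p1), X1, Y1. unfold padd, pscal, e, psub; simpl. f_equal; field; lra. }
  assert (Ep2 : p2 = padd c1 (pscal (s2 * D) e)).
  { rewrite (surjective_pairing p2), X2, Y2. unfold padd, pscal, e, psub; simpl. f_equal; field; lra. }
  assert (Ec2 : c2 = padd c1 (pscal D e)).
  { rewrite (surjective_pairing c2) at 1. unfold padd, pscal, e, psub; simpl. f_equal; field; lra. }
  assert (Edef : e = pscal (/ D) (psub c2 c1)) by reflexivity. clearbody e.
  assert (Hdist : forall a b, b <= a -> pdist (padd c1 (pscal a e)) (padd c1 (pscal b e)) = a - b).
  { intros a b Hab. unfold pdist. apply pnorm_eq_nonneg; [lra|].
    unfold psub, padd, pscal; simpl fst; simpl snd.
    replace ((fst c1 + a * fst e - (fst c1 + b * fst e)) ^ 2 + (snd c1 + a * snd e - (snd c1 + b * snd e)) ^ 2)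
      with ((a - b) ^ 2 * (fst e ^ 2 + snd e ^ 2)) by ring. rewrite Ee. ring. }
  assert (Ec1 : c1 = padd c1 (pscal 0 e)).
  { rewrite (surjective_pairing c1) at 1. unfold padd, pscal; simpl. f_equal; ring. }
  set (S1 := s1 * D) in *. set (S2 := s2 * D) in *.
  assert (HS : 0 < S1 /\ S1 < S2 /\ S2 < D).
  { unfold S1, S2. repeat split; nra. }
  assert (d1 : pdist p1 c1 = S1) by (rewrite Ep1; rewrite Ec1 at 2; rewrite Hdist; lra).
  assert (d2 : pdist p2 c1 = S2) by (rewrite Ep2; rewrite Ec1 at 2; rewrite Hdist; lra).
  assert (d3 : pdist p1 c2 = D - S1) by (rewrite pdist_sym, Ep1, Ec2, Hdist; lra).
  assert (d4 : pdist p2 c2 = D - S2) by (rewrite pdist_sym, Ep2, Ec2, Hdist; lra).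
  exists e, S1, S2. repeat split; auto; try lra.
  - unfold D in *. lra.
  - assert (K := pdist_reflect_center c1 r1 p2 ltac:(fold l1; lra)). rewrite E1, d1, d2 in K.
    rewrite K. field. lra.
  - assert (K := pdist_reflect_center c2 r2 p1 ltac:(fold l2; lra)). rewrite E2, d3, d4 in K.
    rewrite K. field. lra.
  - unfold nvec. rewrite Ep1, Ep2, Hdist by lra. unfold psub, pscal, padd; simpl.
    rewrite (surjective_pairing e). simpl. f_equal; field; lra.
  - unfold midgap. rewrite (pdist_sym c2 c1), gD, <- Edef. rewrite Ec2 at 1.
    unfold pscal, padd, psub; simpl. f_equal; unfold D; field.
Qed.

(** Up to sign and the factor 1 / (2 pi), this gradient is the difference of the images of [p1] and
    [p2] under inversion in the unit circle about [x], so the distance formula for reflections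
    evaluates its norm. *)
Lemma pnorm_grad_hfun p1 p2 x : 0 < pdist x p1 -> 0 < pdist x p2 ->
  pnorm (grad (hfun p1 p2) x) = / (2 * PI) * (pdist p1 p2 / (pdist x p1 * pdist x p2)).
Proof.
  intros H1 H2. pose proof PI_RGT_0. assert (D := hasgrad_hfun p1 p2 x H1 H2).
  assert (Hi : 0 < / (2 * PI)) by (apply Rinv_0_lt_compat; lra).
  unfold grad. rewrite (hasgrad_dx _ _ _ _ D), (hasgrad_dy _ _ _ _ D).
  assert (K := pdist_reflect x 1 p1 p2 ltac:(rewrite pdist_sym; auto) ltac:(rewrite pdist_sym; auto)).
  rewrite (pdist_sym p1 x), (pdist_sym p2 x) in K.
  replace (pdist p1 p2 / (pdist x p1 * pdist x p2)) with
    (1 ^ 2 * pdist p1 p2 / (pdist x p1 * pdist x p2)) by (field; lra).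
  rewrite <- K.
  change (pnorm (pscal (/ (2 * PI)) (invx p1 x - invx p2 x, invy p1 x - invy p2 x))
    = / (2 * PI) * pdist (reflect x 1 p1) (reflect x 1 p2)).
  rewrite pnorm_pscal, (Rabs_pos_eq (/ (2 * PI))) by lra. f_equal.
  unfold pdist, pnorm. f_equal. rewrite !reflect_inv. simpl fst; simpl snd.
  assert (S : forall c, sqd x c = sqd c x) by (intros; unfold sqd; ring).
  unfold invx, invy. rewrite !S. ring.
Qed.

(** The mean value theorem first gives the point [xi], then compares the directional derivatives at
    [xi] and [T]; the second directional derivative has four terms, each at most [M]. *)
Lemma directional_mvt (F P Q A B : pt -> R) c e S1 S2 T M :
  (forall p, harm_at F P Q A B p) -> fst e ^ 2 + snd e ^ 2 = 1 -> S1 < S2 -> S1 <= T <= S2 ->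
  (forall s, S1 <= s <= S2 -> Rabs (A (padd c (pscal s e))) <= M /\ Rabs (B (padd c (pscal s e))) <= M) ->
  let d := fun s => P (padd c (pscal s e)) * fst e + Q (padd c (pscal s e)) * snd e in
  exists xi, F (padd c (pscal S2 e)) - F (padd c (pscal S1 e)) = d xi * (S2 - S1) /\
    Rabs (d xi - d T) <= 4 * M * (S2 - S1).
Proof.
  intros HF He HS HT HM d.
  set (z := fun s => padd c (pscal s e)).
  assert (dz : forall G a b s, hasgrad G (z s) a b ->
     derivable_pt_lim (fun s => G (z s)) s (a * fst e + b * snd e)).
  { intros G a b s HG. apply is_derive_Reals.
    apply (is_derive_line G (fun s => fst c + s * fst e) (fun s => snd c + s * snd e)); auto;
      auto_derive; auto; ring. }
  destruct (MVT_cor2 (fun s => F (z s)) d S1 S2) as [xi [Ex Hx]]; auto.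
  { intros s Hs. apply dz. apply (HF (z s)). }
  exists xi. split; auto.
  set (dd := fun s => (A (z s) * fst e + B (z s) * snd e) * fst e
                    + (B (z s) * fst e + - A (z s) * snd e) * snd e).
  assert (Ddd : forall s, is_derive d s (dd s)).
  { intros s. destruct (HF (z s)) as (_ & h2 & h3 & _).
    assert (dP := dz P _ _ s h2). assert (dQ := dz Q _ _ s h3).
    apply is_derive_Reals in dP, dQ. unfold d, dd. evar_last.
    - apply @is_derive_plus; apply @is_derive_scal_l; eassumption.
    - reflexivity. }
  assert (e1 : Rabs (fst e) <= 1) by (apply Rabs_le_between; nra).
  assert (e2 : Rabs (snd e) <= 1) by (apply Rabs_le_between; nra).
  assert (Bd : forall s, S1 <= s <= S2 -> Rabs (dd s) <= 4 * M).
  { intros s Hs. destruct (HM s Hs) as [MA MB]. fold (z s) in MA, MB. unfold dd.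
    assert (Hmul : forall a b, Rabs a <= M -> Rabs b <= 1 -> Rabs (a * b) <= M).
    { intros a b Ha Hb. rewrite Rabs_mult. pose proof (Rabs_pos a). pose proof (Rabs_pos b). nra. }
    assert (MA' : Rabs (- A (z s)) <= M) by now rewrite Rabs_Ropp.
    replace (_ + _) with (A (z s) * fst e * fst e + B (z s) * snd e * fst e
      + (B (z s) * fst e * snd e + - A (z s) * snd e * snd e)) by ring.
    assert (K1 := Hmul _ _ (Hmul _ _ MA e1) e1). assert (K2 := Hmul _ _ (Hmul _ _ MB e2) e1).
    assert (K3 := Hmul _ _ (Hmul _ _ MB e1) e2). assert (K4 := Hmul _ _ (Hmul _ _ MA' e2) e2).
    apply Rabs_le_between in K1, K2, K3, K4. apply Rabs_le_between. lra. }
  destruct (MVT_gen d T xi dd) as [y [Hy Ey]].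
  - intros s _. apply Ddd.
  - intros s _. apply continuity_pt_filterlim, (@ex_derive_continuous _ R_NormedModule).
    exists (dd s). apply Ddd.
  - assert (Hy2 : S1 <= y <= S2).
    { revert Hy. unfold Rmin, Rmax. repeat destruct Rle_dec; lra. }
    rewrite Ey, Rabs_mult. apply Rmult_le_compat; auto using Rabs_pos. apply Rabs_le_between. lra.
Qed.

(** The lower bound on [Lam] gives L / Lam <= 2 D0. The difference splits into one error from dxi -
    dT and one from Lam - L k; each is this bounded quotient times a factor of order L. *)
Lemma coefficient_estimate L Lam k q D0 dxi dT M M1 :
  0 < L -> 0 < k -> 0 < D0 -> 0 <= q -> L / (2 * D0) <= Lam -> Rabs (Lam - L * k) <= L ^ 2 * q ->
  Rabs (dxi - dT) <= M * L -> Rabs dT <= M1 ->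
  Rabs (dxi * L / Lam - / k * dT) <= (2 * D0 * M + 2 * D0 * q / k * M1) * L.
Proof.
  intros HL Hk HD Hq Hlow Hup Hd HT.
  assert (HLam : 0 < Lam) by (assert (0 < L / (2 * D0)) by (apply Rdiv_lt_0_compat; lra); lra).
  assert (HLL : L / Lam <= 2 * D0).
  { apply Rmult_le_reg_r with Lam; [lra|]. replace (L / Lam * Lam) with L by (field; lra).
    apply Rmult_le_compat_l with (r := 2 * D0) in Hlow; [|lra].
    replace (2 * D0 * (L / (2 * D0))) with L in Hlow by (field; lra). lra. }
  assert (HLL0 : 0 < L / Lam) by now apply Rdiv_lt_0_compat.
  replace (dxi * L / Lam - / k * dT) with (L / Lam * (dxi - dT) + - ((Lam - L * k) / (k * Lam)) * dT)
    by (field; lra).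
  eapply Rle_trans; [apply Rabs_triang|]. rewrite !Rabs_mult, Rabs_Ropp, (Rabs_pos_eq (L / Lam)) by lra.
  assert (A1 : L / Lam * Rabs (dxi - dT) <= 2 * D0 * (M * L)).
  { apply Rmult_le_compat; auto using Rabs_pos. lra. }
  assert (A2 : Rabs ((Lam - L * k) / (k * Lam)) <= 2 * D0 * q / k * L).
  { unfold Rdiv at 1. rewrite Rabs_mult, (Rabs_pos_eq (/ (k * Lam)))
      by (left; apply Rinv_0_lt_compat; nra).
    apply Rle_trans with (L ^ 2 * q * / (k * Lam)).
    - apply Rmult_le_compat_r; auto. left. apply Rinv_0_lt_compat. nra.
    - replace (L ^ 2 * q * / (k * Lam)) with (L / Lam * (q / k * L)) by (field; lra).
      replace (2 * D0 * q / k * L) with (2 * D0 * (q / k * L)) by (field; lra).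
      apply Rmult_le_compat_r; auto. apply Rmult_le_pos; [apply Rdiv_le_0_compat; lra|lra]. }
  assert (A3 : Rabs ((Lam - L * k) / (k * Lam)) * Rabs dT <= 2 * D0 * q / k * L * M1)
    by (apply Rmult_le_compat; auto using Rabs_pos).
  lra.
Qed.

Lemma pnorm_padd_scal c s e : fst e ^ 2 + snd e ^ 2 = 1 -> pnorm (padd c (pscal s e)) <= pnorm c + Rabs s.
Proof.
  intros He. eapply Rle_trans; [apply pnorm_triangle|]. rewrite pnorm_pscal.
  rewrite (pnorm_eq_nonneg e 1); [|lra|lra]. lra.
Qed.

Theorem theorem2p1 :
  forall (r1 r2 : R) (H : pt -> R),
    0 < r1 -> 0 < r2 -> harmonic_on (fun _ => True) H ->
  forall Omega : pt -> Prop,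
    (exists Rb, forall x, Omega x -> pnorm x <= Rb) ->
  exists C : R,
  forall (eps : R) (c1 c2 : pt),
    0 < eps -> pdist c1 c2 = r1 + r2 + eps ->
    (forall x, pdist x c1 <= r1 -> Omega x) ->
    (forall x, pdist x c2 <= r2 -> Omega x) ->
  forall p1 p2 : pt,
    pdist p1 c1 < r1 -> reflect c1 r1 (reflect c2 r2 p1) = p1 ->
    pdist p2 c2 < r2 -> reflect c2 r2 (reflect c1 r1 p2) = p2 ->
  forall (u : pt -> R) (lam1 lam2 : R),
    is_solution c1 r1 c2 r2 H u lam1 lam2 ->
  let a := acoef r1 r2 H c1 c2 p1 p2 in
  let b := fun x => u x - a * hfun p1 p2 x in
  forall x, Omega x -> ext2 c1 r1 c2 r2 x -> pnorm (grad b x) <= C.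
Proof.
  intros r1 r2 H Hr1 Hr2 HH Omega [Rb HRb].
  apply harmonic_on_harm in HH; [|apply popen_True].
  assert (HHc := HH). destruct HH as (P & Q & A & B & HP).
  assert (HP' : forall p, harm_at H P Q A B p) by (intros; now apply HP).
  (* [D0] bounds the distance of the centres, hence also [eps], since both disks lie in [Omega]. The
     disk of radius [rho0] contains the 3-neighbourhoods of the disks, the unit disk about [x], and
     the segments of length [D0] starting at [c1]. *)
  set (D0 := 2 * Rabs Rb + 1). set (rho0 := Rabs Rb + D0 + r1 + r2 + 5).
  destruct (continuous_bounded H rho0) as [M0 [HM0 BH]].
  { intros p. now apply (harm_continuous _ _ p HHc). }
  destruct (continuous_bounded P rho0) as [MP [HMP BP]].
  { intros p. eapply hasgrad_continuous. apply (HP' p). }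
  destruct (continuous_bounded Q rho0) as [MQ [HMQ BQ]].
  { intros p. eapply hasgrad_continuous. apply (HP' p). }
  destruct (continuous_bounded A rho0) as [MA [HMA BA]]; [intros p; apply (HP' p)|].
  destruct (continuous_bounded B rho0) as [MB [HMB BB]]; [intros p; apply (HP' p)|].
  (* [k] is 1 / (2 r1) + 1 / (2 r2), the first-order coefficient of [Lam] in L, and 2 pi / k is the
     factor in [acoef]; [q] collects the second-order constants of the two circles. *)
  set (k := (r1 + r2) / (2 * r1 * r2)). set (q := D0 / r1 ^ 3 + D0 / r2 ^ 3).
  set (M2 := MA + MB).
  set (K := 2 * D0 * (4 * M2) + 2 * D0 * q / k * (MP + MQ)).
  exists (16 * (2 * M0 + 2 * near_const (2 * M0) r1 + 2 * near_const (2 * M0) r2)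
          + K * (4 * D0 ^ 2 / (r1 * r2))).
  intros eps c1 c2 He HD HO1 HO2 p1 p2 P1 E1 P2 E2 u lam1 lam2 Hsol a b x Hx HE.
  assert (G : gap c1 r1 c2 r2 eps) by (repeat split; auto).
  assert (Hf : fixed_pair c1 r1 c2 r2 p1 p2).
  { destruct (fixed_points_swapped _ _ _ _ _ p1 p2 G P1 E1 P2 E2). repeat split; auto. }
  pose proof PI_RGT_0 as HPI. pose proof (Rabs_pos Rb). pose proof (Rle_abs Rb).
  assert (Nc1 : pnorm c1 <= Rb) by (apply HRb, HO1; rewrite pdist_refl; lra).
  assert (Nc2 : pnorm c2 <= Rb) by (apply HRb, HO2; rewrite pdist_refl; lra).
  assert (Nx : pnorm x <= Rb) by now apply HRb.
  assert (HDD : r1 + r2 + eps <= D0).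
  { rewrite <- HD. pose proof (pdist_triangle c1 (0, 0) c2) as T.
    rewrite (pdist_sym (0, 0) c2), <- !pnorm_dist_0 in T. unfold D0. lra. }
  assert (HD0 : 0 < D0) by (unfold D0; lra).
  assert (Reg := regular_part_bound H M0 rho0 c1 r1 c2 r2 eps p1 p2 u lam1 lam2 x G HHc Hf Hsol
    (Rlt_le _ _ HM0) BH ltac:(unfold rho0; lra) ltac:(unfold rho0; lra) ltac:(unfold rho0; lra) HE).
  cbv zeta in Reg. rewrite (potential_jump H c1 r1 c2 r2 eps p1 p2 u lam1 lam2 G HHc Hf Hsol) in Reg.
  pose proof (hval_lt _ _ _ _ _ _ _ G Hf) as Hlt.
  set (al := (H p2 - H p1) / (hval2 c2 r2 p1 - hval1 c1 r1 p2)) in *.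
  destruct (gap_axis c1 r1 c2 r2 eps p1 p2 G Hf) as (e & S1 & S2 & Ee & Ep1 & Ep2 & HS1 & HS2 & EA & EB
    & En & Em & d11 & d22 & d21 & d12).
  set (L := S2 - S1). assert (HL : 0 < L) by (unfold L; lra).
  destruct (inverse_pair_estimates S1 S2 r1 D0 ltac:(lra) ltac:(lra) EA ltac:(lra)) as (I1 & I2 & I3).
  (* Seen from [c2] the roles are exchanged: [p2] is the inner point of the inverse pair and [p1]
     the outer one. *)
  destruct (inverse_pair_estimates (r1 + r2 + eps - S2) (r1 + r2 + eps - S1) r2 D0 ltac:(lra) ltac:(lra) EB ltac:(lra))
    as (J1 & J2 & J3).
  replace (r1 + r2 + eps - S1 - (r1 + r2 + eps - S2)) with L in J1, J2, J3 by (unfold L; ring).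
  fold L in I1, I2, I3.
  set (Lam := (ln S2 - ln r1) + (ln (r1 + r2 + eps - S1) - ln r2)).
  assert (HLamE : hval2 c2 r2 p1 - hval1 c1 r1 p2 = Lam / (2 * PI)).
  { unfold hval1, hval2. rewrite d21, d12. unfold Lam. field. lra. }
  assert (HLd : 0 < L / (2 * D0)) by (apply Rdiv_lt_0_compat; lra).
  assert (HLam : 0 < Lam) by (unfold Lam; lra).
  assert (Hk : 0 < k) by (unfold k; apply Rdiv_lt_0_compat; nra).
  assert (r13 : 0 < r1 ^ 3) by now apply pow_lt. assert (r23 : 0 < r2 ^ 3) by now apply pow_lt.
  assert (Hq : 0 < q) by (unfold q; apply Rplus_lt_0_compat; now apply Rdiv_lt_0_compat).
  assert (Nz : forall s, 0 <= s <= D0 -> pnorm (padd c1 (pscal s e)) <= rho0).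
  { intros s Hs. pose proof (pnorm_padd_scal c1 s e Ee). rewrite Rabs_pos_eq in H2 by lra. unfold rho0. lra. }
  destruct (directional_mvt H P Q A B c1 e S1 S2 (r1 + eps / 2) M2 HP' Ee ltac:(lra) ltac:(lra))
    as (xi & Exi & Hxi).
  { intros s Hs. assert (N := Nz s ltac:(lra)). specialize (BA _ N). specialize (BB _ N). unfold M2. lra. }
  cbv beta zeta in Hxi, Exi. fold L in Exi, Hxi. rewrite <- Ep1, <- Ep2 in Exi.
  set (d := fun s => P (padd c1 (pscal s e)) * fst e + Q (padd c1 (pscal s e)) * snd e) in *.
  change (H p2 - H p1 = d xi * L) in Exi.
  change (Rabs (d xi - d (r1 + eps / 2)) <= 4 * M2 * L) in Hxi.
  assert (HdT : Rabs (d (r1 + eps / 2)) <= MP + MQ).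
  { assert (N := Nz (r1 + eps / 2) ltac:(lra)). specialize (BP _ N). specialize (BQ _ N).
    assert (Rabs (fst e) <= 1) by (apply Rabs_le_between; nra).
    assert (Rabs (snd e) <= 1) by (apply Rabs_le_between; nra).
    unfold d. eapply Rle_trans; [apply Rabs_triang|]. rewrite !Rabs_mult.
    pose proof (Rabs_pos (fst e)). pose proof (Rabs_pos (snd e)).
    pose proof (Rabs_pos (P (padd c1 (pscal (r1 + eps / 2) e)))).
    pose proof (Rabs_pos (Q (padd c1 (pscal (r1 + eps / 2) e)))). nra. }
  assert (Ck := coefficient_estimate L Lam k q D0 (d xi) (d (r1 + eps / 2)) (4 * M2) (MP + MQ)
    HL Hk HD0 (Rlt_le _ _ Hq)).
  assert (Cest : Rabs (d xi * L / Lam - / k * d (r1 + eps / 2)) <= K * L).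
  { apply Ck; auto.
    - unfold Lam. lra.
    - replace (Lam - L * k) with ((ln S2 - ln r1 - L / (2 * r1))
        + (ln (r1 + r2 + eps - S1) - ln r2 - L / (2 * r2))) by (unfold Lam, k; field; lra).
      eapply Rle_trans; [apply Rabs_triang|]. unfold q. lra. }
  assert (Ha : a = 2 * PI * (/ k * d (r1 + eps / 2))).
  { unfold a, acoef. rewrite En, Em.
    destruct (HP' (padd c1 (pscal (r1 + eps / 2) e))) as (hg & _).
    unfold grad. rewrite (hasgrad_dx _ _ _ _ hg), (hasgrad_dy _ _ _ _ hg).
    unfold pdot, d, k; simpl fst; simpl snd. field. lra. }
  assert (Hal : al = 2 * PI * (d xi * L / Lam)).
  { unfold al. rewrite HLamE, Exi. field. lra. }
  assert (Hdiff : Rabs (al - a) <= 2 * PI * (K * L)).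
  { rewrite Ha, Hal. rewrite <- Rmult_minus_distr_l, Rabs_mult, (Rabs_pos_eq (2 * PI)) by lra.
    apply Rmult_le_compat_l; lra. }
  assert (HK : 0 <= K).
  { pose proof (Rabs_pos (d xi * L / Lam - / k * d (r1 + eps / 2))). nra. }
  assert (Dh : 0 < pdist x p1 /\ 0 < pdist x p2).
  { destruct HE. apply (fixed_pair_apart c1 r1 c2 r2); auto; lra. }
  destruct Dh as [Dh1 Dh2].
  (* By [I1] and [J1] each p_j lies at depth at least L r_j / (2 D0) inside its disk, so the product
     of the two distances is at least a multiple of L^2. The resulting 1 / L cancels the L in
     [Hdiff]. *)
  assert (Gh : pnorm (grad (hfun p1 p2) x) <= / (2 * PI) * (4 * D0 ^ 2 / (r1 * r2) / L)).
  { rewrite (pnorm_grad_hfun p1 p2 x Dh1 Dh2).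
    apply Rmult_le_compat_l; [left; apply Rinv_0_lt_compat; lra|].
    assert (EL : pdist p1 p2 = L).
    { rewrite Ep1, Ep2, pdist_sym. unfold pdist. apply pnorm_eq_nonneg; [lra|].
      unfold psub, padd, pscal; simpl fst; simpl snd. unfold L.
      replace ((fst c1 + S2 * fst e - (fst c1 + S1 * fst e)) ^ 2 + (snd c1 + S2 * snd e - (snd c1 + S1 * snd e)) ^ 2)
        with ((S2 - S1) ^ 2 * (fst e ^ 2 + snd e ^ 2)) by ring. rewrite Ee. ring. }
    rewrite EL. destruct HE as [HE1 HE2].
    pose proof (pdist_triangle x p1 c1) as T1. pose proof (pdist_triangle x p2 c2) as T2.
    rewrite d11 in T1. rewrite d22 in T2.
    set (x1 := L * (r1 / (2 * D0))) in *. set (x2 := L * (r2 / (2 * D0))) in *.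
    assert (0 < x1) by (apply Rmult_lt_0_compat; [lra|apply Rdiv_lt_0_compat; lra]).
    assert (0 < x2) by (apply Rmult_lt_0_compat; [lra|apply Rdiv_lt_0_compat; lra]).
    replace (4 * D0 ^ 2 / (r1 * r2) / L) with (L * / (x1 * x2)) by (unfold x1, x2; field; lra).
    apply Rmult_le_compat_l; [lra|]. apply Rinv_le_contravar; [nra|].
    apply Rmult_le_compat; lra. }
  set (b0 := fun q => u q - al * hfun p1 p2 q) in *.
  assert (Hu : harm (ext2 c1 r1 c2 r2) u).
  { apply harmonic_on_harm; [apply popen_ext2|apply Hsol]. }
  assert (hh : harm (ext2 c1 r1 c2 r2) (hfun p1 p2)) by now apply harm_hfun_ext2.
  assert (Gb : grad b x = padd (grad b0 x) (pscal (al - a) (grad (hfun p1 p2) x))).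
  { assert (Du := harm_grad _ _ _ Hu HE). assert (Dh := harm_grad _ _ _ hh HE).
    assert (Db := hasgrad_minus _ _ _ _ _ _ _ Du (hasgrad_scal a _ _ _ _ Dh)).
    assert (Db0 := hasgrad_minus _ _ _ _ _ _ _ Du (hasgrad_scal al _ _ _ _ Dh)).
    cbv beta in Db, Db0. fold b in Db. fold b0 in Db0. unfold grad.
    rewrite (hasgrad_dx _ _ _ _ Db), (hasgrad_dy _ _ _ _ Db), (hasgrad_dx _ _ _ _ Db0), (hasgrad_dy _ _ _ _ Db0).
    unfold padd, pscal; simpl. f_equal; ring. }
  rewrite Gb. eapply Rle_trans; [apply pnorm_triangle|]. apply Rplus_le_compat; auto.
  rewrite pnorm_pscal.
  apply Rle_trans with (2 * PI * (K * L) * (/ (2 * PI) * (4 * D0 ^ 2 / (r1 * r2) / L))).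
  - apply Rmult_le_compat; auto using Rabs_pos, pnorm_ge_0.
  - right. field. lra.
Qed.
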